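(* Let $(M,F)$ be a homogeneous Finsler surface (i.e. $\dim M=2$) which is a Landsberg surface, that is, its Landsberg curvature ${\bf L}$ vanishes identically. Then $F$ has isotropic flag curvature: there is a function ${\bf K}:M\to\mathbb{R}$ such that for every $x\in M$ and every $y\in T_xM\setminus\{0\}$ the flag curvature of $F$ at $x$ with flagpole $y$ equals ${\bf K}(x)$.
   Context: A Finsler metric on a smooth manifold $M$ is a continuous function $F:TM\to[0,\infty)$, smooth on the slit tangent bundle $TM_0=TM\setminus\{0\}$, positively $1$-homogeneous on each fibre ($F(x,\lambda y)=\lambda F(x,y)$ for $\lambda>0$), with positive definite fundamental tensor $g_{ij}(x,y)=\frac12\frac{\partial^2 F^2}{\partial y^i\partial y^j}$ on $TM_0$; write $(g^{ij})=(g_{ij})^{-1}$ and $\mathbf{g}_y(u,v)=g_{ij}(x,y)u^iv^j$. Here $(x^i,y^i)$ are standard local coordinates on $TM$, and the summation convention is used. A Finsler surface is a Finsler manifold of dimension $2$. The spray coefficients of $F$ are $G^i=\frac14 g^{ij}\left\{\frac{\partial^2 F^2}{\partial x^k\partial y^j}y^k-\frac{\partial F^2}{\partial x^j}\right\}$. The Berwald curvature is $B^i_{\ jkl}=\frac{\partial^3G^i}{\partial y^j\partial y^k\partial y^l}$, i.e. ${\bf B}_y(u,v,w)=B^i_{\ jkl}(y)u^jv^kw^l\frac{\partial}{\partial x^i}$. The Landsberg curvature is ${\bf L}_y(u,v,w)=-\frac12\mathbf{g}_y({\bf B}_y(u,v,w),y)$ for $y\in T_xM\setminus\{0\}$, $u,v,w\in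 T_xM$. $F$ is a Landsberg metric if ${\bf L}=0$. The Riemann curvature is the linear map ${\bf R}_y:T_xM\to T_xM$, ${\bf R}_y(u)=R^i_k(y)u^k\frac{\partial}{\partial x^i}$, where $R^i_k=2\frac{\partial G^i}{\partial x^k}-\frac{\partial^2G^i}{\partial x^j\partial y^k}y^j+2G^j\frac{\partial^2G^i}{\partial y^j\partial y^k}-\frac{\partial G^i}{\partial y^j}\frac{\partial G^j}{\partial y^k}$. For a flag $P=\mathrm{span}\{y,u\}\subset T_xM$ with flagpole $y$, the flag curvature is ${\bf K}(x,y,P)=\frac{\mathbf{g}_y(u,{\bf R}_y(u))}{\mathbf{g}_y(y,y)\mathbf{g}_y(u,u)-\mathbf{g}_y(y,u)^2}$. On a surface the only flag at $x$ is $P=T_xM$, so the flag curvature is a function ${\bf K}(x,y)$ on $TM_0$. Isotropic flag curvature means ${\bf K}={\bf K}(x)$ depends only on $x$. $(M,F)$ is homogeneous if its group of isometries (diffeomorphisms $\varphi$ of $M$ with $F\circ d\varphi=F$) acts transitively on $M$. *)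

(* Defs.v *)
From HB Require Import structures.
From mathcomp Require Import all_boot all_order all_algebra.
From mathcomp Require Import all_classical all_reals all_analysis.

Set Implicit Arguments.
Unset Strict Implicit.
Unset Printing Implicit Defensive.

Import Order.TTheory GRing.Theory Num.Theory.
Import numFieldNormedType.Exports.

Local Open Scope classical_set_scope.
Local Open Scope ring_scope.

Section Smooth.
Context {R : realType} {V W : normedModType R}.

Fixpoint iter_derive (vs : seq V) (f : V -> W) : V -> W :=
  if vs is v :: vs' then 'D_v (iter_derive vs' f) else f.

(* C^infinity on the open set A: every iterated directional derivative is
   Frechet differentiable (hence continuous) at each point of A. *)
Definition smooth_on (A : set V) (f : V -> W) : Prop :=
  forall (vs : seq V) (x : V), A x -> differentiable (iter_derive vs f) x.

End Smooth.

(* [chart_dom] and [chart_cod] are the domain and the image of the chart; the total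
   functions [chart_map] and [chart_inv] are arbitrary outside of them. *)
Record chart (R : realType) (n : nat) (M : topologicalType) := Chart {
  chart_dom : set M ;
  chart_cod : set 'rV[R]_n ;
  chart_map : M -> 'rV[R]_n ;
  chart_inv : 'rV[R]_n -> M ;
  chart_dom_open : open chart_dom ;
  chart_cod_open : open chart_cod ;
  chart_map_cod : forall p, chart_dom p -> chart_cod (chart_map p) ;
  chart_inv_dom : forall x, chart_cod x -> chart_dom (chart_inv x) ;
  chart_mapK : forall p, chart_dom p -> chart_inv (chart_map p) = p ;
  chart_invK : forall x, chart_cod x -> chart_map (chart_inv x) = x ;
  chart_map_continuous : {within chart_dom, continuous chart_map} ;
  chart_inv_continuous : {within chart_cod, continuous chart_inv} }.

(* The smooth structure is given by an indexed smooth atlas, not necessarily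
   maximal. *)
Record manifold (R : realType) (n : nat) := Manifold {
  space :> topologicalType ;
  chart_index : Type ;
  atlas : chart_index -> chart R n space ;
  space_hausdorff : hausdorff_space space ;
  space_second_countable : @second_countable space ;
  atlas_cover : forall p : space, exists i, chart_dom (atlas i) p ;
  atlas_smooth : forall i j,
    smooth_on (chart_map (atlas i) @` (chart_dom (atlas i) `&` chart_dom (atlas j)))
      (chart_map (atlas j) \o chart_inv (atlas i)) }.

Section Tangent.
Context {R : realType} {n : nat} (M : manifold R n).
Implicit Types (p : M) (i j : chart_index M).

(* A tangent vector at p is the family (v i)_i of its components in the charts
   around p, related by the Jacobians of the changes of coordinates; the
   irrelevant entries, at the charts not containing p, are set to 0. *)
Definition tangent p : set (chart_index M -> 'rV[R]_n) :=
  [set v | (forall i j, chart_dom (atlas i) p -> chart_dom (atlas j) p ->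
              v j = 'd (chart_map (atlas j) \o chart_inv (atlas i))
                       (chart_map (atlas i) p) (v i)) /\
           (forall i, ~ chart_dom (atlas i) p -> v i = 0)].

(* The tangent vector y^k d/dx^k at p, where x is the i-th chart. *)
Definition vec_of_comp i p (y : 'rV[R]_n) : chart_index M -> 'rV[R]_n :=
  fun j => if `[< chart_dom (atlas j) p >]
           then 'd (chart_map (atlas j) \o chart_inv (atlas i)) (chart_map (atlas i) p) y
           else 0.

Definition chart_around p : chart_index M := sval (cid (atlas_cover p)).

Definition smooth_map (phi : M -> M) : Prop :=
  continuous phi /\
  forall i j,
    smooth_on (chart_map (atlas i) @` (chart_dom (atlas i) `&` phi @^-1` chart_dom (atlas j)))
      (chart_map (atlas j) \o phi \o chart_inv (atlas i)).

Definition diffeomorphism (phi : M -> M) : Prop :=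
  exists psi : M -> M,
    [/\ smooth_map phi, smooth_map psi, cancel phi psi & cancel psi phi].

(* d phi at p; by the chain rule, the choice of the chart around p is
   immaterial for smooth phi and v in [tangent p]. *)
Definition tangent_map (phi : M -> M) p (v : chart_index M -> 'rV[R]_n) :
    chart_index M -> 'rV[R]_n :=
  let i := chart_around p in
  fun j => if `[< chart_dom (atlas j) (phi p) >]
           then 'd (chart_map (atlas j) \o phi \o chart_inv (atlas i))
                   (chart_map (atlas i) p) (v i)
           else 0.

End Tangent.

(* Local expressions, in standard coordinates z = (x, y), of the tensors
   attached to a function L = L(x, y). *)
Section LocalFormulas.
Context {R : realType} {n : nat}.
Local Notation TU := ('rV[R]_n * 'rV[R]_n)%type.
Implicit Types (f : TU -> R) (z : TU) (u v w : 'rV[R]_n) (i j k l : 'I_n).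

Definition dx k f : TU -> R := 'D_(delta_mx 0 k, 0) f.
Definition dy k f : TU -> R := 'D_(0, delta_mx 0 k) f.

Variable L : TU -> R.

Let L2 : TU -> R := fun z => L z ^+ 2.

Definition fund i j : TU -> R := fun z => 2^-1 * dy i (dy j L2) z.

Definition fund_inv i j : TU -> R :=
  fun z => invmx (\matrix_(a, b) fund a b z) i j.

Definition gform z u v : R :=
  \sum_i \sum_j fund i j z * u 0 i * v 0 j.

Definition spray i : TU -> R := fun z =>
  4^-1 * \sum_j fund_inv i j z *
           (\sum_k dx k (dy j L2) z * z.2 0 k - dx j L2 z).

Definition berwald_coef i j k l : TU -> R := dy j (dy k (dy l (spray i))).

Definition berwald z u v w : 'rV[R]_n :=
  \row_i \sum_j \sum_k \sum_l berwald_coef i j k l z * u 0 j * v 0 k * w 0 l.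

Definition landsberg z u v w : R := - 2^-1 * gform z (berwald z u v w) z.2.

Definition riemann_coef i k : TU -> R := fun z =>
  2 * dx k (spray i) z
  - \sum_j dx j (dy k (spray i)) z * z.2 0 j
  + 2 * (\sum_j spray j z * dy j (dy k (spray i)) z)
  - \sum_j dy j (spray i) z * dy k (spray j) z.

Definition riemann z u : 'rV[R]_n :=
  \row_i \sum_k riemann_coef i k z * u 0 k.

Definition flag_curv z u : R :=
  gform z u (riemann z u) /
  (gform z z.2 z.2 * gform z u u - gform z z.2 u ^+ 2).

End LocalFormulas.

Section LocalExpression.
Context {R : realType} {n : nat} (M : manifold R n).

(* (x, y) |-> F (x, y^k d/dx^k) in the i-th chart. *)
Definition local_expr (F : M -> (chart_index M -> 'rV[R]_n) -> R) (i : chart_index M) :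
    'rV[R]_n * 'rV[R]_n -> R :=
  fun z => let p := chart_inv (atlas i) z.1 in F p (vec_of_comp i p z.2).

End LocalExpression.

(* Only the values [F p v] with v in [tangent p] are meaningful. *)
Record finsler (R : realType) (n : nat) (M : manifold R n) := Finsler {
  finsler_fun :> M -> (chart_index M -> 'rV[R]_n) -> R ;
  finsler_ge0 : forall p v, tangent p v -> 0 <= finsler_fun p v ;
  finsler_homog : forall p v (a : R), tangent p v -> 0 < a ->
    finsler_fun p (a *: v) = a * finsler_fun p v ;
  finsler_continuous : forall i,
    {within [set z | chart_cod (atlas i) z.1], continuous (local_expr finsler_fun i)} ;
  finsler_smooth : forall i,
    smooth_on [set z | chart_cod (atlas i) z.1 /\ z.2 != 0]
      (local_expr finsler_fun i) ;
  finsler_posdef : forall i z u, chart_cod (atlas i) z.1 -> z.2 != 0 -> u != 0 ->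
    0 < gform (local_expr finsler_fun i) z u u }.

Section FinslerGeometry.
Context {R : realType} {n : nat} {M : manifold R n} (F : finsler M).

Definition isometry (phi : M -> M) : Prop :=
  diffeomorphism phi /\
  forall p v, tangent p v -> F (phi p) (tangent_map phi p v) = F p v.

Definition homogeneous : Prop :=
  forall p q : M, exists2 phi, isometry phi & phi p = q.

Definition landsberg_metric : Prop :=
  forall (p : M) y u v w,
    tangent p y -> y <> 0 -> tangent p u -> tangent p v -> tangent p w ->
    forall i, chart_dom (atlas i) p ->
      landsberg (local_expr F i) (chart_map (atlas i) p, y i) (u i) (v i) (w i) = 0.

Definition lin_indep (y u : chart_index M -> 'rV[R]_n) : Prop :=
  forall a b : R, a *: y + b *: u = 0 -> a = 0 /\ b = 0.

(* K(x, y, P) = k for the flag P = span {y, u}. *)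
Definition flag_curvature_is (p : M) (y u : chart_index M -> 'rV[R]_n) (k : R) : Prop :=
  forall i, chart_dom (atlas i) p ->
    flag_curv (local_expr F i) (chart_map (atlas i) p, y i) (u i) = k.

Definition isotropic_flag_curvature : Prop :=
  exists K : M -> R, forall (p : M) y,
    tangent p y -> y <> 0 ->
    forall u, tangent p u -> lin_indep y u -> flag_curvature_is p y u (K p).

End FinslerGeometry.

(* Main.v *)
(* On the slit tangent bundle let S be the geodesic spray, V the vertical field
   orthogonal to the flagpole y and of the same length, H = [V, S], I the main
   scalar, E half the squared norm and K the flag curvature. For a Landsberg
   metric [S, H] = 2 E K V and [V, H] = - S - I H, and the Jacobi identity gives
   S I = 0 and V K = - I K. Hence S (V I) = - H I and S (H I) = 2 E K V I.

   By homogeneity all fibres carry the same pair (I, V I), up to the sign of I.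
   On a single fibre the points where I = c and V I <> 0 are isolated, so V I
   takes only countably many nonzero values on {I = c}. Through a point with
   V I <> 0 there is a curve in {I = c} tangent to S, on which V I is continuous,
   hence constant. So S (V I) = 0 wherever V I <> 0; there H I = 0 and then
   K V I = 0. Therefore I is locally constant on a fibre wherever K <> 0. At a
   maximum of |K| on the fibre V K = - I K forces I = 0, and an open-closed
   argument shows that K is constant along the fibre. *)
From HB Require Import structures.
From mathcomp Require Import all_boot all_order all_algebra.
From mathcomp Require Import all_classical all_reals all_analysis.
From mathcomp Require Import ring lra.
Require Import Defs.

Set Implicit Arguments.
Unset Strict Implicit.
Unset Printing Implicit Defensive.

Import Order.TTheory GRing.Theory Num.Theory.
Import numFieldNormedType.Exports.

Local Open Scope classical_set_scope.
Local Open Scope ring_scope.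

(** * Derivations and the fundamental frame of a Finsler surface *)

(** Transitivity of the isometry group is available only as a statement about points: no isometry is
    chosen continuously, and there are no Killing fields to differentiate along. So homogeneity
    yields nothing but the set of values taken by [I] and [V I], without any differentiable relation
    between them. Counting values and then using continuity is what replaces regularity in the
    transverse directions. Values of the curvature over different points of the surface never have
    to be compared.

    The bracket calculus takes place in a commutative ring without 2-torsion, with four commuting
    derivations, in which [E] and the square root [s] of the determinant are invertible. Adjoining
    [s] makes [V] and [I] polynomial expressions, so each identity is a linear combination of known
    ones, checked by [ring]. The price is that [s] is natural only up to sign, which is the origin
    of the sign of [I]. *)

Section LinComb.
Variable A : comPzRingType.
Implicit Types a b c l r : A.

(** A certificate for an equation in an ideal: once the cofactors are supplied, what remains is a
    polynomial identity for [ring]. Most of the tensor calculus below is reduced to such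
    certificates. *)
Lemma lin_comb1 c1 l1 r1 a b : l1 = r1 -> a - b = c1 * (l1 - r1) -> a = b.
Proof. by move=> -> /eqP; rewrite subrr mulr0 subr_eq0 => /eqP. Qed.

Lemma lin_comb2 c1 c2 l1 r1 l2 r2 a b : l1 = r1 -> l2 = r2 ->
  a - b = c1 * (l1 - r1) + c2 * (l2 - r2) -> a = b.
Proof. by move=> -> -> /eqP; rewrite !subrr !mulr0 addr0 subr_eq0 => /eqP. Qed.

Lemma lin_comb3 c1 c2 c3 l1 r1 l2 r2 l3 r3 a b : l1 = r1 -> l2 = r2 -> l3 = r3 ->
  a - b = c1 * (l1 - r1) + c2 * (l2 - r2) + c3 * (l3 - r3) -> a = b.
Proof. by move=> -> -> -> /eqP; rewrite !subrr !mulr0 !addr0 subr_eq0 => /eqP. Qed.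

Lemma lin_comb4 c1 c2 c3 c4 l1 r1 l2 r2 l3 r3 l4 r4 a b :
  l1 = r1 -> l2 = r2 -> l3 = r3 -> l4 = r4 ->
  a - b = c1 * (l1 - r1) + c2 * (l2 - r2) + c3 * (l3 - r3) + c4 * (l4 - r4) ->
  a = b.
Proof. by move=> -> -> -> -> /eqP; rewrite !subrr !mulr0 !addr0 subr_eq0 => /eqP. Qed.

Lemma mulI_of_inv s t a b : s * t = 1 -> s * a = s * b -> a = b.
Proof.
move=> st e; have := congr1 (fun z => t * z) e.
by rewrite !mulrA (mulrC t) st !mul1r.
Qed.

End LinComb.
Arguments lin_comb1 {A} c1 {l1 r1 a b}.
Arguments lin_comb2 {A} c1 c2 {l1 r1 l2 r2 a b}.
Arguments lin_comb3 {A} c1 c2 c3 {l1 r1 l2 r2 l3 r3 a b}.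
Arguments lin_comb4 {A} c1 c2 c3 c4 {l1 r1 l2 r2 l3 r3 l4 r4 a b}.

Definition derivation (A : comPzRingType) (D : A -> A) :=
  (forall a b, D (a + b) = D a + D b) /\ (forall a b, D (a * b) = D a * b + a * D b).

Section Derivation.
Variables (A : comPzRingType) (D : A -> A).
Hypothesis hD : derivation D.
Lemma derivD a b : D (a + b) = D a + D b. Proof. by case: hD. Qed.
Lemma derivM a b : D (a * b) = D a * b + a * D b. Proof. by case: hD. Qed.
Lemma deriv0 : D 0 = 0.
Proof. by apply: (addrI (D 0)); rewrite -derivD !addr0. Qed.
Lemma derivN a : D (- a) = - D a.
Proof. by apply: (addrI (D a)); rewrite -derivD !subrr deriv0. Qed.
Lemma derivB a b : D (a - b) = D a - D b. Proof. by rewrite derivD derivN. Qed.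
Lemma deriv1 : D 1 = 0.
Proof. by have := derivM 1 1; rewrite !mulr1 mul1r -[LHS]addr0 => /addrI. Qed.
Definition derivE := (derivD, derivM, derivN).
End Derivation.

(* The coordinates and partial derivatives of the ring of smooth functions on
   (an open part of) the tangent bundle of a surface. *)
Record tring := TRing {
  tcar :> comPzRingType;
  x1 : tcar; x2 : tcar; y1 : tcar; y2 : tcar;
  X1 : tcar -> tcar; X2 : tcar -> tcar; Y1 : tcar -> tcar; Y2 : tcar -> tcar;
  X1d : derivation X1; X2d : derivation X2; Y1d : derivation Y1; Y2d : derivation Y2;
  XX : forall f, X2 (X1 f) = X1 (X2 f);
  YX11 : forall f, Y1 (X1 f) = X1 (Y1 f);
  YX12 : forall f, Y1 (X2 f) = X2 (Y1 f);
  YX21 : forall f, Y2 (X1 f) = X1 (Y2 f);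
  YX22 : forall f, Y2 (X2 f) = X2 (Y2 f);
  YY : forall f, Y2 (Y1 f) = Y1 (Y2 f);
  X1x1 : X1 x1 = 1; X1x2 : X1 x2 = 0; X1y1 : X1 y1 = 0; X1y2 : X1 y2 = 0;
  X2x1 : X2 x1 = 0; X2x2 : X2 x2 = 1; X2y1 : X2 y1 = 0; X2y2 : X2 y2 = 0;
  Y1x1 : Y1 x1 = 0; Y1x2 : Y1 x2 = 0; Y1y1 : Y1 y1 = 1; Y1y2 : Y1 y2 = 0;
  Y2x1 : Y2 x1 = 0; Y2x2 : Y2 x2 = 0; Y2y1 : Y2 y1 = 0; Y2y2 : Y2 y2 = 1;
  tring_torsion : forall f : tcar, f + f = 0 -> f = 0 }.

Arguments x1 {t}. Arguments x2 {t}. Arguments y1 {t}. Arguments y2 {t}.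

(* E is half the squared norm, s the square root of the determinant of the
   fundamental tensor, G the spray. *)
Record fdata (A : tring) := FData {
  E : A; Ei : A; s : A; si : A; G1 : A; G2 : A;
  EEi : E * Ei = 1;
  ssi : s * si = 1;
  euler : y1 * Y1 E + y2 * Y2 E = E + E;
  s2 : s * s = Y1 (Y1 E) * Y2 (Y2 E) - Y1 (Y2 E) * Y1 (Y2 E);
  G1E : Y1 (Y1 E) * (G1 + G1) + Y1 (Y2 E) * (G2 + G2) =
        y1 * X1 (Y1 E) + y2 * X2 (Y1 E) - X1 E;
  G2E : Y1 (Y2 E) * (G1 + G1) + Y2 (Y2 E) * (G2 + G2) =
        y1 * X1 (Y2 E) + y2 * X2 (Y2 E) - X2 E }.

Section FinslerAlgebra.
Variables (A : tring) (F : fdata A).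
Let X1d := @X1d A. Let X2d := @X2d A. Let Y1d := @Y1d A. Let Y2d := @Y2d A.
Notation E := (E F). Notation G1 := (G1 F). Notation G2 := (G2 F).
Notation s := (s F). Notation si := (si F).
Notation E1 := (Y1 E). Notation E2 := (Y2 E).
Notation g11 := (Y1 (Y1 E)). Notation g12 := (Y1 (Y2 E)). Notation g22 := (Y2 (Y2 E)).

Definition dE := (derivE X1d, derivE X2d, derivE Y1d, derivE Y2d,
  (XX, YX11, YX12, YX21, YX22, YY),
  (@X1y1 A, @X1y2 A, @X2y1 A, @X2y2 A, @Y1y1 A, @Y1y2 A, @Y2y1 A, @Y2y2 A),
  (@X1x1 A, @X1x2 A, @X2x1 A, @X2x2 A, @Y1x1 A, @Y1x2 A, @Y2x1 A, @Y2x2 A)).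

Lemma tors_eq (a b : A) : a + a = b + b -> a = b.
Proof.
move=> e; apply/eqP; rewrite -subr_eq0; apply/eqP/tring_torsion.
by rewrite addrACA e -opprD subrr.
Qed.

Lemma s_inj (a b : A) : s * a = s * b -> a = b.
Proof. exact/mulI_of_inv/ssi. Qed.

Lemma E_inj (a b : A) : E * a = E * b -> a = b.
Proof. exact/mulI_of_inv/EEi. Qed.

(** Cramer's rule, with the determinant of the fundamental tensor written as the square of the
    invertible [s]. *)
Lemma g_inj (a b c d : A) : g11 * a + g12 * b = g11 * c + g12 * d ->
  g12 * a + g22 * b = g12 * c + g22 * d -> a = c /\ b = d.
Proof.
move=> h1 h2; split; do 2 apply: s_inj; rewrite !mulrA s2.
  by apply: (lin_comb2 g22 (- g12) h1 h2); ring.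
by apply: (lin_comb2 (- g12) g11 h1 h2); ring.
Qed.

Lemma eulerY1 : y1 * g11 + y2 * g12 = E1.
Proof. by have := congr1 (@Y1 A) (euler F); rewrite ?dE => h; apply: (lin_comb1 1 h); ring. Qed.
Lemma eulerY2 : y1 * g12 + y2 * g22 = E2.
Proof. by have := congr1 (@Y2 A) (euler F); rewrite ?dE => h; apply: (lin_comb1 1 h); ring. Qed.
Lemma eulerX1 : y1 * X1 E1 + y2 * X1 E2 = X1 E + X1 E.
Proof. by have := congr1 (@X1 A) (euler F); rewrite ?dE => h; apply: (lin_comb1 1 h); ring. Qed.
Lemma eulerX2 : y1 * X2 E1 + y2 * X2 E2 = X2 E + X2 E.
Proof. by have := congr1 (@X2 A) (euler F); rewrite ?dE => h; apply: (lin_comb1 1 h); ring. Qed.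

(* [geod] is the geodesic spray S, [vert] the vertical field V orthogonal to the
   flagpole and of the same length, [hor] their bracket [V, S], [mscal] the
   main scalar and [jac] the trace of the Riemann curvature, that is [2 E K]. *)
Definition geod (f : A) : A :=
  y1 * X1 f + y2 * X2 f - (G1 + G1) * Y1 f - (G2 + G2) * Y2 f.

Definition vert (f : A) : A := si * (E2 * Y1 f - E1 * Y2 f).

Definition hor (f : A) : A := vert (geod f) - geod (vert f).

Definition mscal : A := si * vert s.

(** The horizontal lifts of the coordinate fields, for the nonlinear connection whose coefficients
    are the vertical derivatives of the spray. *)
Definition H1 (f : A) : A := X1 f - Y1 G1 * Y1 f - Y1 G2 * Y2 f.
Definition H2 (f : A) : A := X2 f - Y2 G1 * Y1 f - Y2 G2 * Y2 f.

Lemma geod_deriv : derivation geod.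
Proof. by split=> a b; rewrite /geod ?dE; ring. Qed.
Lemma vert_deriv : derivation vert.
Proof. by split=> a b; rewrite /vert ?dE; ring. Qed.
Lemma H1_deriv : derivation H1.
Proof. by split=> a b; rewrite /H1 ?dE; ring. Qed.
Lemma H2_deriv : derivation H2.
Proof. by split=> a b; rewrite /H2 ?dE; ring. Qed.

(** Together with [geodY2E], the Euler-Lagrange equations of the energy; they restate the implicit
    definition of the spray without inverting the metric. *)
Lemma geodY1E : geod E1 = X1 E.
Proof. by rewrite /geod ?dE; apply: (lin_comb1 (-1) (G1E F)); ring. Qed.
Lemma geodY2E : geod E2 = X2 E.
Proof. by rewrite /geod ?dE; apply: (lin_comb1 (-1) (G2E F)); ring. Qed.

(** Conservation of energy: contract the two spray equations with [y] and simplify by Euler's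
    relation and its derivatives. *)
Lemma geodE : geod E = 0.
Proof.
apply: tors_eq.
have e1 : E1 * (G1 + G1) + E2 * (G2 + G2) = y1 * X1 E + y2 * X2 E.
  rewrite -[X in X * _ + _]eulerY1 -[X in _ + X * _]eulerY2.
  have h1 := G1E F; have h2 := G2E F; have h3 := eulerX1; have h4 := eulerX2.
  by apply: (lin_comb4 y1 y2 y1 y2 h1 h2 h3 h4); ring.
by rewrite /geod; apply: (lin_comb1 (-2) e1); ring.
Qed.

(** The vertical derivative of [geod E = 0] is twice [H1 E], because the Euler-Lagrange equation
    supplies a second copy of [X1 E]. *)
Lemma H1E : H1 E = 0.
Proof.
apply: tors_eq; have := congr1 (@Y1 A) geodE; rewrite /geod (deriv0 Y1d) ?dE => h.
have h1 := geodY1E; rewrite /geod in h1.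
by rewrite /H1; apply: (lin_comb2 1 (-1) h h1); rewrite ?dE; ring.
Qed.
Lemma H2E : H2 E = 0.
Proof.
apply: tors_eq; have := congr1 (@Y2 A) geodE; rewrite /geod (deriv0 Y2d) ?dE => h.
have h1 := geodY2E; rewrite /geod in h1.
by rewrite /H2; apply: (lin_comb2 1 (-1) h h1); rewrite ?dE; ring.
Qed.

Definition eul (f : A) : A := y1 * Y1 f + y2 * Y2 f.

(** The spray is known only through a linear system. The Euler field annihilates its matrix and
    doubles its right-hand side, so it doubles the solution. *)
Lemma eulG : eul G1 = G1 + G1 /\ eul G2 = G2 + G2.
Proof.
have E0 : eul E = E + E by exact: euler.
have h1 : eul E1 = E1 by rewrite /eul ?dE eulerY1.
have h2 : eul E2 = E2 by rewrite /eul eulerY2.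
have c11 : eul g11 = 0.
  have := congr1 (@Y1 A) h1; rewrite /eul ?dE => h.
  by apply: (lin_comb1 1 h); ring.
have c12 : eul g12 = 0.
  have := congr1 (@Y1 A) h2; rewrite /eul ?dE => h.
  by apply: (lin_comb1 1 h); ring.
have c22 : eul g22 = 0.
  have := congr1 (@Y2 A) h2; rewrite /eul ?dE => h.
  by apply: (lin_comb1 1 h); ring.
have [||k1 k2] := @g_inj (eul G1 + eul G1) (eul G2 + eul G2)
   ((G1 + G1) + (G1 + G1)) ((G2 + G2) + (G2 + G2)); last first.
- by split; apply: tors_eq.
- have := congr1 eul (G2E F); have := G2E F.
  have := congr1 (@X1 A) h2; have := congr1 (@X2 A) h2; have := congr1 (@X2 A) E0.
  rewrite /eul ?dE in h1 h2 c12 c22 * => e1 e2 e3 e4 e5.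
  apply: (lin_comb2 1 (-2) e5 e4).
  apply: (lin_comb4 (- (G1 + G1)) (- (G2 + G2)) y1 y2 c12 c22 e3 e2).
  apply: (lin_comb1 (-1) e1); ring.
- have := congr1 eul (G1E F); have := G1E F.
  have := congr1 (@X1 A) h1; have := congr1 (@X2 A) h1; have := congr1 (@X1 A) E0.
  rewrite /eul ?dE in h1 h2 c12 c11 * => e1 e2 e3 e4 e5.
  apply: (lin_comb2 1 (-2) e5 e4).
  apply: (lin_comb4 (- (G1 + G1)) (- (G2 + G2)) y1 y2 c11 c12 e3 e2).
  apply: (lin_comb1 (-1) e1); ring.
Qed.

(** The entries of the Riemann curvature, upper index first; the terms with second derivatives of
    the spray coefficients that involve [y] or [G] undifferentiated are gathered into [geod]. *)
Definition R11 := X1 G1 + X1 G1 - geod (Y1 G1) - (Y1 G1 * Y1 G1 + Y2 G1 * Y1 G2).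
Definition R12 := X2 G1 + X2 G1 - geod (Y2 G1) - (Y1 G1 * Y2 G1 + Y2 G1 * Y2 G2).
Definition R21 := X1 G2 + X1 G2 - geod (Y1 G2) - (Y1 G2 * Y1 G1 + Y2 G2 * Y1 G2).
Definition R22 := X2 G2 + X2 G2 - geod (Y2 G2) - (Y1 G2 * Y2 G1 + Y2 G2 * Y2 G2).
Definition jac : A := R11 + R22.

(** The vertical part of the bracket of the spray with a horizontal field is the curvature. This
    links the coordinate formula to the frame. *)
Lemma comm_geodH1 f : geod (H1 f) - H1 (geod f) =
  Y1 G1 * H1 f + Y1 G2 * H2 f + R11 * Y1 f + R21 * Y2 f.
Proof. by rewrite /R11 /R21 /H1 /H2 /geod ?dE; ring. Qed.
Lemma comm_geodH2 f : geod (H2 f) - H2 (geod f) =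
  Y2 G1 * H1 f + Y2 G2 * H2 f + R12 * Y1 f + R22 * Y2 f.
Proof. by rewrite /R12 /R22 /H1 /H2 /geod ?dE; ring. Qed.

Lemma R_E1 : R11 * E1 + R21 * E2 = 0.
Proof.
have := comm_geodH1 E; rewrite H1E H2E geodE (deriv0 geod_deriv) (deriv0 H1_deriv).
by rewrite subrr !mulr0 !add0r.
Qed.
Lemma R_E2 : R12 * E1 + R22 * E2 = 0.
Proof.
have := comm_geodH2 E; rewrite H1E H2E geodE (deriv0 geod_deriv) (deriv0 H2_deriv).
by rewrite subrr !mulr0 !add0r.
Qed.

(** Obtained by differentiating the homogeneity relation of the spray coefficients along the spray
    itself. *)
Lemma R_y : R11 * y1 + R12 * y2 = 0 /\ R21 * y1 + R22 * y2 = 0.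
Proof.
have [h1 h2] := eulG.
have e1 := congr1 geod h1; have e2 := congr1 geod h2.
rewrite /R11 /R12 /R21 /R22; rewrite /eul /geod ?dE in h1 h2 e1 e2 *; split.
  apply: (lin_comb1 (-1) e1).
  by apply: (lin_comb2 (- Y1 G1) (- Y2 G1) h1 h2); ring.
apply: (lin_comb1 (-1) e2).
by apply: (lin_comb2 (- Y1 G2) (- Y2 G2) h1 h2); ring.
Qed.

Notation V1 := (si * E2).
Notation V2 := (- (si * E1)).

Lemma vertV f : vert f = V1 * Y1 f + V2 * Y2 f.
Proof. by rewrite /vert; ring. Qed.

(** By [R_E1] and [R_E2] the image of the curvature lies in the kernel of the fibre differential of
    [E]. In dimension two this is the line of [V], on which the endomorphism acts by its trace. *)
Lemma R_V : R11 * V1 + R12 * V2 = jac * V1 /\ R21 * V1 + R22 * V2 = jac * V2.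
Proof.
rewrite /jac; split.
  by apply: (lin_comb1 (- si) R_E2); ring.
by apply: (lin_comb1 si R_E1); ring.
Qed.

Lemma geodH f : geod f = y1 * H1 f + y2 * H2 f.
Proof.
have [h1 h2] := eulG; rewrite /eul in h1 h2.
by rewrite /geod /H1 /H2; apply: (lin_comb2 (Y1 f) (Y2 f) h1 h2); ring.
Qed.

Lemma geodE1 : geod E1 = Y1 G1 * E1 + Y1 G2 * E2.
Proof. by have := H1E; rewrite geodY1E /H1 => h; apply: (lin_comb1 1 h); ring. Qed.
Lemma geodE2 : geod E2 = Y2 G1 * E1 + Y2 G2 * E2.
Proof. by have := H2E; rewrite geodY2E /H2 => h; apply: (lin_comb1 1 h); ring. Qed.

Lemma geod_g11 : geod g11 = (Y1 G1 * g11 + Y1 G2 * g12) + (Y1 G1 * g11 + Y1 G2 * g12).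
Proof.
have := congr1 (@Y1 A) geodY1E; rewrite /geod ?dE => h.
by apply: (lin_comb1 1 h); ring.
Qed.
Lemma geod_g22 : geod g22 = (Y2 G1 * g12 + Y2 G2 * g22) + (Y2 G1 * g12 + Y2 G2 * g22).
Proof.
have := congr1 (@Y2 A) geodY2E; rewrite /geod ?dE => h.
by apply: (lin_comb1 1 h); ring.
Qed.
(** Either Euler-Lagrange equation alone leaves the difference of [X1 E2] and [X2 E1]; the two
    differences cancel in the sum. *)
Lemma geod_g12 : geod g12 = (Y1 G1 * g12 + Y1 G2 * g22) + (Y2 G1 * g11 + Y2 G2 * g12).
Proof.
apply: tors_eq.
have := congr1 (@Y1 A) geodY2E; have := congr1 (@Y2 A) geodY1E; rewrite /geod ?dE => h h'.
by apply: (lin_comb2 1 1 h h'); ring.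
Qed.

(** Differentiates the square root through its square, a polynomial in the metric: [a] is half the
    logarithmic derivative of the determinant. *)
Lemma deriv_s (D : A -> A) (a : A) : derivation D ->
  D g11 * g22 + g11 * D g22 - (D g12 + D g12) * g12 = (a + a) * (s * s) ->
  D s = a * s.
Proof.
move=> hD h; apply: s_inj; apply: tors_eq.
have := congr1 D (s2 F); rewrite !(derivE hD) => h'.
by apply: (lin_comb2 1 1 h h'); ring.
Qed.

Lemma deriv_si (D : A -> A) : derivation D -> D si = - (si * si * D s).
Proof.
move=> hD; have := congr1 D (ssi F); rewrite (derivM hD) (deriv1 hD) => h.
apply: s_inj; have h' := ssi F.
by apply: (lin_comb2 1 (si * D s) h h'); ring.
Qed.

Lemma geod_s : geod s = (Y1 G1 + Y2 G2) * s.
Proof.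
apply: (deriv_s geod_deriv); rewrite s2 geod_g11 geod_g12 geod_g22; ring.
Qed.

(** [V] is parallel along geodesics: [geod_s] provides the normalisation and [geodE2] the
    direction. *)
Lemma geod_V1 : geod V1 = - (Y1 G1 * V1 + Y2 G1 * V2).
Proof.
rewrite (derivM geod_deriv) (deriv_si geod_deriv) geod_s geodE2.
have h := ssi F; apply: (lin_comb1 (- (si * E2 * (Y1 G1 + Y2 G2))) h); ring.
Qed.
Lemma geod_V2 : geod V2 = - (Y1 G2 * V1 + Y2 G2 * V2).
Proof.
rewrite (derivN geod_deriv) (derivM geod_deriv) (deriv_si geod_deriv) geod_s geodE1.
have h := ssi F; apply: (lin_comb1 (si * E1 * (Y1 G1 + Y2 G2)) h); ring.
Qed.

Lemma comm_geodY1 f : geod (Y1 f) - Y1 (geod f) = - H1 f + Y1 G1 * Y1 f + Y1 G2 * Y2 f.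
Proof. by rewrite /geod /H1 ?dE; ring. Qed.
Lemma comm_geodY2 f : geod (Y2 f) - Y2 (geod f) = - H2 f + Y2 G1 * Y1 f + Y2 G2 * Y2 f.
Proof. by rewrite /geod /H2 ?dE; ring. Qed.

(** As [V] is parallel along geodesics, the vertical terms of the bracket cancel and [hor] is the
    horizontal lift of [V]. *)
Lemma horV f : hor f = V1 * H1 f + V2 * H2 f.
Proof.
rewrite /hor !vertV !(derivD geod_deriv) !(derivM geod_deriv V1) !(derivM geod_deriv V2).
rewrite geod_V1 geod_V2; have h1 := comm_geodY1 f; have h2 := comm_geodY2 f.
by apply: (lin_comb2 (- V1) (- V2) h1 h2); ring.
Qed.

Lemma comm_geod_hor f : geod (hor f) - hor (geod f) = jac * vert f.
Proof.
rewrite !horV vertV (derivD geod_deriv) !(derivM geod_deriv V1) !(derivM geod_deriv V2).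
rewrite geod_V1 geod_V2; have h1 := comm_geodH1 f; have h2 := comm_geodH2 f.
have [h3 h4] := R_V.
by apply: (lin_comb4 V1 V2 (Y1 f) (Y2 f) h1 h2 h3 h4); ring.
Qed.

(** The components of [V] are, up to order, sign and the unit [si], those of the fibre differential
    of [E], and pairing the latter with [y] gives [2 E]. This serves to extract scalar identities
    from operator identities tested on coordinates. *)
Lemma V_inj (a : A) : a * V1 = 0 -> a * V2 = 0 -> a = 0.
Proof.
move=> h1 h2; apply: E_inj; apply: tors_eq; rewrite mulr0 addr0.
have h := euler F; have h' := ssi F.
by apply: (lin_comb4 (s * y2) (- s * y1) (- a) (- a * (y1 * E1 + y2 * E2)) h1 h2 h h'); ring.
Qed.

(** * Structure equations of a Landsberg surface *)

Section Landsberg.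
(** Lowering the index of [y] gives the fibre differential of [E], so these are the components of
    the Landsberg tensor up to symmetry and a constant factor. *)
Hypothesis B111 : E1 * Y1 (Y1 (Y1 G1)) + E2 * Y1 (Y1 (Y1 G2)) = 0.
Hypothesis B112 : E1 * Y1 (Y1 (Y2 G1)) + E2 * Y1 (Y1 (Y2 G2)) = 0.
Hypothesis B122 : E1 * Y1 (Y2 (Y2 G1)) + E2 * Y1 (Y2 (Y2 G2)) = 0.
Hypothesis B222 : E1 * Y2 (Y2 (Y2 G1)) + E2 * Y2 (Y2 (Y2 G2)) = 0.

Lemma H1E1 : H1 E1 = Y1 (Y1 G1) * E1 + Y1 (Y1 G2) * E2.
Proof.
have := congr1 (@Y1 A) H1E; rewrite /H1 (deriv0 Y1d) ?dE => h.
by apply: (lin_comb1 1 h); ring.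
Qed.
Lemma H1E2 : H1 E2 = Y1 (Y2 G1) * E1 + Y1 (Y2 G2) * E2.
Proof.
have := congr1 (@Y2 A) H1E; rewrite /H1 (deriv0 Y2d) ?dE => h.
by apply: (lin_comb1 1 h); ring.
Qed.
Lemma H2E1 : H2 E1 = Y1 (Y2 G1) * E1 + Y1 (Y2 G2) * E2.
Proof.
have := congr1 (@Y1 A) H2E; rewrite /H2 (deriv0 Y1d) ?dE => h.
by apply: (lin_comb1 1 h); ring.
Qed.
Lemma H2E2 : H2 E2 = Y2 (Y2 G1) * E1 + Y2 (Y2 G2) * E2.
Proof.
have := congr1 (@Y2 A) H2E; rewrite /H2 (deriv0 Y2d) ?dE => h.
by apply: (lin_comb1 1 h); ring.
Qed.

(** A vertical derivative of [H1E1] and [H1E2] produces the contracted Berwald tensor, which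
    vanishes. So the Berwald connection is metric and preserves the area density [s]. *)
Lemma H1_s : H1 s = (Y1 (Y1 G1) + Y1 (Y2 G2)) * s.
Proof.
have h11 : H1 g11 = (Y1 (Y1 G1) * g11 + Y1 (Y1 G2) * g12) * 2.
  have := congr1 (@Y1 A) H1E1; rewrite /H1 ?dE => h.
  by apply: (lin_comb2 1 1 h B111); ring.
have h12 : H1 g12 = Y1 (Y1 G1) * g12 + Y1 (Y1 G2) * g22 + Y1 (Y2 G1) * g11 + Y1 (Y2 G2) * g12.
  have := congr1 (@Y1 A) H1E2; rewrite /H1 ?dE => h.
  by apply: (lin_comb2 1 1 h B112); ring.
have h22 : H1 g22 = (Y1 (Y2 G1) * g12 + Y1 (Y2 G2) * g22) * 2.
  have := congr1 (@Y2 A) H1E2; rewrite /H1 ?dE => h.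
  by apply: (lin_comb2 1 1 h B122); ring.
by apply: (deriv_s H1_deriv); rewrite s2 h11 h12 h22; ring.
Qed.
Lemma H2_s : H2 s = (Y1 (Y2 G1) + Y2 (Y2 G2)) * s.
Proof.
have h11 : H2 g11 = (Y1 (Y2 G1) * g11 + Y1 (Y2 G2) * g12) * 2.
  have := congr1 (@Y1 A) H2E1; rewrite /H2 ?dE => h.
  by apply: (lin_comb2 1 1 h B112); ring.
have h12 : H2 g12 = Y1 (Y2 G1) * g12 + Y1 (Y2 G2) * g22 + Y2 (Y2 G1) * g11 + Y2 (Y2 G2) * g12.
  have := congr1 (@Y2 A) H2E1; rewrite /H2 ?dE => h.
  by apply: (lin_comb2 1 1 h B122); ring.
have h22 : H2 g22 = (Y2 (Y2 G1) * g12 + Y2 (Y2 G2) * g22) * 2.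
  have := congr1 (@Y2 A) H2E2; rewrite /H2 ?dE => h.
  by apply: (lin_comb2 1 1 h B222); ring.
by apply: (deriv_s H2_deriv); rewrite s2 h11 h12 h22; ring.
Qed.

(** The Landsberg condition makes [V] parallel in every horizontal direction, whereas [geod_V1]
    gives it along geodesics only. *)
Lemma H1_V1 : H1 V1 = - (Y1 (Y1 G1) * V1 + Y1 (Y2 G1) * V2).
Proof.
rewrite (derivM H1_deriv) (deriv_si H1_deriv) H1_s H1E2; have h := ssi F.
by apply: (lin_comb1 (- (si * E2 * (Y1 (Y1 G1) + Y1 (Y2 G2)))) h); ring.
Qed.
Lemma H1_V2 : H1 V2 = - (Y1 (Y1 G2) * V1 + Y1 (Y2 G2) * V2).
Proof.
rewrite (derivN H1_deriv) (derivM H1_deriv) (deriv_si H1_deriv) H1_s H1E1; have h := ssi F.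
by apply: (lin_comb1 (si * E1 * (Y1 (Y1 G1) + Y1 (Y2 G2))) h); ring.
Qed.
Lemma H2_V1 : H2 V1 = - (Y1 (Y2 G1) * V1 + Y2 (Y2 G1) * V2).
Proof.
rewrite (derivM H2_deriv) (deriv_si H2_deriv) H2_s H2E2; have h := ssi F.
by apply: (lin_comb1 (- (si * E2 * (Y1 (Y2 G1) + Y2 (Y2 G2)))) h); ring.
Qed.
Lemma H2_V2 : H2 V2 = - (Y1 (Y2 G2) * V1 + Y2 (Y2 G2) * V2).
Proof.
rewrite (derivN H2_deriv) (derivM H2_deriv) (deriv_si H2_deriv) H2_s H2E1; have h := ssi F.
by apply: (lin_comb1 (si * E1 * (Y1 (Y2 G1) + Y2 (Y2 G2))) h); ring.
Qed.

(** Since [vert y1] is the component [V1], this is one coordinate of the equation [y'' = - y - I y']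
    of the indicatrix, parametrized by the flow of [V]. *)
Lemma vert_V1 : vert V1 = - y1 - mscal * V1.
Proof.
rewrite (derivM vert_deriv) (deriv_si vert_deriv) /mscal.
suff h : si * vert E2 = - y1 by apply: (lin_comb1 1 h); ring.
do 2 apply: s_inj; rewrite /vert ?dE.
have h1 := ssi F; have h2 := s2 F; have h3 := eulerY1; have h4 := eulerY2.
apply: (lin_comb4 ((1 + s * si) * (E2 * g12 - E1 * g22)) y1 (g22) (- g12) h1 h2 h3 h4); ring.
Qed.
Lemma vert_V2 : vert V2 = - y2 - mscal * V2.
Proof.
rewrite (derivN vert_deriv) (derivM vert_deriv) (deriv_si vert_deriv) /mscal.
suff h : si * vert E1 = y2 by apply: (lin_comb1 (-1) h); ring.
do 2 apply: s_inj; rewrite /vert ?dE.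
have h1 := ssi F; have h2 := s2 F; have h3 := eulerY1; have h4 := eulerY2.
apply: (lin_comb4 ((1 + s * si) * (E2 * g11 - E1 * g12)) (- y2) g12 (- g11) h1 h2 h3 h4); ring.
Qed.

(** Parallelism of [V] cancels the connection terms; what is left comes from the equation of the
    indicatrix. *)
Lemma comm_vert_hor f : vert (hor f) - hor (vert f) = - geod f - mscal * hor f.
Proof.
rewrite !horV [vert (_ + _)](derivD vert_deriv) !(derivM vert_deriv V1) !(derivM vert_deriv V2).
rewrite vert_V1 vert_V2 !vertV !(derivD H1_deriv) !(derivD H2_deriv).
rewrite !(derivM H1_deriv V1) !(derivM H1_deriv V2) !(derivM H2_deriv V1) !(derivM H2_deriv V2).
rewrite H1_V1 H1_V2 H2_V1 H2_V2 geodH /H1 /H2 ?dE; ring.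
Qed.

Lemma jacobi f : geod mscal * hor f = - (mscal * jac + vert jac) * vert f.
Proof.
have a1 := comm_vert_hor (geod f).
have a2 : geod (vert (hor f)) - geod (hor (vert f)) =
    - geod (geod f) - (geod mscal * hor f + mscal * geod (hor f)).
  rewrite -(derivB geod_deriv) comm_vert_hor (derivB geod_deriv).
  by rewrite (derivN geod_deriv (geod f)) (derivM geod_deriv mscal).
have a3 := comm_geod_hor (vert f).
have a4 : vert (geod (hor f)) - vert (hor (geod f)) =
    vert jac * vert f + jac * vert (vert f).
  by rewrite -(derivB vert_deriv) comm_geod_hor (derivM vert_deriv jac).
have a5 := comm_geod_hor f.
have h1 : forall g, vert (geod g) = hor g + geod (vert g).
  by move=> g; rewrite /hor subrK.
have a6 : hor (vert (geod f)) = hor (hor f) + hor (geod (vert f)).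
  by rewrite h1 horV [hor (hor f)]horV [hor (geod _)]horV (derivD H1_deriv) (derivD H2_deriv); ring.
rewrite (h1 (hor f)) in a4; rewrite a6 in a1.
move: (hor f) (vert f) (geod f) a1 a2 a3 a4 a5 => h v g a1 a2 a3 a4 a5.
apply: (lin_comb4 (-1) 1 1 (-1) a1 a2 a3 a4).
by apply: (lin_comb1 (-mscal) a5); ring.
Qed.

(** In [jacobi] the coordinates [x1] and [x2] are killed by [V], while [H] maps them to the
    components of [V]. *)
Lemma geod_mscal : geod mscal = 0.
Proof.
have h f : vert f = 0 -> geod mscal * hor f = 0 by rewrite jacobi => ->; rewrite mulr0.
have v1 : vert x1 = 0 by rewrite vertV ?dE; ring.
have v2 : vert x2 = 0 by rewrite vertV ?dE; ring.
have := h _ v1; have := h _ v2; rewrite !horV /H1 /H2 ?dE => e1 e2; apply: V_inj.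
  by rewrite -[RHS]e2; ring.
by rewrite -[RHS]e1; ring.
Qed.

Lemma vert_jac : vert jac = - (mscal * jac).
Proof.
have h f : (mscal * jac + vert jac) * vert f = 0 by apply/eqP; rewrite -oppr_eq0 -mulNr -jacobi geod_mscal mul0r.
apply/eqP; rewrite -subr_eq0 opprK addrC; apply/eqP; apply: V_inj.
  by have := h y1; rewrite (vertV y1) ?dE => e; rewrite -[RHS]e; ring.
by have := h y2; rewrite (vertV y2) ?dE => e; rewrite -[RHS]e; ring.
Qed.

Lemma hor_mscal : hor mscal = - geod (vert mscal).
Proof. by rewrite /hor geod_mscal (deriv0 vert_deriv) add0r. Qed.

Lemma geod_hor_mscal : geod (hor mscal) = jac * vert mscal.
Proof.
have := comm_geod_hor mscal; rewrite geod_mscal [X in _ - X]horV.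
by rewrite (deriv0 H1_deriv) (deriv0 H2_deriv) !mulr0 addr0 subr0.
Qed.

End Landsberg.

(** * Homogeneity of the frame and of its invariants *)

Lemma eul_deriv : derivation eul.
Proof. by split=> a b; rewrite /eul ?dE; ring. Qed.

Lemma eulE : eul E = E + E. Proof. exact: euler. Qed.

Lemma eulY1 f : eul (Y1 f) = Y1 (eul f) - Y1 f.
Proof. by rewrite /eul ?dE; ring. Qed.
Lemma eulY2 f : eul (Y2 f) = Y2 (eul f) - Y2 f.
Proof. by rewrite /eul ?dE; ring. Qed.

Lemma eul_E1 : eul E1 = E1.
Proof. by rewrite eulY1 eulE (derivD Y1d) addrK. Qed.
Lemma eul_E2 : eul E2 = E2.
Proof. by rewrite eulY2 eulE (derivD Y2d) addrK. Qed.

(** The metric coefficients are homogeneous of degree zero, so [deriv_s] applies with logarithmic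
    derivative zero. *)
Lemma eul_s : eul s = 0.
Proof.
have -> : eul s = 0 * s; last by rewrite mul0r.
apply: (deriv_s eul_deriv).
by rewrite (eulY1 E1) (eulY1 E2) (eulY2 E2) eul_E1 eul_E2 !subrr; ring.
Qed.

Lemma eul_vert f : eul (vert f) = vert (eul f).
Proof.
rewrite !vertV (derivD eul_deriv) (derivM eul_deriv V1) (derivM eul_deriv V2).
rewrite (derivN eul_deriv) !(derivM eul_deriv si) (deriv_si eul_deriv) eul_s eul_E1 eul_E2.
by rewrite eulY1 eulY2; ring.
Qed.

Lemma eul_mscal : eul mscal = 0.
Proof.
rewrite /mscal (derivM eul_deriv) (deriv_si eul_deriv) eul_s eul_vert eul_s.
by rewrite (deriv0 vert_deriv); ring.
Qed.

Lemma eul_vert_mscal : eul (vert mscal) = 0.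
Proof. by rewrite eul_vert eul_mscal (deriv0 vert_deriv). Qed.

Lemma eul_geod f : eul (geod f) = geod f + geod (eul f).
Proof.
have [h1 h2] := eulG.
have e : eul (geod f) = geod f + geod (eul f)
   - (eul G1 - (G1 + G1)) * (Y1 f + Y1 f) - (eul G2 - (G2 + G2)) * (Y2 f + Y2 f).
  by rewrite /eul /geod ?dE; ring.
by rewrite e h1 h2 !subrr !mul0r !subr0.
Qed.

Lemma eul_hor f : eul (hor f) = hor f + hor (eul f).
Proof.
rewrite /hor (derivB eul_deriv) eul_vert !eul_geod eul_vert (derivD vert_deriv).
by ring.
Qed.

(** The degree is read off from the bracket [comm_geod_hor], tested on [y1] and [y2], so the
    curvature entries need not be expanded. *)
Lemma eul_jac : eul jac = jac + jac.
Proof.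
have h f : (eul jac - (jac + jac)) * vert f = 0.
  have h1 : eul (geod (hor f)) - eul (hor (geod f)) = eul jac * vert f + jac * vert (eul f).
    by rewrite -eul_vert -(derivM eul_deriv jac) -(derivB eul_deriv) comm_geod_hor.
  rewrite eul_geod eul_hor eul_hor eul_geod (derivD geod_deriv) in h1.
  have h2 : hor (geod f + geod (eul f)) = hor (geod f) + hor (geod (eul f)).
    by rewrite !horV (derivD H1_deriv) (derivD H2_deriv); ring.
  have h3 := comm_geod_hor f; have h4 := comm_geod_hor (eul f).
  rewrite h2 in h1.
  by apply: (lin_comb3 (-1) 2 1 h1 h3 h4); ring.
apply/eqP; rewrite -subr_eq0; apply/eqP; apply: V_inj.
  by have := h y1; rewrite (vertV y1) ?dE => e; rewrite -[RHS]e; ring.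
by have := h y2; rewrite (vertV y2) ?dE => e; rewrite -[RHS]e; ring.
Qed.

Lemma vertE : vert E = 0.
Proof. by rewrite /vert; ring. Qed.

(* The rotation field of the fibre is a multiple of [vert] modulo the Euler field. *)
Lemma rotation_vert f : eul f = 0 ->
  (E + E) * (y1 * Y2 f - y2 * Y1 f) = - ((y1 * y1 + y2 * y2) * (s * vert f)).
Proof.
move=> h; rewrite /vert; have h1 := ssi F; have h2 := euler F; rewrite /eul in h.
apply: (lin_comb3 (y1 * E2 - y2 * E1) ((y1 * y1 + y2 * y2) * (E2 * Y1 f - E1 * Y2 f))
  (- (y1 * Y2 f - y2 * Y1 f)) h h1 h2); ring.
Qed.

End FinslerAlgebra.

(** * Naturality of the frame under changes of coordinates *)

Section Naturality.
(** [phi] abstracts the pullback along the tangent map of a map of the base, [a11] to [a22] form its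
    Jacobian, and [di] inverts the Jacobian determinant. The Jacobian is constant on fibres and its
    rows are closed. *)
Variables (A A' : tring) (F : fdata A) (F' : fdata A') (phi : A' -> A).
Variables (a11 a12 a21 a22 di : A).
Hypotheses (phiD : forall f g, phi (f + g) = phi f + phi g)
  (phiM : forall f g, phi (f * g) = phi f * phi g) (phi1 : phi 1 = 1).
Hypotheses (phiy1 : phi y1 = a11 * y1 + a12 * y2) (phiy2 : phi y2 = a21 * y1 + a22 * y2).
Hypotheses (Y1a11 : Y1 a11 = 0) (Y1a12 : Y1 a12 = 0) (Y1a21 : Y1 a21 = 0) (Y1a22 : Y1 a22 = 0).
Hypotheses (Y2a11 : Y2 a11 = 0) (Y2a12 : Y2 a12 = 0) (Y2a21 : Y2 a21 = 0) (Y2a22 : Y2 a22 = 0).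
Hypotheses (Xa1 : X2 a11 = X1 a12) (Xa2 : X2 a21 = X1 a22).
Hypotheses (Y1phi : forall f, Y1 (phi f) = phi (Y1 f) * a11 + phi (Y2 f) * a21)
  (Y2phi : forall f, Y2 (phi f) = phi (Y1 f) * a12 + phi (Y2 f) * a22).
Hypotheses
  (X1phi : forall f, X1 (phi f) = phi (X1 f) * a11 + phi (X2 f) * a21 +
     phi (Y1 f) * (X1 a11 * y1 + X1 a12 * y2) + phi (Y2 f) * (X1 a21 * y1 + X1 a22 * y2))
  (X2phi : forall f, X2 (phi f) = phi (X1 f) * a12 + phi (X2 f) * a22 +
     phi (Y1 f) * (X2 a11 * y1 + X2 a12 * y2) + phi (Y2 f) * (X2 a21 * y1 + X2 a22 * y2)).
Hypotheses (phiE : phi (E F') = E F) (detK : (a11 * a22 - a12 * a21) * di = 1).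

Notation X1d := (@X1d A). Notation X2d := (@X2d A).
Notation Y1d := (@Y1d A). Notation Y2d := (@Y2d A).
Notation d := (a11 * a22 - a12 * a21).
Notation E1' := (phi (Y1 (E F'))). Notation E2' := (phi (Y2 (E F'))).
Notation g11' := (phi (Y1 (Y1 (E F')))). Notation g12' := (phi (Y1 (Y2 (E F')))).
Notation g22' := (phi (Y2 (Y2 (E F')))).

Lemma phi0 : phi 0 = 0.
Proof. by apply: (addrI (phi 0)); rewrite -phiD !addr0. Qed.
Lemma phiN f : phi (- f) = - phi f.
Proof. by apply: (addrI (phi f)); rewrite -phiD !subrr phi0. Qed.
Lemma phiB f g : phi (f - g) = phi f - phi g.
Proof. by rewrite phiD phiN. Qed.

Lemma Y1Ephi : Y1 (E F) = E1' * a11 + E2' * a21. Proof. by rewrite -phiE Y1phi. Qed.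
Lemma Y2Ephi : Y2 (E F) = E1' * a12 + E2' * a22. Proof. by rewrite -phiE Y2phi. Qed.

Definition Ya := (Y1a11, Y1a12, Y1a21, Y1a22, Y2a11, Y2a12, Y2a21, Y2a22).

Lemma s2phi : s F * s F = d * d * (phi (s F') * phi (s F')).
Proof.
rewrite -phiM !s2 phiB !phiM Y1Ephi Y2Ephi !(derivE Y1d) !(derivE Y2d) !Y1phi !Y2phi !Ya YY.
ring.
Qed.

(** By [s2phi] the square of [s] scales by the squared Jacobian determinant. This is the remaining
    sign: whether the chosen roots agree with the orientation. *)
Definition sgn : A := s F * di * phi (si F').

Lemma phi_ssi : phi (s F') * phi (si F') = 1.
Proof. by rewrite -phiM ssi phi1. Qed.

Lemma sgn2 : sgn * sgn = 1.
Proof.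
transitivity ((s F * s F) * (di * di) * (phi (si F') * phi (si F'))).
  by rewrite /sgn; ring.
rewrite s2phi; transitivity ((d * di) * (d * di) * (phi (s F') * phi (si F')) * (phi (s F') * phi (si F'))).
  by ring.
by rewrite detK phi_ssi !mulr1.
Qed.

(** Local constancy of the sign in algebraic form: differentiating [sgn * sgn = 1] gives
    [2 sgn (D sgn) = 0], and [sgn] is invertible. *)
Lemma deriv_sgn D : derivation D -> D sgn = 0.
Proof.
move=> hD; have := congr1 D sgn2; rewrite (derivM hD) (deriv1 hD) [D _ * _]mulrC.
move=> /(@tring_torsion A) /(congr1 (fun z => sgn * z)).
by rewrite mulrA sgn2 mul1r mulr0.
Qed.

Lemma sE : s F = sgn * d * phi (s F').
Proof.
transitivity (s F * (d * di) * (phi (s F') * phi (si F'))); last by rewrite /sgn; ring.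
by rewrite detK phi_ssi !mulr1.
Qed.

Lemma siE : si F = sgn * di * phi (si F').
Proof.
apply: (s_inj (F := F)); rewrite ssi {1}sE.
transitivity ((sgn * sgn) * (d * di) * (phi (s F') * phi (si F'))); last by ring.
by rewrite sgn2 detK phi_ssi !mulr1.
Qed.

Lemma vert_phi f : vert F (phi f) = sgn * phi (vert F' f).
Proof.
rewrite /vert Y1phi Y2phi Y1Ephi Y2Ephi phiM phiB !phiM siE.
set W := _ * phi (Y1 f) - _.
transitivity (sgn * (d * di) * phi (si F') * W); first by rewrite /W; ring.
by rewrite detK; ring.
Qed.

Lemma vert_d : vert F d = 0.
Proof. by rewrite /vert !(derivE Y1d) !(derivE Y2d) !Ya; ring. Qed.

Lemma mscal_phi : mscal F = sgn * phi (mscal F').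
Proof.
rewrite /mscal [s F]sE (derivM (vert_deriv F) (sgn * d)) (derivM (vert_deriv F) sgn d) vert_d (deriv_sgn (vert_deriv F)) vert_phi siE phiM.
transitivity ((sgn * sgn) * (d * di) * sgn * phi (si F') * phi (vert F' (s F'))); first by ring.
by rewrite sgn2 detK; ring.
Qed.

(** [V] and [I] each change by the same sign, so their combination is invariant. *)
Lemma vert_mscal_phi : vert F (mscal F) = phi (vert F' (mscal F')).
Proof.
rewrite {1}mscal_phi (derivM (vert_deriv F)) (deriv_sgn (vert_deriv F)) vert_phi.
by rewrite mul0r add0r mulrA sgn2 mul1r.
Qed.

Lemma d_inj a b c e : a * a11 + b * a21 = c * a11 + e * a21 ->
  a * a12 + b * a22 = c * a12 + e * a22 -> a = c /\ b = e.
Proof.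
move=> h1 h2; split; apply: (mulI_of_inv detK).
  by apply: (lin_comb2 a22 (- a21) h1 h2); ring.
by apply: (lin_comb2 (- a12) a11 h1 h2); ring.
Qed.

Definition Xa := (Xa1, Xa2).

(** [c1] and [c2] are the fibre components of the spray pushed forward by the tangent map. *)
Let c1 := (X1 a11 * y1 + X1 a12 * y2) * y1 + (X2 a11 * y1 + X2 a12 * y2) * y2
  - (G1 F + G1 F) * a11 - (G2 F + G2 F) * a12.
Let c2 := (X1 a21 * y1 + X1 a22 * y2) * y1 + (X2 a21 * y1 + X2 a22 * y2) * y2
  - (G1 F + G1 F) * a21 - (G2 F + G2 F) * a22.

Lemma geod_phi_aux f : geod F (phi f) =
  phi (X1 f) * phi y1 + phi (X2 f) * phi y2 + phi (Y1 f) * c1 + phi (Y2 f) * c2.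
Proof. by rewrite /geod /c1 /c2 X1phi X2phi Y1phi Y2phi phiy1 phiy2; ring. Qed.

Lemma geod_a : [/\ geod F a11 = X1 a11 * y1 + X1 a12 * y2, geod F a12 = X2 a11 * y1 + X2 a12 * y2,
  geod F a21 = X1 a21 * y1 + X1 a22 * y2 & geod F a22 = X2 a21 * y1 + X2 a22 * y2].
Proof. by rewrite /geod !Ya !Xa; split; ring. Qed.

Lemma geod_phiE : geod F E1' = phi (X1 (E F')) /\ geod F E2' = phi (X2 (E F')).
Proof.
have [h11 h12 h21 h22] := geod_a.
have := geodY1E F; have := geodY2E F; rewrite -phiE X1phi X2phi Y1phi Y2phi.
rewrite !(derivD (geod_deriv F)) !(derivM (geod_deriv F) _ a11) !(derivM (geod_deriv F) _ a12).
rewrite !(derivM (geod_deriv F) _ a21) !(derivM (geod_deriv F) _ a22) h11 h12 h21 h22 => e2 e1.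
by apply: d_inj; [apply: (lin_comb1 1 e1)|apply: (lin_comb1 1 e2)]; ring.
Qed.

(** The pushed-forward spray satisfies the Euler-Lagrange system of [F'] by [geod_phiE]; that system
    has a unique solution. *)
Lemma c_phiG : c1 = - (phi (G1 F') + phi (G1 F')) /\ c2 = - (phi (G2 F') + phi (G2 F')).
Proof.
have [] := geod_phiE; rewrite !geod_phi_aux !(YX11, YX12, YX21, YX22, YY) => e1 e2.
have := congr1 phi (G1E F'); have := congr1 phi (G2E F').
rewrite !phiB !phiD !phiM !phiD => h2 h1.
have hd : phi (s F') * phi (s F') = g11' * g22' - g12' * g12'.
  by rewrite -phiM s2 phiB !phiM.
have f1 : g11' * c1 + g12' * c2 = - (g11' * (phi (G1 F') + phi (G1 F')) + g12' * (phi (G2 F') + phi (G2 F'))).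
  by apply: (lin_comb2 1 1 e1 h1); ring.
have f2 : g12' * c1 + g22' * c2 = - (g12' * (phi (G1 F') + phi (G1 F')) + g22' * (phi (G2 F') + phi (G2 F'))).
  by apply: (lin_comb2 1 1 e2 h2); ring.
split; do 2 apply: (mulI_of_inv phi_ssi); rewrite !mulrA hd.
  by apply: (lin_comb2 g22' (- g12') f1 f2); ring.
by apply: (lin_comb2 (- g12') g11' f1 f2); ring.
Qed.

Lemma geod_phi f : geod F (phi f) = phi (geod F' f).
Proof.
have [e1 e2] := c_phiG; rewrite geod_phi_aux e1 e2 /geod.
by rewrite !phiB !phiD !phiM !phiD; ring.
Qed.

Lemma hor_phi f : hor F (phi f) = sgn * phi (hor F' f).
Proof.
rewrite /hor geod_phi !vert_phi (derivM (geod_deriv F)) (deriv_sgn (geod_deriv F)) geod_phi [phi (vert F' (geod F' f) - _)]phiB.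
by ring.
Qed.

(** Comparing the bracket of the spray and [hor] on both sides avoids transforming the individual
    curvature entries, which are not scalars. *)
Lemma jac_phi : jac F = phi (jac F').
Proof.
have h f : (jac F - phi (jac F')) * phi (vert F' f) = 0.
  have := comm_geod_hor F (phi f); rewrite geod_phi !hor_phi (derivM (geod_deriv F)).
  rewrite (deriv_sgn (geod_deriv F)) geod_phi vert_phi => h1.
  have h2 := congr1 phi (comm_geod_hor F' f); rewrite phiB phiM in h2.
  have h3 := sgn2.
  apply: (mulI_of_inv h3).
  by apply: (lin_comb2 (-1) sgn h1 h2); ring.
have v1 : vert F' y1 = si F' * Y2 (E F') by rewrite /vert Y1y1 Y2y1; ring.
have v2 : vert F' y2 = - (si F' * Y1 (E F')) by rewrite /vert Y1y2 Y2y2; ring.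
have k1 := h y1; have k2 := h y2; rewrite v1 v2 phiN !phiM in k1 k2.
have he := congr1 phi (euler F'); rewrite !phiD !phiM phiE in he.
have hs := phi_ssi.
apply/eqP; rewrite -subr_eq0; apply/eqP; apply: (E_inj (F := F)); apply: tors_eq.
move: (jac F - _) k1 k2 => a k1 k2.
apply: (lin_comb4 (phi (s F') * phi y2) (- phi (s F') * phi y1) (- a)
  (- a * (phi y1 * E1' + phi y2 * E2')) k1 k2 he hs); ring.
Qed.

End Naturality.

(** * Smooth functions *)

Section NearEq.
Context {R : realType} {V W : normedModType R}.
Implicit Types (f g : V -> W) (x : V).

Lemma near_eq_is_diff f g x : (\near x, f x = g x) -> differentiable f x ->
  differentiable g x /\ 'd g x = 'd f x :> (V -> W).
Proof.
move=> fg df.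
have fgx : f x = g x by exact: nbhs_singleton fg.
have sh : \forall y \near (0 : V), f (y + x) = g (y + x).
  by move: fg; rewrite (near_shift 0 x); apply: filterS => y; rewrite /= subr0.
have e : g \o shift x = cst (g x) + 'd f x +o_ 0 id.
  apply/eqaddoP => e e0.
  have /eqaddoP/(_ e e0) h := diff_locally df.
  near=> y.
  have : f (y + x) = g (y + x) by near: y.
  have : `|(f \o shift x - (cst (f x) + 'd f x)) y| <= e * `|id y| by near: y.
  by rewrite !fctE /= fgx => + fgy; rewrite fgy.
have dd : 'd g x = 'd f x :> (V -> W) by apply: diff_unique => //; exact: diff_continuous.
split => //; apply/diff_locallyP; rewrite dd; split => //; exact: diff_continuous.
Unshelve. all: by end_near. Qed.

(** Here the function itself is differentiated first, whereas [iter_derive] puts each new derivative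
    outermost. This order suits induction for products, inverses and compositions. *)
Fixpoint Ck n (U : set V) f : Prop :=
  (forall x, U x -> differentiable f x) /\
  (if n is n'.+1 then forall v, Ck n' U ('D_v f) else True).

Lemma Ck_diff n U f x : Ck n U f -> U x -> differentiable f x.
Proof. by case: n => [|n] [h _]; apply: h. Qed.

Lemma CkW n U f : Ck n.+1 U f -> Ck n U f.
Proof.
elim: n f => [|n IH] f [h1 h2]; first by split.
by split=> [|v]; [exact: h1|apply: IH; exact: h2].
Qed.

Lemma iter_derive_rcons vs v f : iter_derive (rcons vs v) f = iter_derive vs ('D_v f).
Proof. by elim: vs => //= w vs ->. Qed.

Lemma smooth_onP U f : smooth_on U f <-> forall n, Ck n U f.
Proof.
split=> [h n|h vs].
  elim: n f h => [|n IH] f h; split => //.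
  - exact: (h [::]).
  - exact: (h [::]).
  - by move=> v; apply: IH => vs x Ux; rewrite -iter_derive_rcons; exact: h.
elim/last_ind: vs f h => [|vs v IH] f h x Ux.
  exact: (Ck_diff (h 0%N) Ux).
rewrite iter_derive_rcons; apply: IH => // n.
by have [_] := h n.+1; exact.
Qed.

Lemma smooth_on_diff U f x : smooth_on U f -> U x -> differentiable f x.
Proof. by move=> /smooth_onP /(_ 0%N) /Ck_diff; apply. Qed.

Lemma smooth_on_derive U f v : smooth_on U f -> smooth_on U ('D_v f).
Proof. by move=> /smooth_onP h; apply/smooth_onP => n; have [_] := h n.+1; exact. Qed.

Lemma smooth_on_sub U U' f : U `<=` U' -> smooth_on U' f -> smooth_on U f.
Proof. by move=> UU h vs x /UU; exact: h. Qed.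

Variable U : set V.
Hypothesis Uo : open U.

Lemma open_near_eq f g x : {in U, f =1 g} -> U x -> \near x, f x = g x.
Proof.
move=> fg Ux; near=> y; apply: fg; rewrite inE; near: y.
exact: open_nbhs_nbhs.
Unshelve. all: by end_near. Qed.

Lemma derive_eq f g v : {in U, f =1 g} -> {in U, 'D_v f =1 'D_v g}.
Proof. by move=> fg x; rewrite inE => Ux; apply/near_eq_derive/open_near_eq. Qed.

Lemma eq_Ck n f g : {in U, f =1 g} -> Ck n U f -> Ck n U g.
Proof.
elim: n f g => [|n IH] f g fg [h1 h2]; split => //.
- by move=> x Ux; apply: (near_eq_is_diff (open_near_eq fg Ux) (h1 _ Ux)).1.
- by move=> x Ux; apply: (near_eq_is_diff (open_near_eq fg Ux) (h1 _ Ux)).1.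
- by move=> v; apply: (IH ('D_v f)); [exact: derive_eq|exact: h2].
Qed.

Lemma eq_smooth_on f g : {in U, f =1 g} -> smooth_on U f -> smooth_on U g.
Proof. by move=> fg /smooth_onP h; apply/smooth_onP => n; apply: eq_Ck fg (h n). Qed.

Lemma Ck_cst n (c : W) : Ck n U (cst c).
Proof.
have e (v : V) : 'D_v (cst c) = cst (0 : W).
  by apply/funext => x; rewrite derive_cst.
elim: n c e => [|n IH] c e; split=> [x _|]; try exact: differentiable_cst; first by [].
by move=> v; rewrite e; apply: IH => w; apply/funext => x; rewrite derive_cst.
Qed.

Lemma Ck_add n f g : Ck n U f -> Ck n U g -> Ck n U (f + g).
Proof.
elim: n f g => [|n IH] f g [f1 f2] [g1 g2];
  (split=> [x Ux|]; first by apply: differentiableD; [exact: f1|exact: g1]).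
  by [].
move=> v; apply: (@eq_Ck _ ('D_v f + 'D_v g)); last first.
  by apply: IH; [exact: f2|exact: g2].
move=> x; rewrite inE => Ux.
have df := diff_derivable (v := v) (f1 _ Ux); have dg := diff_derivable (v := v) (g1 _ Ux).
by rewrite (deriveD df dg).
Qed.

Lemma Ck_opp n f : Ck n U f -> Ck n U (- f).
Proof.
elim: n f => [|n IH] f [f1 f2];
  (split=> [x Ux|]; first by apply: differentiableN; exact: f1).
  by [].
move=> v; apply: (@eq_Ck _ (- 'D_v f)); last by apply: IH; exact: f2.
move=> x; rewrite inE => Ux.
by have df := diff_derivable (v := v) (f1 _ Ux); rewrite (deriveN df).
Qed.

End NearEq.

Section ChainRule.
Context {R : realType} {V V' W : normedModType R}.

Lemma derive_comp (f : V -> V') (g : V' -> W) x v :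
  differentiable f x -> differentiable g (f x) ->
  'D_v (g \o f) x = 'D_('D_v f x) g (f x).
Proof.
move=> df dg; have dfg : differentiable (g \o f) x by exact: differentiable_comp.
by rewrite (deriveE _ dfg) (diff_comp df dg) (deriveE _ df) (deriveE _ dg).
Qed.

End ChainRule.

Section ScalarSmooth.
Context {R : realType} {V : normedModType R}.
Variable U : set V.
Hypothesis Uo : open U.
Implicit Types f g : V -> R.

Lemma Ck_mul n f g : Ck n U f -> Ck n U g -> Ck n U (f * g).
Proof.
elim: n f g => [|n IH] f g hf hg; have [f1 f2] := hf; have [g1 g2] := hg;
  (split=> [x Ux|]; first by apply: differentiableM; [exact: f1|exact: g1]).
  by [].
move=> v; apply: (@eq_Ck _ _ _ _ Uo _ (f * 'D_v g + g * 'D_v f)); last first.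
  apply: Ck_add; first exact: Uo.
    by apply: IH; [exact: CkW|exact: g2].
  by apply: IH; [exact: CkW|exact: f2].
move=> x; rewrite inE => Ux.
have df := diff_derivable (v := v) (f1 _ Ux); have dg := diff_derivable (v := v) (g1 _ Ux).
by rewrite (deriveM df dg).
Qed.

(** The derivative is a product of copies of [1 / f] and a derivative of [f], so the induction
    hypothesis at one order less suffices. *)
Lemma Ck_inv n f : (forall x, U x -> f x != 0) -> Ck n U f ->
  Ck n U (fun x => (f x)^-1).
Proof.
move=> fn0; elim: n => [|n IH] hf; have [f1 f2] := hf;
  (split=> [x Ux|]; first by apply: differentiableV; [exact: f1|exact: fn0]).
  by [].
move=> v; have hi := IH (CkW hf).
apply: (@eq_Ck _ _ _ _ Uo _ (- (((fun x => (f x)^-1) * (fun x => (f x)^-1)) * 'D_v f))); last first.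
  by apply: Ck_opp; [exact: Uo|apply: Ck_mul; [exact: Ck_mul|exact: f2]].
move=> x; rewrite inE => Ux; rewrite deriveV.
+ by rewrite !fctE expr2 /GRing.scale /= -mulNr invfM.
+ exact: fn0.
+ by apply: diff_derivable; exact: f1.
Qed.

Lemma Ck_sqrt n f : (forall x, U x -> 0 < f x) -> Ck n U f ->
  Ck n U (fun x => Num.sqrt (f x)).
Proof.
move=> f0.
have ds (x : V) : U x -> differentiable (Num.sqrt : R -> R) (f x).
  by move=> Ux; apply/derivable1_diffP; apply: ex_derive; apply: is_derive1_sqrt; exact: f0.
elim: n => [|n IH] hf; have [f1 f2] := hf;
  (split=> [x Ux|]; first by apply: (@differentiable_comp _ _ _ _ f Num.sqrt); [exact: f1|exact: ds]).
  by [].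
move=> v; have hs := IH (CkW hf).
apply: (@eq_Ck _ _ _ _ Uo _ ('D_v f * (fun x => ((cst 2 * (fun x => Num.sqrt (f x)) : V -> R) x)^-1))); last first.
  apply: Ck_mul; first exact: f2.
  apply: Ck_inv; last by apply: Ck_mul; [exact: Ck_cst|exact: hs].
  by move=> x Ux; rewrite !fctE mulf_neq0 // gt_eqF // sqrtr_gt0 f0.
move=> x; rewrite inE => Ux.
have dd : is_derive (f x) 1 (Num.sqrt : R -> R) (2 * Num.sqrt (f x))^-1.
  by apply: is_derive1_sqrt; exact: f0.
rewrite [RHS](@derive_comp _ _ _ _ f Num.sqrt); [|exact: f1|exact: ds].
rewrite [RHS]deriveE; last exact: ds.
rewrite -[X in 'd _ _ X]mulr1 -/(_ *: _) linearZ /= -deriveE ?derive_val; last exact: ds.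
by rewrite !fctE.
Qed.

Lemma smooth_on_cst (c : R) : smooth_on U (cst c).
Proof. by apply/smooth_onP => n; apply: Ck_cst. Qed.
Lemma smooth_on_add f g : smooth_on U f -> smooth_on U g -> smooth_on U (f + g).
Proof. by move=> /smooth_onP hf /smooth_onP hg; apply/smooth_onP => n; apply: Ck_add. Qed.
Lemma smooth_on_opp f : smooth_on U f -> smooth_on U (- f).
Proof. by move=> /smooth_onP hf; apply/smooth_onP => n; apply: Ck_opp. Qed.
Lemma smooth_on_mul f g : smooth_on U f -> smooth_on U g -> smooth_on U (f * g).
Proof. by move=> /smooth_onP hf /smooth_onP hg; apply/smooth_onP => n; apply: Ck_mul. Qed.
Lemma smooth_on_inv f : (forall x, U x -> f x != 0) -> smooth_on U f ->
  smooth_on U (fun x => (f x)^-1).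
Proof. by move=> f0 /smooth_onP hf; apply/smooth_onP => n; apply: Ck_inv. Qed.
Lemma smooth_on_sqrt f : (forall x, U x -> 0 < f x) -> smooth_on U f ->
  smooth_on U (fun x => Num.sqrt (f x)).
Proof. by move=> f0 /smooth_onP hf; apply/smooth_onP => n; apply: Ck_sqrt. Qed.

End ScalarSmooth.

(** * Symmetry of second derivatives *)

Section Schwarz.
Context {R : realType} {V : normedModType R}.
Implicit Types (f : V -> R) (u v x : V).

Lemma is_diff_line x u (s : R) : is_diff s (fun t : R => x + t *: u) ( *:%R ^~ u).
Proof.
have -> : (fun t : R => x + t *: u) = cst x + ( *:%R ^~ u) by [].
have h := is_diffD (is_diff_cst x s) (is_diff_scalel s u).
by apply: (is_diff_eq h); rewrite add0r.
Qed.

Lemma derive_line {W : normedModType R} (f : V -> W) x u (s : R) : differentiable f (x + s *: u) ->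
  is_derive s 1 (fun t : R => f (x + t *: u)) ('D_u f (x + s *: u)).
Proof.
move=> df; have dl := is_diff_line x u s.
have dl' : differentiable (fun t : R => x + t *: u) s by exact: ex_diff.
apply: DeriveDef.
  by apply: diff_derivable; apply: (differentiable_comp dl' df).
have -> : (fun t : R => f (x + t *: u)) = f \o (fun t : R => x + t *: u) by [].
rewrite (@derive_comp _ R V W _ _ _ 1 dl' df); congr ('D_ _ f _).
by rewrite (deriveE _ dl') diff_val scale1r.
Qed.

(** The mean value theorem, first in direction [u] for a difference of two values of [f], then in
    direction [v] for ['D_u f]. *)
Lemma second_difference f x u v (h : R) : 0 < h ->
  (forall s t : R, 0 <= s <= h -> 0 <= t <= h ->
    differentiable f (x + s *: u + t *: v) /\
    differentiable ('D_u f) (x + s *: u + t *: v)) ->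
  exists s t : R, [/\ 0 <= s <= h, 0 <= t <= h &
    f (x + h *: u + h *: v) - f (x + h *: u) - f (x + h *: v) + f x =
    h * h * 'D_v ('D_u f) (x + s *: u + t *: v)].
Proof.
move=> h0 hd.
have hh : 0 <= h <= h by apply/andP; split; [exact: ltW|exact: lexx].
have zh : (0 : R) <= 0 <= h by apply/andP; split; [exact: lexx|exact: ltW].
pose g (s : R) := f (x + h *: v + s *: u) - f (x + s *: u).
pose g' (s : R) := 'D_u f (x + h *: v + s *: u) - 'D_u f (x + s *: u).
have dg s : 0 <= s <= h -> is_derive s 1 g (g' s).
  move=> hs; have [d1 _] := hd _ _ hs hh; have [d2 _] := hd _ _ hs zh.
  rewrite scale0r addr0 in d2; rewrite addrAC in d1.
  have D1 := derive_line d1; have D2 := derive_line d2.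
  exact: is_deriveB.
have [s sI es] : exists2 c, c \in `]0, h[%R & g h - g 0 = g' c * (h - 0).
  apply: (@MVT _ g g'); [exact: h0|move=> s|].
    by rewrite in_itv /= => /andP[s0 sh]; apply: dg; rewrite (ltW s0) (ltW sh).
  apply: derivable_within_continuous => s; rewrite in_itv /= => hs.
  by case: (dg _ hs).
have hs : 0 <= s <= h by move: sI; rewrite in_itv /= => /andP[s0 sh]; rewrite (ltW s0) (ltW sh).
pose k (t : R) := 'D_u f (x + s *: u + t *: v).
have dk t : 0 <= t <= h -> is_derive t 1 k ('D_v ('D_u f) (x + s *: u + t *: v)).
  by move=> ht; have [_ d1] := hd _ _ hs ht; apply: derive_line.
have [t tI et] : exists2 c, c \in `]0, h[%R & k h - k 0 = 'D_v ('D_u f) (x + s *: u + c *: v) * (h - 0).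
  apply: (@MVT _ k (fun t => 'D_v ('D_u f) (x + s *: u + t *: v))); [exact: h0|move=> t|].
    by rewrite in_itv /= => /andP[s0 sh]; apply: dk; rewrite (ltW s0) (ltW sh).
  apply: derivable_within_continuous => t; rewrite in_itv /= => ht.
  by case: (dk _ ht).
have ht : 0 <= t <= h by move: tI; rewrite in_itv /= => /andP[s0 sh]; rewrite (ltW s0) (ltW sh).
exists s, t; split => //.
move: es; rewrite {1 2}/g scale0r !addr0 (addrAC x (h *: v)) subr0.
have -> : g' s = k h - k 0 by rewrite /g' /k scale0r addr0 (addrAC x).
rewrite et => es.
set D := 'D_v _ _ in es *; set f1 := f _ in es *; set f2 := f (x + h *: v) in es *.
set f3 := f (x + h *: u) in es *.
have -> : f1 - f3 - f2 + f x = f1 - f3 - (f2 - f x) by ring.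
by rewrite es; ring.
Qed.

Lemma dist_lt_half (a b p e : R) : `|a - p| < e / 2 -> `|b - p| < e / 2 -> `|a - b| <= e.
Proof.
move=> h1 h2; have -> : a - b = (a - p) - (b - p) by ring.
by rewrite [e]splitr; apply: (le_trans (ler_normB _ _)); apply: lerD; exact: ltW.
Qed.

(** The second difference is symmetric in [u] and [v], so the two mixed derivatives agree at
    suitable points arbitrarily close to [x]; continuity concludes. *)
Lemma derive_comm (U : set V) f u v x : open U -> smooth_on U f -> U x ->
  'D_v ('D_u f) x = 'D_u ('D_v f) x.
Proof.
move=> Uo sf Ux; apply/eqP; rewrite -subr_eq0 -normr_le0; apply/ler_addgt0Pl => e e0.
rewrite addr0.
have sm (a b : V) : {for x, continuous ('D_b ('D_a f))}.
  apply: differentiable_continuous; apply: (smooth_on_diff _ Ux).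
  by do 2 apply: smooth_on_derive.
have e2 : 0 < e / 2 by rewrite divr_gt0.
have /cvgrPdist_lt/(_ _ e2) c1 := sm u v.
have /cvgrPdist_lt/(_ _ e2) c2 := sm v u.
have : \forall y \near x, [/\ U y, `|'D_v ('D_u f) x - 'D_v ('D_u f) y| < e / 2 &
     `|'D_u ('D_v f) x - 'D_u ('D_v f) y| < e / 2].
  have c0 : \forall y \near x, U y by exact: open_nbhs_nbhs.
  by apply: filterS3 c0 c1 c2 => y a b c; exact: (And3 a b c).
move=> /nbhs_normP [r /= r0 hr].
(* With this [h] the whole parallelogram lies within [r / 2] of [x]; the summand 1 keeps the
   denominator positive. *)
pose h := r / (2 * (`|u| + `|v| + 1)).
have uv0 : 0 < `|u| + `|v| + 1 by rewrite ltr_wpDl // addr_ge0.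
have h0 : 0 < h by rewrite divr_gt0 // mulr_gt0.
have inb (s t : R) : 0 <= s <= h -> 0 <= t <= h ->
    [/\ U (x + s *: u + t *: v), `|'D_v ('D_u f) x - 'D_v ('D_u f) (x + s *: u + t *: v)| < e / 2 &
     `|'D_u ('D_v f) x - 'D_u ('D_v f) (x + s *: u + t *: v)| < e / 2].
  move=> /andP[s0 sh] /andP[t0 th]; apply: hr => /=.
  rewrite -addrA opprD addrA subrr add0r normrN.
  apply: (le_lt_trans (ler_normD _ _)); rewrite !normrZ !ger0_norm //.
  apply: (@le_lt_trans _ _ (h * (`|u| + `|v| + 1))).
    rewrite !mulrDr mulr1 ler_wpDr ?(ltW h0) //.
    by apply: lerD; apply: ler_wpM2r.
  rewrite /h invfM mulrA mulfVK ?gt_eqF //.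
  by rewrite ltr_pdivrMr // mulr_natr mulr2n ltrDl.
have [s [t [hs ht e1]]] : exists s t : R, [/\ 0 <= s <= h, 0 <= t <= h &
    f (x + h *: u + h *: v) - f (x + h *: u) - f (x + h *: v) + f x =
    h * h * 'D_v ('D_u f) (x + s *: u + t *: v)].
  apply: second_difference => // a b ha hb; have [Uy _ _] := inb _ _ ha hb.
  by split; apply: (smooth_on_diff _ Uy); [exact: sf|apply: smooth_on_derive].
have [t' [s' [ht' hs' e2']]] : exists s t : R, [/\ 0 <= s <= h, 0 <= t <= h &
    f (x + h *: v + h *: u) - f (x + h *: v) - f (x + h *: u) + f x =
    h * h * 'D_u ('D_v f) (x + s *: v + t *: u)].
  apply: second_difference => // a b ha hb; have [Uy _ _] := inb _ _ hb ha.
  by rewrite addrAC; split; apply: (smooth_on_diff _ Uy); [exact: sf|apply: smooth_on_derive].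
have hn : h * h != 0 by rewrite mulf_neq0 // gt_eqF.
have ee : 'D_v ('D_u f) (x + s *: u + t *: v) = 'D_u ('D_v f) (x + s' *: u + t' *: v).
  have E1 : x + h *: v + h *: u = x + h *: u + h *: v by exact: addrAC.
  have E2 : x + t' *: v + s' *: u = x + s' *: u + t' *: v by exact: addrAC.
  rewrite E1 E2 in e2'; apply: (mulfI hn); rewrite -[LHS]e1 -[RHS]e2'.
  by rewrite [in RHS](addrAC (f _)).
have [_ k1 _] := inb _ _ hs ht; have [_ _ k2] := inb _ _ hs' ht'.
rewrite ee in k1; exact: dist_lt_half k1 k2.
Qed.

End Schwarz.

(** * The ring of smooth functions *)

Definition i0 : 'I_2 := ord0.
Definition i1 : 'I_2 := lift ord0 ord0.

Lemma sum_I2 (V : nmodType) (f : 'I_2 -> V) : \sum_i f i = f i0 + f i1.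
Proof. by rewrite big_ord_recl big_ord1. Qed.

Lemma I2P (i : 'I_2) : i = i0 \/ i = i1.
Proof. by case: i => -[|[|//]] h; [left|right]; apply: val_inj. Qed.

Notation TU R := ('rV[R]_2 * 'rV[R]_2)%type.

Section Frame.
Context {R : realType}.
Implicit Types (z w : TU R) (f : TU R -> R).

Definition ex (k : 'I_2) : TU R := (delta_mx 0 k, 0).
Definition ey (k : 'I_2) : TU R := (0, delta_mx 0 k).

Lemma row2_decomp (v : 'rV[R]_2) : v = v 0 i0 *: delta_mx 0 i0 + v 0 i1 *: delta_mx 0 i1.
Proof. by rewrite [LHS]row_sum_delta sum_I2. Qed.

Lemma TU_decomp w : w = w.1 0 i0 *: ex i0 + w.1 0 i1 *: ex i1 +
  (w.2 0 i0 *: ey i0 + w.2 0 i1 *: ey i1).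
Proof.
case: w => a b /=; rewrite /ex /ey.
apply: injective_projections => /=; rewrite ?scaler0 ?addr0 ?add0r; exact: row2_decomp.
Qed.

Lemma derive_frame f z w : differentiable f z ->
  'D_w f z = w.1 0 i0 * 'D_(ex i0) f z + w.1 0 i1 * 'D_(ex i1) f z +
    (w.2 0 i0 * 'D_(ey i0) f z + w.2 0 i1 * 'D_(ey i1) f z).
Proof.
move=> df; rewrite !(deriveE _ df) {1}[w]TU_decomp.
by rewrite !linearD !linearZ.
Qed.

Lemma derive_fiber f z (y : 'rV[R]_2) : differentiable f z ->
  'D_(0, y) f z = y 0 i0 * 'D_(ey i0) f z + y 0 i1 * 'D_(ey i1) f z.
Proof.
move=> df; apply: etrans (derive_frame (0, y) df) _.
move: ('D_(ex i0) f z) ('D_(ex i1) f z) ('D_(ey i0) f z) ('D_(ey i1) f z) => a b c d.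
by rewrite !mxE !mul0r !add0r.
Qed.

Lemma coord1_diff (k : 'I_2) z : is_diff z (fun z => z.1 0 k) (fun w => w.1 0 k).
Proof.
have @l : {linear TU R -> R}.
  by exists (fun z => z.1 0 k); do 2![eexists]; do ?[constructor];
     rewrite /= ?mxE // => ? *; rewrite /= ?mxE //; move=> ?; rewrite /= !mxE.
have lc : continuous l.
  move=> w; apply: (@continuous_comp _ _ _ fst (fun v : 'rV[R]_2 => v 0 k)).
    exact: cvg_fst.
  exact: coord_continuous.
by apply: DiffDef; [exact: (@linear_differentiable _ _ _ l)|exact: (@diff_lin _ _ _ l)].
Qed.

Lemma coord2_diff (k : 'I_2) z : is_diff z (fun z => z.2 0 k) (fun w => w.2 0 k).
Proof.
have @l : {linear TU R -> R}.
  by exists (fun z => z.2 0 k); do 2![eexists]; do ?[constructor];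
     rewrite /= ?mxE // => ? *; rewrite /= ?mxE //; move=> ?; rewrite /= !mxE.
have lc : continuous l.
  move=> w; apply: (@continuous_comp _ _ _ snd (fun v : 'rV[R]_2 => v 0 k)).
    exact: cvg_snd.
  exact: coord_continuous.
by apply: DiffDef; [exact: (@linear_differentiable _ _ _ l)|exact: (@diff_lin _ _ _ l)].
Qed.

Lemma smooth_on_linear (V : normedModType R) (U : set V) (l : V -> R) (dl : V -> R) :
  open U -> (forall x : V, is_diff x l dl) -> smooth_on U l.
Proof.
move=> Uo h; apply/smooth_onP => -[|n].
  by split=> [x _|]; [case: (h x)|].
split=> [x _|v]; first by case: (h x).
have -> : 'D_v l = cst (dl v); last exact: Ck_cst.
apply/funext => x; case: (h x) => d1 d2.
by rewrite (deriveE _ d1) d2.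
Qed.

End Frame.

Record dom (R : realType) := Dom { dset :> set (TU R); dset_open : open dset }.

(** Extension by zero outside the domain turns agreement on the domain into equality, so that the
    ring laws hold for Leibniz equality. *)
Record sf (R : realType) (D : dom R) := Sf {
  sfun :> TU R -> R;
  sf_smooth : smooth_on D sfun;
  sf_supp : forall z, ~ dset D z -> sfun z = 0 }.

Section SmoothRing.
Context {R : realType} {D : dom R}.
Implicit Types f g h : sf D.
Local Notation Do := (@dset_open _ D).

Lemma sf_eq f g : (forall z, dset D z -> f z = g z) -> f = g.
Proof.
case: f g => [f fs f0] [g gs g0] /= e.
have fg : f = g.
  by apply/funext => z; case: (pselect (dset D z)) => [/e//|nz]; rewrite f0 // g0.
by case: _ / fg in gs g0 e *; congr Sf; exact: Prop_irrelevance.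
Qed.

Lemma restr_ex (f : TU R -> R) : smooth_on D f -> {h : sf D | forall z, dset D z -> h z = f z}.
Proof.
move=> hf; pose r z := if `[< dset D z >] then f z else 0.
have rs : smooth_on D r.
  by apply: (eq_smooth_on Do _ hf) => z; rewrite inE => Dz; rewrite /r asboolT.
have r0 z : ~ dset D z -> r z = 0 by move=> nz; rewrite /r asboolF.
by exists (Sf rs r0) => z Dz; rewrite /= /r asboolT.
Qed.

Definition restr (f : TU R -> R) (hf : smooth_on D f) : sf D := sval (restr_ex hf).

Lemma restrE (f : TU R -> R) (hf : smooth_on D f) z : dset D z -> restr hf z = f z.
Proof. exact: (svalP (restr_ex hf)). Qed.

(* Each operation is sealed behind an opaque existence proof: unification would
   otherwise unfold derivatives down to limits. *)
Lemma sf_zero_ex : {h : sf D | forall z, dset D z -> h z = 0}.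
Proof. exact: restr_ex (@smooth_on_cst R _ D 0). Qed.
Lemma sf_one_ex : {h : sf D | forall z, dset D z -> h z = 1}.
Proof. exact: restr_ex (@smooth_on_cst R _ D 1). Qed.
Lemma sf_add_ex : {h : sf D -> sf D -> sf D | forall f g z, dset D z -> h f g z = f z + g z}.
Proof.
exists (fun f g => restr (smooth_on_add Do (sf_smooth f) (sf_smooth g))) => f g z.
exact: restrE.
Qed.
Lemma sf_mul_ex : {h : sf D -> sf D -> sf D | forall f g z, dset D z -> h f g z = f z * g z}.
Proof.
exists (fun f g => restr (smooth_on_mul Do (sf_smooth f) (sf_smooth g))) => f g z.
exact: restrE.
Qed.
Lemma sf_opp_ex : {h : sf D -> sf D | forall f z, dset D z -> h f z = - f z}.
Proof. exists (fun f => restr (smooth_on_opp Do (sf_smooth f))) => f z; exact: restrE. Qed.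

Definition sf_zero : sf D := sval sf_zero_ex.
Definition sf_one : sf D := sval sf_one_ex.
Definition sf_add : sf D -> sf D -> sf D := sval sf_add_ex.
Definition sf_mul : sf D -> sf D -> sf D := sval sf_mul_ex.
Definition sf_opp : sf D -> sf D := sval sf_opp_ex.

Let zE z : dset D z -> sf_zero z = 0. Proof. exact: (svalP sf_zero_ex). Qed.
Let oE z : dset D z -> sf_one z = 1. Proof. exact: (svalP sf_one_ex). Qed.
Let aE f g z : dset D z -> sf_add f g z = f z + g z. Proof. exact: (svalP sf_add_ex). Qed.
Let mE f g z : dset D z -> sf_mul f g z = f z * g z. Proof. exact: (svalP sf_mul_ex). Qed.
Let nE f z : dset D z -> sf_opp f z = - f z. Proof. exact: (svalP sf_opp_ex). Qed.

Lemma sf_addA : associative sf_add.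
Proof. by move=> f g h; apply: sf_eq => z Dz; rewrite !(aE _ _ Dz) addrA. Qed.
Lemma sf_addC : commutative sf_add.
Proof. by move=> f g; apply: sf_eq => z Dz; rewrite !(aE _ _ Dz) addrC. Qed.
Lemma sf_add0 : left_id sf_zero sf_add.
Proof. by move=> f; apply: sf_eq => z Dz; rewrite (aE _ _ Dz) (zE Dz) add0r. Qed.
Lemma sf_addN : left_inverse sf_zero sf_opp sf_add.
Proof. by move=> f; apply: sf_eq => z Dz; rewrite (aE _ _ Dz) (zE Dz) (nE _ Dz) addNr. Qed.
Lemma sf_mulA : associative sf_mul.
Proof. by move=> f g h; apply: sf_eq => z Dz; rewrite !(mE _ _ Dz) mulrA. Qed.
Lemma sf_mulC : commutative sf_mul.
Proof. by move=> f g; apply: sf_eq => z Dz; rewrite !(mE _ _ Dz) mulrC. Qed.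
Lemma sf_mul1 : left_id sf_one sf_mul.
Proof. by move=> f; apply: sf_eq => z Dz; rewrite (mE _ _ Dz) (oE Dz) mul1r. Qed.
Lemma sf_mulD : left_distributive sf_mul sf_add.
Proof. by move=> f g h; apply: sf_eq => z Dz; rewrite !(aE, mE) // mulrDl. Qed.

End SmoothRing.

HB.instance Definition _ (R : realType) (D : dom R) := gen_eqMixin (sf D).
HB.instance Definition _ (R : realType) (D : dom R) := gen_choiceMixin (sf D).
HB.instance Definition _ (R : realType) (D : dom R) :=
  GRing.isZmodule.Build (sf D) sf_addA sf_addC sf_add0 sf_addN.
HB.instance Definition _ (R : realType) (D : dom R) :=
  GRing.Zmodule_isComPzRing.Build (sf D) sf_mulA sf_mulC sf_mul1 sf_mulD.

Section SmoothDerivations.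
Context {R : realType} {D : dom R}.
Implicit Types f g h : sf D.
Local Notation Do := (@dset_open _ D).

Lemma sf0E z : dset D z -> (0 : sf D) z = 0. Proof. exact: (svalP sf_zero_ex). Qed.
Lemma sf1E z : dset D z -> (1 : sf D) z = 1. Proof. exact: (svalP sf_one_ex). Qed.
Lemma sfDE f g z : dset D z -> (f + g) z = f z + g z. Proof. exact: (svalP sf_add_ex f g). Qed.
Lemma sfME f g z : dset D z -> (f * g) z = f z * g z. Proof. exact: (svalP sf_mul_ex f g). Qed.
Lemma sfNE f z : dset D z -> (- f) z = - f z. Proof. exact: (svalP sf_opp_ex f). Qed.

Lemma dv_ex : {h : TU R -> sf D -> sf D | forall v f z, dset D z -> h v f z = 'D_v f z}.
Proof.
exists (fun v f => restr (smooth_on_derive v (sf_smooth f))) => v f z; exact: restrE.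
Qed.

Definition dv : TU R -> sf D -> sf D := sval dv_ex.

Lemma dvE v f z : dset D z -> dv v f z = 'D_v f z. Proof. exact: (svalP dv_ex). Qed.

(** The bridge from ring elements to the total functions of the coordinate formulas; as the domain
    is open, it is stable under derivatives. *)
Definition represents f (p : TU R -> R) := forall z, dset D z -> f z = p z.

Lemma derive_represents v f p z : represents f p -> dset D z -> 'D_v f z = 'D_v p z.
Proof. by move=> h Dz; apply: (derive_eq Do) => [w|]; rewrite inE // => Dw; exact: h. Qed.

Lemma represents_dv v f p : represents f p -> represents (dv v f) ('D_v p).
Proof. by move=> h z Dz; apply: etrans (dvE v f Dz) _; exact: derive_represents. Qed.

Lemma represents_restr p (hp : smooth_on D p) : represents (restr hp) p.
Proof. by move=> z Dz; exact: restrE. Qed.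

Lemma sf_diff f z : dset D z -> differentiable f z.
Proof. exact/smooth_on_diff/sf_smooth. Qed.

Lemma dv_derivation v : derivation (dv v).
Proof.
split=> f g; apply: sf_eq => z Dz;
  have df := diff_derivable (v := v) (sf_diff f Dz);
  have dg := diff_derivable (v := v) (sf_diff g Dz).
  have h : represents (f + g) (sfun f + sfun g) by move=> w; exact: sfDE.
  rewrite (represents_dv v h Dz) (deriveD df dg) sfDE //.
  by congr (_ + _); exact: esym (dvE _ _ _).
have h : represents (f * g) (sfun f * sfun g) by move=> w; exact: sfME.
rewrite (represents_dv v h Dz) (deriveM df dg) sfDE // !sfME // addrC [dv v f z * _]mulrC.
by congr (_ * _ + _ * _); exact: esym (dvE _ _ _).
Qed.

Lemma dv_comm u v f : dv v (dv u f) = dv u (dv v f).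
Proof.
apply: sf_eq => z Dz.
have h a b : dv b (dv a f) z = 'D_b ('D_a f) z.
  by apply: (represents_dv b _ Dz); exact: represents_dv.
apply: etrans (h u v) _; apply: etrans _ (esym (h v u)).
exact: (derive_comm u v Do (sf_smooth f) Dz).
Qed.

Lemma sx_ex : {h : 'I_2 -> sf D | forall k z, dset D z -> h k z = z.1 0 k}.
Proof. exists (fun k => restr (smooth_on_linear Do (coord1_diff k))) => k z; exact: restrE. Qed.
Lemma sy_ex : {h : 'I_2 -> sf D | forall k z, dset D z -> h k z = z.2 0 k}.
Proof. exists (fun k => restr (smooth_on_linear Do (coord2_diff k))) => k z; exact: restrE. Qed.
Definition sx : 'I_2 -> sf D := sval sx_ex.
Definition sy : 'I_2 -> sf D := sval sy_ex.
Lemma sxE k z : dset D z -> sx k z = z.1 0 k. Proof. exact: (svalP sx_ex). Qed.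
Lemma syE k z : dset D z -> sy k z = z.2 0 k. Proof. exact: (svalP sy_ex). Qed.

Lemma dv_sx v k z : dset D z -> dv v (sx k) z = v.1 0 k.
Proof.
move=> Dz; rewrite (represents_dv v (sxE k) Dz).
by case: (coord1_diff k z) => d e; rewrite (deriveE _ d) e.
Qed.
Lemma dv_sy v k z : dset D z -> dv v (sy k) z = v.2 0 k.
Proof.
move=> Dz; rewrite (represents_dv v (syE k) Dz).
by case: (coord2_diff k z) => d e; rewrite (deriveE _ d) e.
Qed.

Lemma sf_torsion f : f + f = 0 -> f = 0.
Proof.
move=> e; apply: sf_eq => z Dz; rewrite sf0E //.
have := congr1 (fun h : sf D => h z) e; rewrite sfDE // sf0E //.
by move/eqP; rewrite -mulr2n mulrn_eq0 /= => /eqP.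
Qed.

Let dx_sx a b : dv (ex a) (sx b) = if a == b then 1 else 0.
Proof.
apply: sf_eq => z Dz; rewrite dv_sx //= mxE eqxx /= eq_sym.
by case: (a == b); rewrite ?sf1E ?sf0E.
Qed.
Let dy_sy a b : dv (ey a) (sy b) = if a == b then 1 else 0.
Proof.
apply: sf_eq => z Dz; rewrite dv_sy //= mxE eqxx /= eq_sym.
by case: (a == b); rewrite ?sf1E ?sf0E.
Qed.
Let dx_sy a b : dv (ex a) (sy b) = 0.
Proof. by apply: sf_eq => z Dz; rewrite (sf0E Dz) dv_sy //= mxE. Qed.
Let dy_sx a b : dv (ey a) (sx b) = 0.
Proof. by apply: sf_eq => z Dz; rewrite (sf0E Dz) dv_sx //= mxE. Qed.

Definition sf_tring : tring := @TRing (sf D) (sx i0) (sx i1) (sy i0) (sy i1)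
  (dv (ex i0)) (dv (ex i1)) (dv (ey i0)) (dv (ey i1))
  (dv_derivation _) (dv_derivation _) (dv_derivation _) (dv_derivation _)
  (dv_comm _ _) (dv_comm _ _) (dv_comm _ _) (dv_comm _ _) (dv_comm _ _) (dv_comm _ _)
  (dx_sx i0 i0) (dx_sx i0 i1) (dx_sy i0 i0) (dx_sy i0 i1)
  (dx_sx i1 i0) (dx_sx i1 i1) (dx_sy i1 i0) (dx_sy i1 i1)
  (dy_sx i0 i0) (dy_sx i0 i1) (dy_sy i0 i0) (dy_sy i0 i1)
  (dy_sx i1 i0) (dy_sx i1 i1) (dy_sy i1 i0) (dy_sy i1 i1)
  sf_torsion.

End SmoothDerivations.
Arguments sf_tring {R} D.

(** * Pullback of smooth functions *)

Section Composition.
Context {R : realType} {D D' : dom R}.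
Variables (Psi : TU R -> TU R) (P Q : 'I_2 -> sf D).
Hypothesis PsiD : forall z, dset D z -> dset D' (Psi z).
Hypothesis PsiP : forall k z, dset D z -> (Psi z).1 0 k = P k z.
Hypothesis PsiQ : forall k z, dset D z -> (Psi z).2 0 k = Q k z.
Local Notation Do := (@dset_open _ D).

Lemma Psi_diff z : dset D z -> differentiable Psi z.
Proof.
move=> Dz.
pose Psi' w := P i0 w *: ex i0 + P i1 w *: ex i1 + (Q i0 w *: ey i0 + Q i1 w *: ey i1).
suff h : differentiable Psi' z.
  apply: (near_eq_is_diff _ h).1; apply: (open_near_eq Do) => // w; rewrite inE => Dw.
  by rewrite [RHS]TU_decomp !PsiP // !PsiQ.
by apply: differentiableD; apply: differentiableD; apply: differentiableZl; exact: sf_diff.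
Qed.

Lemma derive_Psi v z : dset D z ->
  [/\ ('D_v Psi z).1 0 i0 = 'D_v (P i0) z, ('D_v Psi z).1 0 i1 = 'D_v (P i1) z,
      ('D_v Psi z).2 0 i0 = 'D_v (Q i0) z & ('D_v Psi z).2 0 i1 = 'D_v (Q i1) z].
Proof.
move=> Dz; have dP := Psi_diff Dz.
have h1 k : ('D_v Psi z).1 0 k = 'D_v (P k) z.
  case: (coord1_diff k (Psi z)) => d e.
  transitivity ('D_v ((fun w : TU R => w.1 0 k) \o Psi) z).
    by rewrite (derive_comp v dP d) (deriveE _ d) e.
  by apply: (derive_eq Do); rewrite ?inE // => w; rewrite inE => Dw; exact: PsiP.
have h2 k : ('D_v Psi z).2 0 k = 'D_v (Q k) z.
  case: (coord2_diff k (Psi z)) => d e.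
  transitivity ('D_v ((fun w : TU R => w.2 0 k) \o Psi) z).
    by rewrite (derive_comp v dP d) (deriveE _ d) e.
  by apply: (derive_eq Do); rewrite ?inE // => w; rewrite inE => Dw; exact: PsiQ.
by split.
Qed.

Lemma derive_pull v (f : sf D') z : dset D z ->
  'D_v (f \o Psi) z = 'D_v (P i0) z * dv (ex i0) f (Psi z) + 'D_v (P i1) z * dv (ex i1) f (Psi z)
   + ('D_v (Q i0) z * dv (ey i0) f (Psi z) + 'D_v (Q i1) z * dv (ey i1) f (Psi z)).
Proof.
move=> Dz; have DPz := PsiD Dz.
rewrite (derive_comp v (Psi_diff Dz) (sf_diff f DPz)) (derive_frame _ (sf_diff f DPz)).
have [e1 e2 e3 e4] := derive_Psi v Dz; rewrite e1 e2 e3 e4.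
by congr (_ * _ + _ * _ + (_ * _ + _ * _)); exact: esym (dvE _ _ DPz).
Qed.

(** By the chain rule a derivative of a pullback combines pullbacks of derivatives, which are again
    ring elements; hence the induction is over all [f] at once. *)
Lemma pull_smooth (f : sf D') : smooth_on D (f \o Psi).
Proof.
apply/smooth_onP => n; elim: n f => [|n IH] f.
  split=> // z Dz; exact: (differentiable_comp (Psi_diff Dz) (sf_diff f (PsiD Dz))).
split=> [z Dz|v]; first exact: (differentiable_comp (Psi_diff Dz) (sf_diff f (PsiD Dz))).
apply: (@eq_Ck _ _ _ _ Do _ ('D_v (P i0) * (dv (ex i0) f \o Psi) + 'D_v (P i1) * (dv (ex i1) f \o Psi)
   + ('D_v (Q i0) * (dv (ey i0) f \o Psi) + 'D_v (Q i1) * (dv (ey i1) f \o Psi)))).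
  by move=> z; rewrite inE => Dz; rewrite derive_pull.
have sd (g : sf D) : Ck n D ('D_v g).
  by have /smooth_onP := smooth_on_derive v (sf_smooth g); exact.
by apply: (Ck_add Do); apply: (Ck_add Do); apply: (Ck_mul Do).
Qed.

Definition pull (f : sf D') : sf D := restr (pull_smooth f).

Lemma pullE f z : dset D z -> pull f z = f (Psi z).
Proof. exact: restrE. Qed.

Lemma pullD f g : pull (f + g) = pull f + pull g.
Proof. by apply: sf_eq => z Dz; rewrite sfDE // !pullE // sfDE //; exact: PsiD. Qed.
Lemma pullM f g : pull (f * g) = pull f * pull g.
Proof. by apply: sf_eq => z Dz; rewrite sfME // !pullE // sfME //; exact: PsiD. Qed.
Lemma pull1 : pull 1 = 1.
Proof. by apply: sf_eq => z Dz; rewrite pullE // !sf1E //; exact: PsiD. Qed.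

Lemma dv_pull v f : dv v (pull f) =
  pull (dv (ex i0) f) * dv v (P i0) + pull (dv (ex i1) f) * dv v (P i1) +
  pull (dv (ey i0) f) * dv v (Q i0) + pull (dv (ey i1) f) * dv v (Q i1).
Proof.
apply: sf_eq => z Dz.
have e : dv v (pull f) z = 'D_v (f \o Psi) z.
  by apply: (represents_dv v _ Dz) => w Dw; exact: restrE.
apply: etrans e _; apply: etrans (derive_pull v f Dz) _; apply: esym.
apply: etrans (sfDE _ _ Dz) _.
apply: etrans (congr1 (fun r => r + _) (sfDE _ _ Dz)) _.
apply: etrans (congr1 (fun r => r + _ + _) (sfDE _ _ Dz)) _.
rewrite -addrA.
congr (_ + _ + (_ + _)); apply: etrans (sfME _ _ Dz) _; rewrite mulrC;
  by congr (_ * _); [exact: dvE|exact: pullE].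
Qed.

End Composition.

(** * Finsler metrics in coordinates *)

(** Stated for any open set, so that a chart can be shrunk to the part that an isometry maps into
    another chart. *)
Record local_finsler (R : realType) (U : set 'rV[R]_2) (L : TU R -> R) : Prop := {
  lf_open : open U;
  lf_smooth : smooth_on [set z | U z.1 /\ z.2 != 0] L;
  lf_homog : forall x y a, U x -> 0 < a -> L (x, a *: y) = a * L (x, y);
  lf_posdef : forall z u, U z.1 -> z.2 != 0 -> u != 0 -> 0 < gform L z u u }.

Lemma slit_open (R : realType) (U : set 'rV[R]_2) : open U ->
  open [set z : TU R | U z.1 /\ z.2 != 0].
Proof.
move=> Uo; apply: openI.
  by apply: open_comp => // z _; exact: cvg_fst.
apply: (@open_comp _ _ snd [set y : 'rV[R]_2 | y != 0]); first by move=> z _; exact: cvg_snd.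
rewrite (_ : [set _ | _] = ~` [set 0]); first exact/closed_openC/accessible_closed_set1/hausdorff_accessible/norm_hausdorff.
by apply/seteqP; split=> y /= /eqP.
Qed.

Definition slit (R : realType) (U : set 'rV[R]_2) (Uo : open U) : dom R := Dom (slit_open Uo).

(** Euler's relation differentiated and contracted with [y]: the fundamental tensor evaluated on [y]
    twice is [2 E]. *)
Lemma euler_second (A : tring) (e : A) : y1 * Y1 e + y2 * Y2 e = e + e ->
  e + e = y1 * (y1 * Y1 (Y1 e) + y2 * Y1 (Y2 e)) + y2 * (y1 * Y1 (Y2 e) + y2 * Y2 (Y2 e)).
Proof.
move=> h; have := congr1 (@Y1 A) h; have := congr1 (@Y2 A) h.
rewrite !(derivE (@Y1d A)) !(derivE (@Y2d A)) Y1y1 Y1y2 Y2y1 Y2y2 YY => h2 h1.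
by apply: (lin_comb3 (- y1) (- y2) (-1) h1 h2 h); ring.
Qed.

Section LocalFinsler.
Context {R : realType} (U : set 'rV[R]_2) (L : TU R -> R).
Hypothesis lf : local_finsler U L.
Let D := slit (lf_open lf).
Local Notation L2 := (fun z => L z ^+ 2).
Local Notation rp := (@represents _ D).
Local Notation A := (sf_tring D).

Definition loc_L : sf D := restr (lf_smooth lf : smooth_on D L).
Definition half : sf D := restr (@smooth_on_cst R _ D 2^-1).
Definition loc_E : A := half * (loc_L * loc_L).

Lemma dv_half v : dv v half = 0.
Proof.
apply: sf_eq => z Dz; have h := represents_dv v (@represents_restr _ D _ (@smooth_on_cst R _ D 2^-1)).
by rewrite (h z Dz) derive_cst sf0E.
Qed.

Lemma half2 : half + half = 1.
Proof.
apply: sf_eq => z Dz; rewrite (sfDE _ _ Dz) (sf1E Dz) !(restrE _ Dz) /cst.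
by rewrite [RHS]splitr !mul1r.
Qed.

Lemma L2_rep : rp (loc_L * loc_L) L2.
Proof.
by move=> z Dz; rewrite (sfME _ _ Dz) expr2 /loc_L !(restrE _ Dz).
Qed.

Lemma dvE_rep v : rp (dv v loc_E) (fun z => 2^-1 * 'D_v L2 z).
Proof.
move=> z Dz; rewrite (derivM (dv_derivation v)) dv_half mul0r add0r (sfME _ _ Dz).
by rewrite (restrE _ Dz) (represents_dv v L2_rep Dz).
Qed.

Lemma dvdvE_rep v w : rp (dv w (dv v loc_E)) (fun z => 2^-1 * 'D_w ('D_v L2) z).
Proof.
move=> z Dz; rewrite (derivM (dv_derivation v)) dv_half mul0r add0r.
rewrite (derivM (dv_derivation w)) dv_half mul0r add0r (sfME _ _ Dz).
by rewrite (restrE _ Dz) (represents_dv w (represents_dv v L2_rep) Dz).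
Qed.

Definition gg i j : A := dv (ey i) (dv (ey j) loc_E).

Lemma gg_rep i j : rp (gg i j) (fund L i j).
Proof. exact: dvdvE_rep. Qed.

Lemma gg_sym i j : gg i j = gg j i.
Proof. exact: dv_comm. Qed.

Lemma euler_L z : dset D z -> 'D_(0, z.2) L z = L z.
Proof.
move=> Dz; have dL : differentiable L z by apply: smooth_on_diff (lf_smooth lf) Dz.
have zE : z + 0 *: (0, z.2) = z by rewrite scale0r addr0.
have dL' : differentiable L (z + (0 : R) *: ((0, z.2) : TU R)) by rewrite zE.
have dl := derive_line dL'.
rewrite zE in dl; have [_ <-] := dl.
have e : \forall t \near (0 : R), L (z + t *: (0, z.2)) = (1 + t) * L z.
  (* Homogeneity holds for positive factors only, so [1 + t] has to stay positive. *)
  have t0 : \forall t \near (0 : R), -1 < t by apply: lt_nbhsr; lra.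
  apply: filterS t0 => t t1; case: z Dz {dL zE dL' dl} => x y [/= Ux y0].
  rewrite -(lf_homog lf) //; last by rewrite -ltrBlDl sub0r.
  congr L; apply: injective_projections; rewrite /= ?scaler0 ?addr0 //.
  by rewrite scalerDl scale1r.
rewrite (near_eq_derive _ e).
have -> : (fun t : R => (1 + t) * L z) = (cst 1 + id) * cst (L z) by [].
by rewrite derive_val /= scaler0 !add0r /GRing.scale /= mulr1.
Qed.

Lemma loc_euler : y1 * Y1 loc_E + y2 * Y2 loc_E = loc_E + loc_E.
Proof.
have e : sy i0 * dv (ey i0) loc_L + sy i1 * dv (ey i1) loc_L = loc_L.
  apply: sf_eq => z Dz.
  have dL : differentiable L z by apply: smooth_on_diff (lf_smooth lf) Dz.
  have h i : dv (ey i) loc_L z = 'D_(ey i) L z.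
    by apply: (represents_dv _ _ Dz); exact: represents_restr.
  rewrite (sfDE _ _ Dz).
  rewrite !(sfME _ _ Dz).
  rewrite !h.
  rewrite !(syE _ Dz).
  have -> : loc_L z = L z by exact: restrE.
  rewrite -[RHS](euler_L Dz).
  exact: esym (derive_fiber z.2 dL).
rewrite /= /loc_E !(derivM (dv_derivation _)) !dv_half !mul0r !add0r.
apply: (lin_comb1 (half * loc_L + half * loc_L) e); ring.
Qed.

Lemma gformE z u v : dset D z -> gform L z u v =
  gg i0 i0 z * u 0 i0 * v 0 i0 + gg i0 i1 z * u 0 i0 * v 0 i1 +
  (gg i0 i1 z * u 0 i1 * v 0 i0 + gg i1 i1 z * u 0 i1 * v 0 i1).
Proof.
by move=> Dz; rewrite /gform !sum_I2 -!(gg_rep _ _ Dz) (gg_sym i1 i0).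
Qed.

Lemma gpos z u : dset D z -> u != 0 -> 0 < gform L z u u.
Proof. by move=> [h1 h2] u0; exact: (lf_posdef lf h1 h2 u0). Qed.

Definition loc_det : sf D := gg i0 i0 * gg i1 i1 - gg i0 i1 * gg i0 i1.

Lemma loc_detE z : dset D z -> loc_det z = gg i0 i0 z * gg i1 i1 z - gg i0 i1 z * gg i0 i1 z.
Proof. by move=> Dz; rewrite (sfDE _ _ Dz) (sfNE _ Dz) !(sfME _ _ Dz). Qed.

Lemma g00_gt0 z : dset D z -> 0 < gg i0 i0 z.
Proof.
move=> Dz; have := @gpos z (delta_mx 0 i0) Dz; rewrite gformE // !mxE /= => h.
suff : 0 < gg i0 i0 z * 1 * 1 + gg i0 i1 z * 1 * 0 + (gg i0 i1 z * 0 * 1 + gg i1 i1 z * 0 * 0).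
  by rewrite !(mulr0, mulr1, addr0, mul0r).
apply: h; apply/eqP => /matrixP/(_ 0 i0); rewrite !mxE /= => /eqP.
by rewrite oner_eq0.
Qed.

Lemma loc_det_gt0 z : dset D z -> 0 < loc_det z.
Proof.
move=> Dz; have g0 := g00_gt0 Dz.
(* This vector is orthogonal to the first basis vector, and its squared length is the determinant
   times the first diagonal entry. *)
pose u : 'rV[R]_2 := \row_j (if j == i0 then - gg i0 i1 z else gg i0 i0 z).
have := @gpos z u Dz; rewrite gformE // !mxE /= loc_detE // => h.
suff : 0 < gg i0 i0 z * (gg i0 i0 z * gg i1 i1 z - gg i0 i1 z * gg i0 i1 z).
  by rewrite pmulr_rgt0.
rewrite [X in _ < X](_ : _ = gg i0 i0 z * - gg i0 i1 z * - gg i0 i1 z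
   + gg i0 i1 z * - gg i0 i1 z * gg i0 i0 z
   + (gg i0 i1 z * gg i0 i0 z * - gg i0 i1 z + gg i1 i1 z * gg i0 i0 z * gg i0 i0 z)); last by ring.
apply: h; apply/eqP => /matrixP/(_ 0 i1); rewrite !mxE /= => /eqP.
by rewrite gt_eqF.
Qed.

Lemma gform_yy z : dset D z -> gform L z z.2 z.2 = loc_E z + loc_E z.
Proof.
move=> Dz; have e : (loc_E + loc_E : A) =
    y1 * (y1 * gg i0 i0 + y2 * gg i0 i1) + y2 * (y1 * gg i0 i1 + y2 * gg i1 i1).
  exact: euler_second loc_euler.
rewrite -(sfDE _ _ Dz) [X in _ = sfun X z]e gformE //.
rewrite (sfDE _ _ Dz) !(sfME _ _ Dz) !(sfDE _ _ Dz) !(sfME _ _ Dz) !(syE _ Dz).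
by ring.
Qed.

Lemma loc_E_gt0 z : dset D z -> 0 < loc_E z.
Proof.
move=> Dz; have := @gpos z z.2 Dz Dz.2; rewrite gform_yy //.
by rewrite -mulr2n pmulrn_lgt0.
Qed.

Lemma loc_E_L z : dset D z -> loc_E z = 2^-1 * L z ^+ 2.
Proof. by move=> Dz; rewrite (sfME _ _ Dz) L2_rep // (restrE _ Dz). Qed.

Definition loc_s : sf D := restr (smooth_on_sqrt (@dset_open _ D) loc_det_gt0 (sf_smooth loc_det)).

Lemma loc_s_gt0 z : dset D z -> 0 < loc_s z.
Proof. by move=> Dz; rewrite (restrE _ Dz) sqrtr_gt0 loc_det_gt0. Qed.

Let s_neq0 z : dset D z -> loc_s z != 0.
Proof. by move=> Dz; rewrite gt_eqF // loc_s_gt0. Qed.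
Let E_neq0 z : dset D z -> loc_E z != 0.
Proof. by move=> Dz; rewrite gt_eqF // loc_E_gt0. Qed.

Definition loc_si : sf D := restr (smooth_on_inv (@dset_open _ D) s_neq0 (sf_smooth loc_s)).
Definition loc_Ei : sf D := restr (smooth_on_inv (@dset_open _ D) E_neq0 (sf_smooth loc_E)).

Lemma loc_ssi : loc_s * loc_si = 1.
Proof.
apply: sf_eq => z Dz; rewrite (sfME _ _ Dz) (sf1E Dz) [loc_si z](restrE _ Dz).
by rewrite mulfV // s_neq0.
Qed.
Lemma loc_EEi : loc_E * loc_Ei = 1.
Proof.
apply: sf_eq => z Dz; rewrite (sfME _ _ Dz) (sf1E Dz) [loc_Ei z](restrE _ Dz).
by rewrite mulfV // E_neq0.
Qed.

Lemma loc_s2 : loc_s * loc_s = loc_det.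
Proof.
apply: sf_eq => z Dz; rewrite (sfME _ _ Dz) (restrE _ Dz) -expr2 sqr_sqrtr //.
by rewrite ltW // loc_det_gt0.
Qed.

Definition rhs j : A :=
  sy i0 * dv (ex i0) (dv (ey j) loc_E) + sy i1 * dv (ex i1) (dv (ey j) loc_E) - dv (ex j) loc_E.

(** Cramer's rule for the spray equations: [loc_si * loc_si] is the inverse determinant, and [half]
    appears because the unknowns there are [2 G]. *)
Definition loc_G1 : A := half * (loc_si * loc_si * (gg i1 i1 * rhs i0 - gg i0 i1 * rhs i1)).
Definition loc_G2 : A := half * (loc_si * loc_si * (gg i0 i0 * rhs i1 - gg i0 i1 * rhs i0)).

Lemma loc_G1E : Y1 (Y1 loc_E) * (loc_G1 + loc_G1) + Y1 (Y2 loc_E) * (loc_G2 + loc_G2) =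
  y1 * X1 (Y1 loc_E) + y2 * X2 (Y1 loc_E) - X1 loc_E.
Proof.
rewrite -[RHS]/(rhs i0) -[Y1 (Y1 loc_E)]/(gg i0 i0) -[Y1 (Y2 loc_E)]/(gg i0 i1).
have h : loc_s * loc_s * (loc_si * loc_si) = 1 by rewrite mulrACA loc_ssi mulr1.
rewrite loc_s2 in h; have h2 := half2.
rewrite /loc_G1 /loc_G2; rewrite /loc_det in h.
have h3 : (loc_si * loc_si * (gg i1 i1 * rhs i0 - gg i0 i1 * rhs i1)) * gg i0 i0 +
   gg i0 i1 * (loc_si * loc_si * (gg i0 i0 * rhs i1 - gg i0 i1 * rhs i0)) = rhs i0.
  by apply: (lin_comb1 (rhs i0) h); ring.
apply: (lin_comb2 1 ((loc_si * loc_si * (gg i1 i1 * rhs i0 - gg i0 i1 * rhs i1)) * gg i0 i0 +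
   gg i0 i1 * (loc_si * loc_si * (gg i0 i0 * rhs i1 - gg i0 i1 * rhs i0))) h3 h2); ring.
Qed.

Lemma loc_G2E : Y1 (Y2 loc_E) * (loc_G1 + loc_G1) + Y2 (Y2 loc_E) * (loc_G2 + loc_G2) =
  y1 * X1 (Y2 loc_E) + y2 * X2 (Y2 loc_E) - X2 loc_E.
Proof.
rewrite -[RHS]/(rhs i1) -[Y2 (Y2 loc_E)]/(gg i1 i1) -[Y1 (Y2 loc_E)]/(gg i0 i1).
have h : loc_s * loc_s * (loc_si * loc_si) = 1 by rewrite mulrACA loc_ssi mulr1.
rewrite loc_s2 in h; have h2 := half2.
rewrite /loc_G1 /loc_G2; rewrite /loc_det in h.
have h3 : (loc_si * loc_si * (gg i1 i1 * rhs i0 - gg i0 i1 * rhs i1)) * gg i0 i1 +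
   gg i1 i1 * (loc_si * loc_si * (gg i0 i0 * rhs i1 - gg i0 i1 * rhs i0)) = rhs i1.
  by apply: (lin_comb1 (rhs i1) h); ring.
apply: (lin_comb2 1 ((loc_si * loc_si * (gg i1 i1 * rhs i0 - gg i0 i1 * rhs i1)) * gg i0 i1 +
   gg i1 i1 * (loc_si * loc_si * (gg i0 i0 * rhs i1 - gg i0 i1 * rhs i0))) h3 h2); ring.
Qed.

Definition loc_fdata : fdata A :=
  @FData A loc_E loc_Ei loc_s loc_si loc_G1 loc_G2 loc_EEi loc_ssi loc_euler
    loc_s2 loc_G1E loc_G2E.

End LocalFinsler.

Lemma invmx2 (R : realType) (a b c : R) (M : 'M[R]_2) :
  M i0 i0 = a -> M i0 i1 = b -> M i1 i0 = b -> M i1 i1 = c -> a * c - b * b != 0 ->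
  let d := (a * c - b * b)^-1 in
  [/\ invmx M i0 i0 = d * c, invmx M i0 i1 = - (d * b),
      invmx M i1 i0 = - (d * b) & invmx M i1 i1 = d * a].
Proof.
move=> M00 M01 M10 M11 d0 d.
pose N : 'M[R]_2 := \matrix_(i, j) (if i == i0 then if j == i0 then d * c else - (d * b)
   else if j == i0 then - (d * b) else d * a).
have dK : d * (a * c - b * b) = 1 by rewrite mulVf.
have MN : M *m N = 1%:M.
  apply/matrixP => i j; rewrite mxE sum_I2 !mxE /=.
  case: (I2P i) => ->; case: (I2P j) => ->; rewrite ?M00 ?M01 ?M10 ?M11 /=.
  - by rewrite -dK; ring.
  - by ring.
  - by ring.
  - by rewrite -dK; ring.
have Mu : M \in unitmx by case/mulmx1_unit: MN.
have -> : invmx M = N by rewrite -[LHS]mulmx1 -MN mulmxA mulVmx // mul1mx.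
by rewrite !mxE.
Qed.

Lemma sum3_delta (R : realType) (f : 'I_2 -> 'I_2 -> 'I_2 -> R) (a b c : 'I_2) :
  \sum_j \sum_k \sum_l f j k l * (delta_mx 0 a : 'rV[R]_2) 0 j * (delta_mx 0 b : 'rV[R]_2) 0 k *
    (delta_mx 0 c : 'rV[R]_2) 0 l = f a b c.
Proof.
rewrite !sum_I2 !mxE.
case: (I2P a) => ->; case: (I2P b) => ->; case: (I2P c) => -> /=;
by rewrite !(mulr0, mul0r, mulr1, addr0, add0r).
Qed.

(** * Identification with the coordinate formulas *)

Section LocalFormulasLink.
Context {R : realType} (U : set 'rV[R]_2) (L : TU R -> R).
Hypothesis lf : local_finsler U L.
Let D := slit (lf_open lf).
Local Notation L2 := (fun z => L z ^+ 2).
Local Notation A := (sf_tring D).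
Local Notation F := (loc_fdata lf).

Definition loc_G i : A := if i == i0 then G1 F else G2 F.

Lemma rhs_rep j z : dset D z -> rhs lf j z =
  2^-1 * (\sum_k dx k (dy j L2) z * z.2 0 k - dx j L2 z).
Proof.
move=> Dz; rewrite /rhs (sfDE _ _ Dz) (sfDE _ _ Dz) (sfNE _ Dz) !(sfME _ _ Dz) !(syE _ Dz).
rewrite !(dvdvE_rep _ _ Dz) (dvE_rep _ Dz) sum_I2.
rewrite -![dx _ _ z]/('D_(ex _) _ z) -![dy _ _]/('D_(ey _) _).
move: ('D_(ex i0) _ z) ('D_(ex i1) _ z) ('D_(ex j) L2 z) => p q r.
by ring.
Qed.

Lemma loc_siE z : dset D z -> loc_si lf z * loc_si lf z = (loc_det lf z)^-1.
Proof.
move=> Dz; have := congr1 (fun f : sf D => f z) (loc_ssi lf).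
have := congr1 (fun f : sf D => f z) (loc_s2 lf).
rewrite (sfME _ _ Dz) (sfME _ _ Dz) (sf1E Dz) => <- h.
have s0 : loc_s lf z != 0 by rewrite gt_eqF // loc_s_gt0.
have -> : loc_si lf z = (loc_s lf z)^-1.
  by apply: (mulfI s0); rewrite h mulfV.
by rewrite invfM.
Qed.

Lemma spray_rep i : represents (loc_G i) (spray L i).
Proof.
move=> z Dz.
have d0 : gg lf i0 i0 z * gg lf i1 i1 z - gg lf i0 i1 z * gg lf i0 i1 z != 0.
  by rewrite -(loc_detE Dz) gt_eqF // loc_det_gt0.
have [] := @invmx2 R (gg lf i0 i0 z) (gg lf i0 i1 z) (gg lf i1 i1 z)
   (\matrix_(a, b) fund L a b z) _ _ _ _ d0.
- by rewrite mxE (gg_rep _ _ Dz).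
- by rewrite mxE (gg_rep _ _ Dz).
- by rewrite mxE (gg_sym lf) (gg_rep _ _ Dz).
- by rewrite mxE (gg_rep _ _ Dz).
rewrite -(loc_detE Dz) -(loc_siE Dz) => e00 e01 e10 e11.
have h j : \sum_k dx k (dy j L2) z * z.2 0 k - dx j L2 z = 2 * rhs lf j z.
  by rewrite rhs_rep // mulrA mulfV // mul1r.
have -> : spray L i z = 4^-1 * (invmx (\matrix_(a, b) fund L a b z) i i0 * (2 * rhs lf i0 z) +
    invmx (\matrix_(a, b) fund L a b z) i i1 * (2 * rhs lf i1 z)).
  by rewrite /spray sum_I2; congr (_ * (_ * _ + _ * _)); exact: h.
(* The spray formula is written with the squared norm [2 E], which turns its factor [1/4] into
   [1/2]. *)
have hh : half lf z = 2 * 4^-1.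
  by rewrite (restrE _ Dz) /cst; field.
case: (I2P i) => ->.
  rewrite e00 e01 /loc_G /= /loc_G1 (sfME _ _ Dz) (sfME _ _ Dz) (sfME _ _ Dz) (sfDE _ _ Dz).
  by rewrite (sfNE _ Dz) (sfME _ _ Dz) (sfME _ _ Dz) hh; ring.
rewrite e10 e11 /loc_G /= /loc_G2 (sfME _ _ Dz) (sfME _ _ Dz) (sfME _ _ Dz) (sfDE _ _ Dz).
by rewrite (sfNE _ Dz) (sfME _ _ Dz) (sfME _ _ Dz) hh; ring.
Qed.

Lemma E_rep i z : dset D z ->
  dv (ey i) (loc_E lf) z = gg lf i i0 z * z.2 0 i0 + gg lf i i1 z * z.2 0 i1.
Proof.
move=> Dz; have := congr1 (fun f : sf D => f z) (eulerY1 F).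
have := congr1 (fun f : sf D => f z) (eulerY2 F).
rewrite !(sfDE _ _ Dz) !(sfME _ _ Dz) !(syE _ Dz) => e2 e1.
case: (I2P i) => ->.
  by rewrite -[LHS]e1 mulrC; congr (_ + _); rewrite mulrC.
by rewrite -[LHS]e2 mulrC (gg_sym lf i1 i0); congr (_ + _); rewrite mulrC.
Qed.

(** Evaluate the Landsberg tensor on coordinate vectors; by [E_rep], the pairing with [y] is
    contraction with the fibre differential of [E]. *)
Lemma berwald_rep (land : forall z u v w, dset D z -> landsberg L z u v w = 0) a b c :
  dv (ey i0) (loc_E lf) * dv (ey a) (dv (ey b) (dv (ey c) (loc_G i0))) +
  dv (ey i1) (loc_E lf) * dv (ey a) (dv (ey b) (dv (ey c) (loc_G i1))) = 0.
Proof.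
apply: sf_eq => z Dz.
have Br i : dv (ey a) (dv (ey b) (dv (ey c) (loc_G i))) z = berwald_coef L i a b c z.
  by apply: (represents_dv _ _ Dz); do 2 apply: represents_dv; exact: spray_rep.
have := land z (delta_mx 0 a) (delta_mx 0 b) (delta_mx 0 c) Dz.
have Be i : berwald L z (delta_mx 0 a) (delta_mx 0 b) (delta_mx 0 c) 0 i = berwald_coef L i a b c z.
  by rewrite mxE; exact: (sum3_delta (fun j k l => berwald_coef L i j k l z)).
rewrite /landsberg (gformE _ _ Dz) !Be => /eqP.
rewrite mulf_eq0 oppr_eq0 invr_eq0 (pnatr_eq0 _ 2) /= => /eqP e.
rewrite (sfDE _ _ Dz) !(sfME _ _ Dz) !Br (sf0E Dz).
rewrite !E_rep //.
rewrite (gg_sym lf i1 i0); move: e.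
move: (berwald_coef L i0 a b c z) (berwald_coef L i1 a b c z) (z.2 0 i0) (z.2 0 i1).
move: (gg lf i0 i0 z) (gg lf i0 i1 z) (gg lf i1 i1 z) => g0 g1 g2 b0 b1 p q e.
by apply: (lin_comb1 1 e); ring.
Qed.

Definition loc_R i k : A := dv (ex k) (loc_G i) + dv (ex k) (loc_G i) - geod F (dv (ey k) (loc_G i))
  - (dv (ey i0) (loc_G i) * dv (ey k) (loc_G i0) + dv (ey i1) (loc_G i) * dv (ey k) (loc_G i1)).

Lemma riemann_rep i k : represents (loc_R i k) (riemann_coef L i k).
Proof.
move=> z Dz.
have hX a : dx a (spray L i) z = dv (ex a) (loc_G i) z.
  by apply: esym; apply: (represents_dv _ _ Dz); exact: spray_rep.
have hY j a : dy a (spray L j) z = dv (ey a) (loc_G j) z.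
  by apply: esym; apply: (represents_dv _ _ Dz); exact: spray_rep.
have hXY a : dx a (dy k (spray L i)) z = dv (ex a) (dv (ey k) (loc_G i)) z.
  by apply: esym; apply: (represents_dv _ _ Dz); apply: represents_dv; exact: spray_rep.
have hYY a : dy a (dy k (spray L i)) z = dv (ey a) (dv (ey k) (loc_G i)) z.
  by apply: esym; apply: (represents_dv _ _ Dz); apply: represents_dv; exact: spray_rep.
have hG j : spray L j z = loc_G j z by apply: esym; exact: spray_rep.
rewrite /riemann_coef !sum_I2 !hX !hXY !hYY !hY !hG /loc_R /geod.
rewrite -[G1 F]/(loc_G i0) -[G2 F]/(loc_G i1).
rewrite -[X1 _]/(dv (ex i0) _) -[X2 _]/(dv (ex i1) _) -[Y1 _]/(dv (ey i0) _) -[Y2 _]/(dv (ey i1) _).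
rewrite -[y1]/(sy i0) -[y2]/(sy i1).
rewrite !(sfDE _ _ Dz, sfNE _ Dz, sfME _ _ Dz, syE _ Dz).
by ring.
Qed.

(** The curvature kills [y] and has image orthogonal to [y], so on a surface it is its trace times
    the orthogonal projection away from [y]. *)
Lemma flag_curvE z (u : 'rV[R]_2) : dset D z ->
  z.2 0 i0 * u 0 i1 - z.2 0 i1 * u 0 i0 != 0 ->
  flag_curv L z u = jac F z / (loc_E lf z + loc_E lf z).
Proof.
move=> Dz yu.
have e (f g : A) : f = g -> f z = g z by move=> ->.
have [] : loc_R i0 i0 * sy i0 + loc_R i0 i1 * sy i1 = 0 /\ loc_R i1 i0 * sy i0 + loc_R i1 i1 * sy i1 = 0.
  exact: R_y F.
move=> /e r1 /e r2.
have /e r3 : loc_R i0 i0 * dv (ey i0) (loc_E lf) + loc_R i1 i0 * dv (ey i1) (loc_E lf) = 0.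
  exact: R_E1 F.
have /e r4 : loc_R i0 i1 * dv (ey i0) (loc_E lf) + loc_R i1 i1 * dv (ey i1) (loc_E lf) = 0.
  exact: R_E2 F.
have -> : jac F z = loc_R i0 i0 z + loc_R i1 i1 z by rewrite -(sfDE _ _ Dz).
rewrite !(sfDE _ _ Dz) !(sfME _ _ Dz) !(syE _ Dz) !(sf0E Dz) in r1 r2.
rewrite !(sfDE _ _ Dz) !(sfME _ _ Dz) !(E_rep _ Dz) !(sf0E Dz) (gg_sym lf i1 i0) in r3 r4.
have d0 := loc_det_gt0 Dz; rewrite (loc_detE Dz) in d0.
have E2 := gform_yy Dz; have E0 := loc_E_gt0 Dz.
have E0' : loc_E lf z + loc_E lf z != 0 by rewrite gt_eqF // addr_gt0.
move: r1 r2 r3 r4; rewrite -E2 in E0' *.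
rewrite /flag_curv !(gformE _ _ Dz) in E0' *.
rewrite /riemann !mxE !sum_I2 -!(riemann_rep _ _ Dz).
move: (loc_R i0 i0 z) (loc_R i0 i1 z) (loc_R i1 i0 z) (loc_R i1 i1 z) => r00 r01 r10 r11.
move: (gg lf i0 i0 z) (gg lf i0 i1 z) (gg lf i1 i1 z) d0 E0' => a b c d0 E0'.
move: (z.2 0 i0) (z.2 0 i1) (u 0 i0) (u 0 i1) yu E0' => p q v w yu E0' r1 r2 r3 r4.
set N := a * p * p + _ + _ in E0' *.
apply/eqP; rewrite eqr_div //; last first.
  (* The Gram determinant of flagpole and edge is the determinant of the metric times the squared
     coordinate area. *)
  rewrite [X in X != 0](_ : _ = (a * c - b * b) * (p * w - q * v) ^+ 2).
    by rewrite mulf_neq0 // ?expf_neq0 // gt_eqF.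
  by rewrite /N; ring.
apply/eqP.
(* With [N] the squared length of [y], the four identities say that [N R] is the trace times [N]
   minus the tensor of [y] with its dual covector. *)
have k1 : N * r00 = (r00 + r11) * (q * (b * p + c * q)).
  by rewrite /N; apply: (lin_comb2 (a * p + b * q) (- q) r1 r4); ring.
have k2 : N * r01 = - ((r00 + r11) * (p * (b * p + c * q))).
  by rewrite /N; apply: (lin_comb2 (b * p + c * q) p r1 r4); ring.
have k3 : N * r10 = - ((r00 + r11) * (q * (a * p + b * q))).
  by rewrite /N; apply: (lin_comb2 (a * p + b * q) q r2 r3); ring.
have k4 : N * r11 = (r00 + r11) * (p * (a * p + b * q)).
  by rewrite /N; apply: (lin_comb2 (b * p + c * q) (- p) r2 r3); ring.
apply: (lin_comb4 (v * (a * v + b * w)) (w * (a * v + b * w)) (v * (b * v + c * w))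
  (w * (b * v + c * w)) k1 k2 k3 k4).
by rewrite /N; ring.
Qed.

End LocalFormulasLink.

(** * Invariance under changes of coordinates *)

Section BaseFunctions.
Context {R : realType}.

Lemma row_coord_diff (k : 'I_2) (v : 'rV[R]_2) :
  is_diff v (fun w : 'rV[R]_2 => w 0 k) (fun w => w 0 k).
Proof.
have @l : {linear 'rV[R]_2 -> R}.
  by exists (fun w : 'M[R]_(_, _) => w 0 k); do 2![eexists]; do ?[constructor];
     rewrite /= ?mxE // => ? *; rewrite /= ?mxE //; move=> ?; rewrite /= !mxE.
have lc : continuous l by move=> w; exact: coord_continuous.
by apply: DiffDef; [exact: (@linear_differentiable _ _ _ l)|exact: (@diff_lin _ _ _ l)].
Qed.

Lemma derive_coord (V : normedModType R) (psi : V -> 'rV[R]_2) k v x : differentiable psi x ->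
  'D_v (fun w => psi w 0 k) x = ('D_v psi x) 0 k.
Proof.
move=> dp; have [d e] := row_coord_diff k (psi x).
by apply: etrans (derive_comp v dp d) _; rewrite (deriveE _ d) e.
Qed.

Lemma Ck_coord (V : normedModType R) n (U : set V) (psi : V -> 'rV[R]_2) k : open U ->
  Ck n U psi -> Ck n U (fun x => psi x 0 k).
Proof.
move=> Uo; have dc (p : V -> 'rV[R]_2) x : differentiable p x -> differentiable (fun x => p x 0 k) x.
  by move=> dp; have [d _] := row_coord_diff k (p x); exact: (differentiable_comp dp d).
elim: n psi => [|n IH] psi [h1 h2]; (split=> [x Ux|]; first by apply: dc; exact: h1).
  by [].
move=> v; apply: (eq_Ck Uo _ (IH _ (h2 v))) => x; rewrite inE => Ux.
exact: esym (derive_coord k v (h1 _ Ux)).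
Qed.

Lemma derive_fst (W : normedModType R) (f : 'rV[R]_2 -> W) (v z : TU R) : differentiable f z.1 ->
  'D_v (fun w : TU R => f w.1) z = 'D_(v.1) f z.1.
Proof.
move=> df; have dl : is_diff z (fst : TU R -> _) fst.
  pose l : {linear TU R -> 'rV[R]_2} := fst.
  have lc : continuous l by move=> w; exact: cvg_fst.
  by apply: DiffDef; [exact: (@linear_differentiable _ _ _ l)|exact: (@diff_lin _ _ _ l)].
have [d e] := dl; apply: etrans (derive_comp v d df) _.
by rewrite (deriveE _ d) e.
Qed.

Lemma Ck_fst n (U : set 'rV[R]_2) (D : set (TU R)) (f : 'rV[R]_2 -> R) : open U -> open D ->
  (forall z, D z -> U z.1) -> Ck n U f -> Ck n D (fun z => f z.1).
Proof.
move=> Uo Do DU; have dc (p : 'rV[R]_2 -> R) (z : TU R) :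
    differentiable p z.1 -> differentiable (fun z : TU R => p z.1) z.
  move=> dp; apply: (@differentiable_comp _ _ _ _ fst p) => //.
  pose l : {linear TU R -> 'rV[R]_2} := fst.
  have lc : continuous l by move=> w; exact: cvg_fst.
  exact: (@linear_differentiable _ _ _ l).
elim: n f => [|n IH] f [h1 h2]; (split=> [z Dz|]; first by apply/dc/h1/DU).
  by [].
move=> v; apply: (eq_Ck Do _ (IH _ (h2 v.1))) => z; rewrite inE => Dz.
by apply: esym; apply: derive_fst; exact/h1/DU.
Qed.

End BaseFunctions.

Section Invariance.
Context {R : realType} (U U' : set 'rV[R]_2) (L L' : TU R -> R) (psi : 'rV[R]_2 -> 'rV[R]_2).
Hypotheses (lf : local_finsler U L) (lf' : local_finsler U' L').
Hypothesis psi_smooth : smooth_on U psi.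
Hypothesis psiU : forall x, U x -> U' (psi x).
Hypothesis psiL : forall x y, U x -> y != 0 -> L' (psi x, 'd psi x y) = L (x, y).
Let D := slit (lf_open lf).
Let D' := slit (lf_open lf').
Local Notation F := (loc_fdata lf).
Local Notation F' := (loc_fdata lf').

Definition tmap (z : TU R) : TU R := (psi z.1, 'd psi (z.1) z.2).

Let psi_diff z : dset D z -> differentiable psi z.1.
Proof. by move=> [Uz _]; exact: smooth_on_diff psi_smooth Uz. Qed.

(** Injectivity of the differential comes from preservation of the norm: nonzero vectors have
    nonzero length, and homogeneity forces length zero at the zero vector. *)
Lemma dpsi_neq0 x y : U x -> y != 0 -> 'd psi x y != 0.
Proof.
move=> Ux y0; apply/eqP => e.
have Dz : dset D (x, y) by [].
have := loc_E_gt0 Dz; rewrite (loc_E_L Dz) -(psiL Ux y0) e.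
suff -> : L' (psi x, 0) = 0 by rewrite expr0n mulr0 ltxx.
have : L' (psi x, 2 *: 0) = 2 * L' (psi x, 0) by apply: (lf_homog lf') => //; exact: psiU.
by rewrite scaler0 => h; lra.
Qed.

Lemma tmapD z : dset D z -> dset D' (tmap z).
Proof. by move=> [Uz z0]; split; [exact: psiU|exact: dpsi_neq0]. Qed.

Lemma base_smooth k : smooth_on D (fun z => psi z.1 0 k).
Proof.
apply/smooth_onP => n; have Uo := lf_open lf.
apply: (@Ck_fst _ n U D (fun x => psi x 0 k) Uo (@dset_open _ D)) => [z []//|].
by apply: Ck_coord => //; move: n; exact/smooth_onP.
Qed.

Definition tP k : sf D := restr (base_smooth k).
Definition ta k l : sf D := dv (ex l) (tP k).
Definition tQ k : sf D := ta k i0 * sy i0 + ta k i1 * sy i1.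

Lemma dv_tP v k z : dset D z -> dv v (tP k) z = ('D_(v.1) psi z.1) 0 k.
Proof.
move=> Dz; rewrite (represents_dv v (represents_restr (base_smooth k)) Dz).
have dp := psi_diff Dz; have [d e] := row_coord_diff k (psi z.1).
apply: etrans (@derive_fst _ _ (fun x => psi x 0 k) v z _) _; last exact: derive_coord.
exact: (differentiable_comp dp d).
Qed.

Lemma tPE k z : dset D z -> (tmap z).1 0 k = tP k z.
Proof. by move=> Dz; rewrite (restrE _ Dz). Qed.

Lemma dpsiE z y k : dset D z -> ('d psi (z.1) y) 0 k = ta k i0 z * y 0 i0 + ta k i1 z * y 0 i1.
Proof.
move=> Dz; rewrite !(dv_tP _ _ Dz) [y in LHS]row2_decomp linearD !linearZ !mxE.
by rewrite !(deriveE _ (psi_diff Dz)) mulrC [in X in _ + X]mulrC.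
Qed.

Lemma tQE k z : dset D z -> (tmap z).2 0 k = tQ k z.
Proof.
by move=> Dz; rewrite (sfDE _ _ Dz) !(sfME _ _ Dz) !(syE _ Dz); exact: dpsiE.
Qed.

Lemma dy_tP l k : dv (ey l) (tP k) = 0.
Proof. by apply: sf_eq => z Dz; rewrite (dv_tP _ _ Dz) derive0 mxE (sf0E Dz). Qed.

Lemma dy_ta l k m : dv (ey l) (ta k m) = 0.
Proof. by rewrite /ta dv_comm dy_tP (deriv0 (dv_derivation _)). Qed.

Lemma dx_ta k : dv (ex i1) (ta k i0) = dv (ex i0) (ta k i1).
Proof. exact: dv_comm. Qed.

Definition tpull := pull tmapD tPE tQE.

Lemma dy_tQ l k : dv (ey l) (tQ k) = ta k l.
Proof.
rewrite /tQ (derivD (dv_derivation _)) !(derivM (dv_derivation _)) !dy_ta !mul0r !add0r.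
apply: sf_eq => z Dz; rewrite (sfDE _ _ Dz) !(sfME _ _ Dz) !(dv_sy _ _ Dz) !mxE /=.
by case: (I2P l) => ->; rewrite /= mulr0 mulr1 ?addr0 ?add0r.
Qed.

Lemma dx_tQ l k : dv (ex l) (tQ k) = dv (ex l) (ta k i0) * sy i0 + dv (ex l) (ta k i1) * sy i1.
Proof.
rewrite /tQ (derivD (dv_derivation _)) !(derivM (dv_derivation _)).
suff h m : dv (ex l) (sy m) = 0 :> sf D by rewrite !h !mulr0 !addr0.
by apply: sf_eq => z Dz; rewrite (dv_sy _ _ Dz) (sf0E Dz) mxE.
Qed.

Lemma dy_tpull l f : dv (ey l) (tpull f) =
  tpull (dv (ey i0) f) * ta i0 l + tpull (dv (ey i1) f) * ta i1 l.
Proof. by rewrite /tpull dv_pull !dy_tP !dy_tQ !mulr0 !add0r. Qed.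

Lemma dx_tpull l f : dv (ex l) (tpull f) =
  tpull (dv (ex i0) f) * ta i0 l + tpull (dv (ex i1) f) * ta i1 l +
  tpull (dv (ey i0) f) * (dv (ex l) (ta i0 i0) * sy i0 + dv (ex l) (ta i0 i1) * sy i1) +
  tpull (dv (ey i1) f) * (dv (ex l) (ta i1 i0) * sy i0 + dv (ex l) (ta i1 i1) * sy i1).
Proof. by rewrite /tpull dv_pull !dx_tQ. Qed.

Lemma tpull_y k : tpull (sy k) = tQ k.
Proof. by apply: sf_eq => z Dz; rewrite (pullE _ _ _ _ Dz) (syE k (tmapD Dz)) (tQE k Dz). Qed.

Lemma tpull_E : tpull (loc_E lf') = loc_E lf.
Proof.
apply: sf_eq => z Dz; rewrite (pullE _ _ _ _ Dz) (loc_E_L (tmapD Dz)) (loc_E_L Dz).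
by case: z Dz => x y [/= Ux y0]; rewrite psiL.
Qed.

Definition tdet : sf D := ta i0 i0 * ta i1 i1 - ta i0 i1 * ta i1 i0.

Lemma tdet_neq0 z : dset D z -> tdet z != 0.
Proof.
move=> Dz; rewrite (sfDE _ _ Dz) (sfNE _ Dz) !(sfME _ _ Dz); apply/eqP => e.
have h (p q : R) : ta i0 i0 z * p + ta i0 i1 z * q = 0 -> ta i1 i0 z * p + ta i1 i1 z * q = 0 ->
    p = 0 /\ q = 0.
  move=> e0 e1; pose y : 'rV[R]_2 := \row_j (if j == i0 then p else q).
  have y0 : y = 0.
    apply/eqP; apply: contraT => /(dpsi_neq0 Dz.1) /eqP; case; apply/rowP => k.
    by rewrite (dpsiE _ _ Dz) !mxE /=; case: (I2P k) => ->.
  by move/rowP: y0 => y0; have := y0 i0; have := y0 i1; rewrite !mxE /=.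
(* If the determinant vanished, both of these vectors would be in the kernel. Then all entries would
   be zero and [(1, 0)] would be a nonzero kernel vector. *)
have [a1 a2] : - ta i0 i1 z = 0 /\ ta i0 i0 z = 0.
  by apply: h; [ring|rewrite -[RHS]e; ring].
have [b1 b2] : - ta i1 i1 z = 0 /\ ta i1 i0 z = 0.
  by apply: h; [rewrite -[RHS]oppr0 -[in RHS]e; ring|ring].
have [] : (1 : R) = 0 /\ (0 : R) = 0.
  by apply: h; [rewrite a2; ring|rewrite b2; ring].
by move/eqP; rewrite oner_eq0.
Qed.

Definition tdeti : sf D := restr (smooth_on_inv (@dset_open _ D) tdet_neq0 (sf_smooth tdet)).

Lemma tdetK : tdet * tdeti = 1.
Proof.
apply: sf_eq => z Dz; rewrite (sfME _ _ Dz) (sf1E Dz) (restrE _ Dz).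
by rewrite mulfV // tdet_neq0.
Qed.

Let tpullD f g : tpull (f + g) = tpull f + tpull g. Proof. exact: pullD. Qed.
Let tpullM f g : tpull (f * g) = tpull f * tpull g. Proof. exact: pullM. Qed.
Let tpull1 : tpull 1 = 1. Proof. exact: pull1. Qed.

Lemma tpull_mscal : exists2 e : sf D, e * e = 1 & mscal F = e * tpull (mscal F').
Proof.
exists (@sgn (sf_tring D) (sf_tring D') F F' tpull tdeti).
  exact: (@sgn2 (sf_tring D) (sf_tring D') F F' tpull _ _ _ _ tdeti tpullD tpullM tpull1
    (dy_ta i0 i0 i0) (dy_ta i0 i0 i1) (dy_ta i0 i1 i0) (dy_ta i0 i1 i1)
    (dy_ta i1 i0 i1) (dy_ta i1 i1 i1)
    (dy_tpull i0) (dy_tpull i1) tpull_E tdetK).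
exact: (@mscal_phi (sf_tring D) (sf_tring D') F F' tpull _ _ _ _ tdeti tpullD tpullM tpull1
    (dy_ta i0 i0 i0) (dy_ta i0 i0 i1) (dy_ta i0 i1 i0) (dy_ta i0 i1 i1)
    (dy_ta i1 i0 i0) (dy_ta i1 i0 i1) (dy_ta i1 i1 i0) (dy_ta i1 i1 i1)
    (dy_tpull i0) (dy_tpull i1) tpull_E tdetK).
Qed.

Lemma tpull_vert_mscal : vert F (mscal F) = tpull (vert F' (mscal F')).
Proof.
exact: (@vert_mscal_phi (sf_tring D) (sf_tring D') F F' tpull _ _ _ _ tdeti tpullD tpullM tpull1
    (dy_ta i0 i0 i0) (dy_ta i0 i0 i1) (dy_ta i0 i1 i0) (dy_ta i0 i1 i1)
    (dy_ta i1 i0 i0) (dy_ta i1 i0 i1) (dy_ta i1 i1 i0) (dy_ta i1 i1 i1)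
    (dy_tpull i0) (dy_tpull i1) tpull_E tdetK).
Qed.

Lemma tpull_jac : jac F = tpull (jac F').
Proof.
exact: (@jac_phi (sf_tring D) (sf_tring D') F F' tpull _ _ _ _ tdeti tpullD tpullM tpull1
    (tpull_y i0) (tpull_y i1)
    (dy_ta i0 i0 i0) (dy_ta i0 i0 i1) (dy_ta i0 i1 i0) (dy_ta i0 i1 i1)
    (dy_ta i1 i0 i0) (dy_ta i1 i0 i1) (dy_ta i1 i1 i0) (dy_ta i1 i1 i1)
    (dx_ta i0) (dx_ta i1)
    (dy_tpull i0) (dy_tpull i1) (dx_tpull i0) (dx_tpull i1) tpull_E tdetK).
Qed.

Lemma mscal_tmap z : dset D z ->
  mscal F z = mscal F' (tmap z) \/ mscal F z = - mscal F' (tmap z).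
Proof.
move=> Dz; have [e e2 ->] := tpull_mscal.
have := congr1 (fun f : sf D => f z) e2; rewrite (sfME _ _ Dz) (sf1E Dz) => /eqP.
rewrite -expr2 sqrf_eq1 (sfME _ _ Dz) (pullE _ _ _ _ Dz) => /orP[] /eqP ->.
  by left; rewrite mul1r.
by right; rewrite mulN1r.
Qed.

Lemma vert_mscal_tmap z : dset D z ->
  vert F (mscal F) z = vert F' (mscal F') (tmap z).
Proof. by move=> Dz; rewrite tpull_vert_mscal (pullE _ _ _ _ Dz). Qed.

Lemma flag_tmap z : dset D z ->
  jac F z / (loc_E lf z + loc_E lf z) = jac F' (tmap z) / (loc_E lf' (tmap z) + loc_E lf' (tmap z)).
Proof. by move=> Dz; rewrite tpull_jac -tpull_E !(pullE _ _ _ _ Dz). Qed.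

End Invariance.

(** * Curves and level sets *)

Section OneVariable.
Context {R : realType}.
Implicit Types (f h k i m : R -> R) (s t r c : R).

Lemma is_derive1_continuous f t (l : R) : is_derive t 1 f l -> {for t, continuous f}.
Proof. by case=> d _; apply/differentiable_continuous/derivable1_diffP. Qed.

Lemma isolated_level h t (l : R) : is_derive t 1 h l -> l != 0 ->
  exists2 r, 0 < r & forall s, s != t -> `|s - t| < r -> h s != h t.
Proof.
case=> dh hl l0.
have : (fun u : R => u^-1 *: ((h \o shift t) (u *: 1) - h t)) @ 0^' --> l.
  by rewrite -hl; exact: dh.
move=> /(cvgr_neq0 _)/(_ l0) /= /nbhs_normP /= [r r0 hr].
exists r => // s st sr; have := hr (s - t); rewrite /= distrC subr0 => /(_ sr).
rewrite subr_eq0 st => /(_ isT); rewrite /GRing.scale /= mulr1 subrK => n0.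
by apply: contra n0 => /eqP ->; rewrite subrr mulr0.
Qed.

Lemma countable_separated (r : R) (A : set R) : 0 < r ->
  (forall s t, A s -> A t -> `|s - t| < r -> s = t) -> countable A.
Proof.
move=> r0 sep; apply/countable_injP.
exists (fun t => pickle (Num.floor (t / r))) => s t; rewrite !inE => As At.
move=> /(pcan_inj pickleK) e; apply: sep => //.
have := floor_itv (s / r); have := floor_itv (t / r).
rewrite e; move: (Num.floor _) => n /andP[t1 t2] /andP[s1 s2].
have : `|s / r - t / r| < 1.
  by rewrite ltr_norml; move: t2 s2; rewrite intrD /= => t2 s2; apply/andP; split; lra.
by rewrite -mulrBl normrM normfV (gtr0_norm r0) ltr_pdivrMr // mul1r.
Qed.

(** Such points are isolated in the level set. Sorting them by a radius of isolation [1 / (n + 1)]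
    gives countably many uniformly separated sets. *)
Lemma countable_level h c :
  countable [set t | h t = c /\ exists2 l, l != 0 & is_derive t 1 h l].
Proof.
pose A n := [set t | h t = c /\ forall s, s != t -> `|s - t| < n.+1%:R^-1 -> h s != h t].
apply: (@sub_countable _ _ _ (\bigcup_n A n)); last first.
  apply: bigcup_countable => // n _; apply: (@countable_separated n.+1%:R^-1) => // s t [hs _] [ht h2] st.
  by apply/eqP; apply: contraT => ne; have := h2 _ ne st; rewrite hs ht eqxx.
apply: subset_card_le => t [htc [l l0 dl]].
have [r r0 hr] := isolated_level dl l0.
have [n rn] := ltr_add_invr r0.
exists n => //; split=> // s st sn; apply: hr => //.
by apply: (lt_trans sn); move: rn; rewrite add0r.
Qed.

(** Were the end values distinct, the image would contain a nondegenerate interval, which has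
    positive Lebesgue measure and cannot be countable. *)
Lemma countable_continuous_cst (k : R -> R) a b (C : set R) : a <= b ->
  {within `[a, b], continuous k} -> countable C -> (forall t, a <= t <= b -> C (k t)) ->
  k a = k b.
Proof.
move=> ab ck cC kC; apply/eqP; apply: contraT => ne.
have sub v : Num.min (k a) (k b) <= v <= Num.max (k a) (k b) -> C v.
  move=> hv; have [t tab <-] := IVT ab ck hv.
  by apply: kC; move: tab; rewrite in_itv.
have : (lebesgue_measure (`[Num.min (k a) (k b), Num.max (k a) (k b)]%classic : set R) = 0)%E.
  apply: countable_lebesgue_measure0; apply: sub_countable cC.
  by apply: subset_card_le => v; rewrite /= in_itv; exact: sub.
have lt : Num.min (k a) (k b) < Num.max (k a) (k b).
  by rewrite gt_min !lt_max !ltxx; case: ltgtP ne => // ->; rewrite eqxx.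
rewrite lebesgue_measure_itv /= lte_fin lt -EFinB => -[] /eqP.
by rewrite subr_eq0 gt_eqF.
Qed.

Lemma locally_cst f t r : (forall s, `|s - t| < r -> is_derive s 1 f 0) ->
  forall s, `|s - t| < r -> f s = f t.
Proof.
move=> df s sr.
have key a b : a <= b -> `|a - t| < r -> `|b - t| < r -> f a = f b.
  rewrite !ltr_norml => ab /andP[a1 a2] /andP[b1 b2].
  have ok x : x \in `[a, b] -> `|x - t| < r.
    by rewrite in_itv /= ltr_norml => /andP[x1 x2]; apply/andP; split; lra.
  have [x xab|//|x _] := @MVT_segment _ f (fun=> 0) a b ab.
  - by apply/df/ok; exact: subset_itv_oo_cc.
  - apply: derivable_within_continuous => x xab.
    by case: (df _ (ok _ xab)).
  - by rewrite mul0r => /eqP; rewrite subr_eq0 eq_sym => /eqP.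
have tt : `|t - t| < r by rewrite subrr normr0; apply: le_lt_trans sr.
by case: (leP s t) => [|/ltW] st; [exact: key|apply/esym; exact: key].
Qed.

Lemma periodic_max f T t0 : 0 < T -> (forall t, {for t, continuous f}) ->
  (forall t, f (t + T) = f t) ->
  exists c, f t0 <= f c /\ exists2 r, 0 < r & forall t, `|t - c| < r -> f t <= f c.
Proof.
move=> T0 cf per.
(* Two periods, so that a maximum attained at an end has a copy at the interior point [t0 + T]. *)
have cw : {within `[t0, t0 + (T + T)], continuous f}.
  by apply: continuous_subspaceT => t; exact: cf.
have le0 : t0 <= t0 + (T + T) by lra.
have [c cT cmax] := EVT_max le0 cw.
have [c' /andP[c0 cT'] e] : exists2 c', t0 < c' < t0 + (T + T) & f c' = f c.
  move: cT; rewrite in_itv /= => /andP[]; rewrite le_eqVlt => /predU1P[<- _|c0].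
    by exists (t0 + T); [apply/andP; split; lra|rewrite per].
  rewrite le_eqVlt => /predU1P[-> |c2].
    by exists (t0 + T); [apply/andP; split; lra|rewrite addrA !per].
  by exists c => //; rewrite c0.
exists c'; rewrite e; split; first by apply: cmax; rewrite in_itv /=; apply/andP; split; lra.
exists (Num.min (c' - t0) (t0 + (T + T) - c')); first by rewrite lt_min; apply/andP; split; lra.
move=> t; rewrite lt_min !ltr_norml => /andP[/andP[t1 t2] /andP[t3 t4]].
by apply: cmax; rewrite in_itv /=; apply/andP; split; lra.
Qed.

Lemma local_max_derive f c r l : 0 < r -> (forall t, `|t - c| < r -> f t <= f c) ->
  (forall t, derivable f t 1) -> is_derive c 1 f l -> l = 0.
Proof.
move=> r0 cmax df dl.
have h : is_derive c 1 f 0.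
  apply: (@derive1_at_max _ f (c - r) (c + r)) => [|t _||t].
  - by lra.
  - exact: df.
  - by rewrite in_itv /=; apply/andP; split; lra.
  - rewrite in_itv /= => /andP[h1 h2]; apply: cmax; rewrite ltr_norml; apply/andP; split; lra.
by case: dl => _ <-; case: h.
Qed.

(* Where [k] is nonzero [i] is locally constant; since [i] vanishes at a
   maximum of [k ^+ 2], it vanishes on the connected set where [k] keeps that
   value, which is therefore open as well as closed. *)
Lemma periodic_ode_cst k i m T : 0 < T ->
  (forall t, is_derive t 1 k (m t * i t * k t)) ->
  (forall t, derivable i t 1) -> (forall t, m t != 0) ->
  (forall t, k t != 0 -> is_derive t 1 i 0) ->
  (forall t, k (t + T) = k t) -> forall s t, k s = k t.
Proof.
move=> T0 dk di m0 di0 per.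
have [[t0 kt0]|none] := pselect (exists t, k t != 0); last first.
  have z t : k t = 0 by apply/eqP; apply: contrapT => /negP h; apply: none; exists t.
  by move=> s t; rewrite !z.
have ck t : {for t, continuous k} by exact: is_derive1_continuous (dk t).
have ci t : {for t, continuous i} by apply/differentiable_continuous/derivable1_diffP.
have dk2 t : is_derive t 1 (k * k) (k t *: (m t * i t * k t) + k t *: (m t * i t * k t)).
  exact: is_deriveM.
have [c [kc [r r0 cmax]]] : exists c, (k * k) t0 <= (k * k) c /\
    exists2 r, 0 < r & forall t, `|t - c| < r -> (k * k) t <= (k * k) c.
  apply: (periodic_max _ T0) => t; first exact: is_derive1_continuous (dk2 t).
  by rewrite !fctE per.
have kc0 : k c != 0.
  apply: contraTneq kc => e; rewrite !fctE e mul0r -ltNge -expr2.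
  by rewrite lt_def expf_neq0 //= sqr_ge0.
have ic0 : i c = 0.
  have := local_max_derive r0 cmax (fun t => ltac:(by case: (dk2 t))) (dk2 c).
  rewrite /GRing.scale /= -mulr2n -mulr_natl => /eqP.
  rewrite !mulf_eq0 (negbTE kc0) (negbTE (m0 c)) (pnatr_eq0 _ 2) /= orbF => /eqP //.
pose B := [set t | k t = k c /\ i t = 0].
have Bo : open B.
  rewrite openE => t [kt it]; rewrite /interior.
  have : \forall s \near t, k s != 0 by apply: (cvgr_neq0 _ (ck t)); rewrite kt.
  move=> /nbhs_normP /= [e e0 he].
  have i0 s : `|s - t| < e -> i s = 0.
    move=> se; rewrite -it; apply: (locally_cst _ se) => u ue; apply: di0.
    by apply: he; rewrite /= distrC.
  have k0 s : `|s - t| < e -> k s = k c.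
    move=> se; rewrite -kt; apply: (locally_cst _ se) => u ue.
    by have := dk u; rewrite (i0 _ ue) mulr0 mul0r.
  by apply/nbhs_normP; exists e => //= s; rewrite /= distrC => se; split; [exact: k0|exact: i0].
have Bc : closed B.
  have cl (f : R -> R) y : (forall t, {for t, continuous f}) -> closed [set t | f t = y].
    by move=> cf; apply: (@preimage_closed _ _ f [set z | z = y]) => [t _|]; [exact: cf|exact: closed_eq].
  by apply: closedI; exact: cl.
have BT : B = setT.
  have cT : connected [set: R] by apply/connected_intervalP => x y _ _ z _.
  apply: cT; first by exists c.
    by exists B => //; rewrite setTI.
  by exists B => //; rewrite setTI.
have kE t : k t = k c by have [] : B t by rewrite BT.
by move=> s t; rewrite !kE.
Qed.
End OneVariable.

Section LevelCurve.
Context {R : realType} {V : normedModType R}.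

(** The arithmetic of tangency: [(t, th)] is a displacement along the level curve and [H] its norm.
    The bound for [f] first yields [|th| <= t]; the bound for [g] then controls its slope [c] by a
    multiple of [e]. *)
Lemma slope_estimate (a e fw gw c t th H : R) : 0 < a -> 0 < fw -> 0 < e -> e * a <= fw / 2 ->
  0 < t -> H <= a * (t + `|th|) -> `|th * fw| <= e * H -> `|t * c + th * gw| <= e * H ->
  `|c| <= e * (2 * a * (`|gw| / fw + 1)).
Proof.
move=> a0 fw0 e0 ea t0 hH h1 h2.
have ea0 : 0 < e * a by rewrite mulr_gt0.
have th0 : 0 <= `|th| by [].
have eH : e * H <= e * a * (t + `|th|) by rewrite -mulrA ler_pM2l.
rewrite normrM (gtr0_norm fw0) in h1.
have tht : `|th| <= t.
  have : `|th| * fw <= fw / 2 * (t + `|th|).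
    apply: (le_trans h1); apply: (le_trans eH); apply: ler_wpM2r => //.
    by rewrite addr_ge0 // ltW.
  by move=> h; have : fw * `|th| <= fw * t by [lra]; rewrite ler_pM2l.
have eH2 : e * H <= e * (2 * a) * t.
  apply: (le_trans eH); rewrite -!mulrA ler_pM2l // mulrCA ler_pM2l //; lra.
have thfw : `|th| <= e * (2 * a) * t / fw by rewrite ler_pdivlMr //; exact: le_trans h1 eH2.
have tc : t * `|c| <= e * (2 * a) * t + `|th| * `|gw|.
  rewrite -(gtr0_norm t0) -!normrM (gtr0_norm t0).
  have -> : t * c = (t * c + th * gw) - th * gw by ring.
  by apply: (le_trans (ler_normB _ _)); apply: lerD => //; exact: le_trans h2 eH2.
rewrite -(ler_pM2l t0); apply: (le_trans tc).
have -> : t * (e * (2 * a * (`|gw| / fw + 1))) = e * (2 * a) * t + e * (2 * a) * t / fw * `|gw| by ring.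
by apply: lerD => //; apply: ler_wpM2r.
Qed.

Lemma dist_lt_of (x y z e : R) : x - z < y -> y < x + z -> z <= e -> `|x - y| < e.
Proof. by move=> h1 h2 h3; rewrite ltr_norml; apply/andP; split; lra. Qed.

Lemma diff_estimate (f : V -> R) z (e : R) : differentiable f z -> 0 < e ->
  \forall h \near (0 : V), `|f (h + z) - f z - 'd f z h| <= e * `|h|.
Proof.
move=> df e0; have /eqaddoP/(_ e e0) := diff_locally df.
by apply: filterS => h; rewrite !fctE /= opprD addrA.
Qed.

Variables (f g : V -> R) (W : set V) (z0 sg w : V) (C : set R).
Hypotheses (Wo : open W) (Wz0 : W z0) (fs : smooth_on W f)
  (gd : forall z, W z -> differentiable g z)
  (f_sg : 'D_sg f z0 = 0) (cC : countable C)
  (gC : forall z, W z -> f z = f z0 -> C (g z)).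

Let p (t th : R) : V := z0 + t *: sg + th *: w.

(* By the implicit function theorem the level curve of [f] through [z0] in the
   plane spanned by [sg] and [w] is tangent to [sg]; on it [g] takes
   countably many values, hence is constant. *)
Lemma level_curve_pos : 0 < 'D_w f z0 -> 'D_sg g z0 = 0.
Proof.
move=> fw0.
have dfz z : W z -> differentiable f z by exact: smooth_on_diff.
have [rho rho0 hrho] : exists2 r, 0 < r & forall z, `|z0 - z| < r -> W z /\ 0 < 'D_w f z.
  have c0 : \forall z \near z0, W z by exact: open_nbhs_nbhs.
  have cw : {for z0, continuous ('D_w f)}.
    by apply: differentiable_continuous; apply: (smooth_on_diff _ Wz0); exact: smooth_on_derive.
  have c1 : \forall z \near z0, 0 < 'D_w f z by exact: (cvgr_gt _ cw).
  have : \forall z \near z0, W z /\ 0 < 'D_w f z.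
    by apply: filterS2 c0 c1 => z h1 h2; exact: (conj h1 h2).
  by move=> /nbhs_normP [r r0 hr]; exists r.
pose a := `|sg| + `|w| + 1.
have a0 : 0 < a by rewrite ltr_wpDl // addr_ge0.
have pn (t th : R) : `|t *: sg + th *: w| <= a * (`|t| + `|th|).
  apply: (le_trans (ler_normD _ _)); rewrite !normrZ mulrDr.
  apply: lerD; rewrite mulrC; apply: ler_wpM2r => //; rewrite /a.
    by rewrite -addrA lerDl addr_ge0.
  by rewrite addrAC lerDr addr_ge0.
(* The box of half-side [r] in the plane of [sg] and [w] stays within [rho / 2] of [z0]. *)
pose r := rho / (4 * a).
have r0 : 0 < r by rewrite divr_gt0 // mulr_gt0.
have inb (t th : R) : `|t| <= r -> `|th| <= r -> W (p t th) /\ 0 < 'D_w f (p t th).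
  move=> tr thr; apply: hrho; rewrite /p -addrA opprD addrA subrr add0r normrN.
  apply: (le_lt_trans (pn t th)).
  apply: (@le_lt_trans _ _ (a * (r + r))); first by rewrite ler_pM2l // lerD.
  have -> : a * (r + r) = rho / 2 by rewrite /r; field; rewrite gt_eqF.
  by lra.
have rr : `|r| <= r by rewrite gtr0_norm.
have Nrr : `|- r| <= r by rewrite normrN gtr0_norm.
have fth (t th : R) : `|t| <= r -> `|th| <= r ->
    is_derive th 1 (fun s => f (p t s)) ('D_w f (p t th)).
  by move=> tr thr; apply: derive_line; apply: dfz; case: (inb _ _ tr thr).
have mono (t s1 s2 : R) : `|t| <= r -> `|s1| <= r -> `|s2| <= r -> s1 < s2 -> f (p t s1) < f (p t s2).
  move=> tr; rewrite !ler_norml => /andP[a1 a2] /andP[b1 b2] lt.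
  have ok x : x \in `[s1, s2] -> `|x| <= r.
    by rewrite in_itv /= ler_norml => /andP[x1 x2]; apply/andP; split; lra.
  have [x xab|x xab|x xab e] := @MVT _ (fun s => f (p t s)) (fun s => 'D_w f (p t s)) s1 s2 lt.
  - by apply: fth => //; apply/ok/subset_itv_oo_cc.
  - by move: x xab; apply: derivable_within_continuous => x xab; case: (fth t x tr (ok _ xab)).
  rewrite -subr_gt0 e mulr_gt0 ?subr_gt0 //.
  by have [] := inb t x tr (ok _ (subset_itv_oo_cc xab)).
have le_of (t s1 s2 : R) : `|t| <= r -> `|s1| <= r -> `|s2| <= r -> f (p t s1) < f (p t s2) -> s1 < s2.
  move=> tr h1 h2 lt; rewrite ltNge; apply/negP; rewrite le_eqVlt => /predU1P[e|l].
    by move: lt; rewrite e ltxx.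
  by have := mono _ _ _ tr h2 h1 l; move/lt_trans/(_ lt); rewrite ltxx.
have contt (th t : R) : `|th| <= r -> `|t| <= r -> {for t, continuous (fun s => f (p s th))}.
  move=> thr tr; have [Wp _] := inb t th tr thr.
  have e s : p s th = z0 + th *: w + s *: sg by rewrite /p addrAC.
  have -> : (fun s => f (p s th)) = (fun s => f (z0 + th *: w + s *: sg)).
    by apply/funext => s; rewrite e.
  rewrite e in Wp; exact: is_derive1_continuous (derive_line (dfz _ Wp)).
have p00 : p 0 0 = z0 by rewrite /p !scale0r !addr0.
have n0 : `|0 : R| <= r by rewrite normr0 ltW.
have [dl dl0 hdl] : exists2 d, 0 < d & forall t : R, `|t| < d ->
    [/\ `|t| <= r, f (p t (- r)) < f z0 & f z0 < f (p t r)].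
  have c1 : \forall t \near (0 : R), f (p t (- r)) < f z0.
    by apply: (cvgr_lt _ (contt _ _ Nrr n0)); rewrite -p00; apply: mono => //; lra.
  have c2 : \forall t \near (0 : R), f z0 < f (p t r).
    by apply: (cvgr_gt _ (contt _ _ rr n0)); rewrite -p00; apply: mono.
  have c3 : \forall t \near (0 : R), `|t| <= r.
    by apply/nbhs_normP; exists r => [|t]; [exact: r0|rewrite /= sub0r normrN; exact: ltW].
  have : \forall t \near (0 : R), [/\ `|t| <= r, f (p t (- r)) < f z0 & f z0 < f (p t r)].
    by apply: filterS3 c3 c1 c2 => t h1 h2 h3; exact: (And3 h1 h2 h3).
  move=> /nbhs_normP [d /= d0 hd]; exists d => // t td; apply: hd.
  by rewrite /= sub0r normrN.
(* The implicit function, from the intermediate value theorem on each segment in direction [w]; 0 is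
   a dummy value for large [t]. *)
have /choice [Th hTh] : forall t : R, exists th : R, `|t| < dl -> `|th| < r /\ f (p t th) = f z0.
  move=> t; have [tdl|ntdl] := pselect (`|t| < dl); last by exists 0 => /ntdl.
  have [tr f1 f2] := hdl _ tdl.
  have Nr_r : - r <= r by lra.
  have cw : {within `[- r, r], continuous (fun s => f (p t s))}.
    apply: derivable_within_continuous => x; rewrite in_itv /= => /andP[x1 x2].
    have xr : `|x| <= r by rewrite ler_norml x1.
    by case: (fth t x tr xr).
  have [|th] := @IVT _ (fun s => f (p t s)) _ _ (f z0) Nr_r cw.
    by apply/andP; split; [rewrite ge_min /= (ltW f1)|rewrite le_max /= (ltW f2) orbT].
  rewrite in_itv /= => /andP[h1 h2] fe; exists th => _; split=> //.
  have thr : `|th| <= r by rewrite ler_norml h1.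
  rewrite ltr_norml; apply/andP; split.
    by apply: (le_of t) => //; rewrite fe.
  by apply: (le_of t) => //; rewrite fe.
have Th0 : Th 0 = 0.
  have [|h1 h2] := hTh 0; first by rewrite normr0.
  apply/eqP; rewrite eq_le !leNgt; apply/andP; split; apply/negP => l.
    by have := mono 0 _ _ n0 n0 (ltW h1) l; rewrite h2 p00 ltxx.
  by have := mono 0 _ _ n0 (ltW h1) n0 l; rewrite h2 p00 ltxx.
have dlr (t : R) : `|t| < dl -> `|t| <= r by move=> h; have [] := hdl _ h.
have near_dl (t1 : R) : `|t1| < dl -> \forall t \near t1, `|t| < dl.
  by move=> h; apply: (cvgr_lt _ (@norm_continuous _ _ t1)).
have cTh (t1 : R) : `|t1| < dl -> {for t1, continuous Th}.
  move=> h1; have [th1r fe] := hTh _ h1.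
  apply/cvgrPdist_lt => e e0.
  (* The second bound keeps [Th t1 - e'] and [Th t1 + e'] inside the box, where monotonicity traps
     the nearby values of [Th]. *)
  pose e' := Num.min e (r - `|Th t1|).
  have e'0 : 0 < e' by rewrite lt_min e0 subr_gt0.
  have e'e : e' <= e by rewrite ge_min lexx.
  have e'r : `|Th t1| + e' <= r by rewrite -lerBrDl ge_min lexx orbT.
  have b1 : `|Th t1 - e'| <= r.
    by apply: le_trans e'r; apply: (le_trans (ler_normB _ _)); rewrite (gtr0_norm e'0).
  have b2 : `|Th t1 + e'| <= r.
    by apply: le_trans e'r; apply: (le_trans (ler_normD _ _)); rewrite (gtr0_norm e'0).
  have t1r := dlr _ h1.
  have c1 : \forall t \near t1, f (p t (Th t1 - e')) < f z0.
    apply: (cvgr_lt _ (contt _ _ b1 t1r)); rewrite -fe; apply: mono => //; first exact: ltW.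
    by rewrite ltrBlDr ltrDl.
  have c2 : \forall t \near t1, f z0 < f (p t (Th t1 + e')).
    apply: (cvgr_gt _ (contt _ _ b2 t1r)); rewrite -fe; apply: mono => //; first exact: ltW.
    by rewrite ltrDl.
  apply: filterS3 (near_dl _ h1) c1 c2 => t tdl k1 k2.
  have [thr fet] := hTh _ tdl; rewrite -fet in k1 k2.
  have l1 := le_of t _ _ (dlr _ tdl) b1 (ltW thr) k1.
  have l2 := le_of t _ _ (dlr _ tdl) (ltW thr) b2 k2.
  exact: dist_lt_of l1 l2 e'e.
pose k t := g (p t (Th t)).
have Wp (t : R) : `|t| < dl -> W (p t (Th t)).
  by move=> h; have [h1 _] := hTh _ h; have [] := inb _ _ (dlr _ h) (ltW h1).
have ck (t1 : R) : `|t1| < dl -> {for t1, continuous k}.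
  move=> h1; have cp : {for t1, continuous (fun t => p t (Th t))}.
    apply: cvgD; last by apply: cvgZr_tmp; exact: cTh.
    by apply: cvgD; [exact: cvg_cst|apply: cvgZr_tmp; exact: cvg_id].
  apply: (@continuous_comp _ _ _ (fun t => p t (Th t)) g) => //.
  exact/differentiable_continuous/gd/Wp.
have kcst (t : R) : 0 <= t -> `|t| < dl -> k t = k 0.
  move=> t0 h; apply/esym; apply: (countable_continuous_cst t0 _ cC) => [|s /andP[s0 st]].
    apply: continuous_in_subspaceT => s; rewrite inE /= in_itv /= => /andP[s0 st].
    by apply: ck; rewrite ger0_norm //; apply: le_lt_trans st _; rewrite -(ger0_norm t0).
  have sdl : `|s| < dl by rewrite ger0_norm //; apply: le_lt_trans st _; rewrite -(ger0_norm t0).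
  by apply: gC; [exact: Wp|have [] := hTh _ sdl].
have dfz0 := dfz _ Wz0; have dgz0 := gd Wz0.
(* The first-order estimates of [f] and [g] are read at one point of the curve close to [z0], where
   both functions take their values at [z0]. *)
have est (e : R) : 0 < e -> e * a <= 'D_w f z0 / 2 ->
    `|'D_sg g z0| <= e * (2 * a * (`|'D_w g z0| / 'D_w f z0 + 1)).
  move=> e0 ea.
  pose u (t : R) : V := t *: sg + Th t *: w.
  have ch : u t @[t --> (0 : R)] --> (0 : V).
    have -> : (0 : V) = (0 : R) *: sg + Th 0 *: w by rewrite Th0 !scale0r addr0.
    by apply: cvgD; apply: cvgZr_tmp; [exact: cvg_id|apply: cTh; rewrite normr0].
  have c1 : \forall t \near (0 : R), `|f (u t + z0) - f z0 - 'd f z0 (u t)| <= e * `|u t|.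
    exact: ch _ (diff_estimate dfz0 e0).
  have c2 : \forall t \near (0 : R), `|g (u t + z0) - g z0 - 'd g z0 (u t)| <= e * `|u t|.
    exact: ch _ (diff_estimate dgz0 e0).
  have n0dl : `|0 : R| < dl by rewrite normr0.
  have : \forall t \near (0 : R), [/\ `|t| < dl,
      `|f (u t + z0) - f z0 - 'd f z0 (u t)| <= e * `|u t| &
      `|g (u t + z0) - g z0 - 'd g z0 (u t)| <= e * `|u t|].
    by apply: filterS3 (near_dl _ n0dl) c1 c2 => t h1 h2 h3; exact: (And3 h1 h2 h3).
  move=> /nbhs_normP [d /= d0 hd].
  pose t := d / 2; have t0 : 0 < t by rewrite divr_gt0.
  have [] := hd t; first by rewrite /= sub0r normrN gtr0_norm // /t; lra.
  rewrite /u => tdl k1 k2.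
  have pz : t *: sg + Th t *: w + z0 = p t (Th t) by rewrite /p addrC addrA.
  have [thr fe] := hTh _ tdl.
  have kt := kcst t (ltW t0) tdl; rewrite /k Th0 p00 in kt.
  rewrite pz fe subrr sub0r normrN in k1; rewrite pz kt subrr sub0r normrN in k2.
  rewrite linearD !linearZZ -!(deriveE _ dfz0) f_sg scaler0 add0r in k1.
  rewrite linearD !linearZZ -!(deriveE _ dgz0) in k2.
  apply: (slope_estimate a0 fw0 e0 ea t0 _ k1 k2).
  by have := pn t (Th t); rewrite (gtr0_norm t0).
apply/eqP; apply: contraT => c0.
pose cst := 2 * a * (`|'D_w g z0| / 'D_w f z0 + 1).
have cst0 : 0 < cst.
  by rewrite mulr_gt0 ?mulr_gt0 // ltr_wpDl // divr_ge0 // ltW.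
(* The first bound is the smallness that [est] asks for; the second makes its conclusion at most
   half of the nonzero number being estimated. *)
pose e := Num.min ('D_w f z0 / 2 / a) (`|'D_sg g z0| / 2 / cst).
have e0 : 0 < e by rewrite lt_min !divr_gt0 // normr_gt0.
have e1 : e * a <= 'D_w f z0 / 2 by rewrite -ler_pdivlMr // ge_min lexx.
have e2 : e * cst <= `|'D_sg g z0| / 2 by rewrite -ler_pdivlMr // ge_min lexx orbT.
have := le_trans (est _ e0 e1) e2.
have : 0 < `|'D_sg g z0| by rewrite normr_gt0.
by move=> h1 h2; lra.
Qed.

End LevelCurve.

Lemma level_curve (R : realType) (V : normedModType R) (f g : V -> R) (W : set V) z0 sg w (C : set R) :
  open W -> W z0 -> smooth_on W f -> (forall z, W z -> differentiable g z) ->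
  'D_sg f z0 = 0 -> countable C -> (forall z, W z -> f z = f z0 -> C (g z)) ->
  'D_w f z0 != 0 -> 'D_sg g z0 = 0.
Proof.
move=> Wo Wz0 fs gd f_sg cC gC; rewrite neq_lt => /orP[lt0|]; last first.
  exact: (level_curve_pos Wo Wz0 fs gd f_sg cC gC).
apply: (@level_curve_pos _ _ f g W z0 sg (- w) C) => //.
have df := smooth_on_diff fs Wz0.
by rewrite (deriveE _ df) linearN -(deriveE _ df) oppr_gt0.
Qed.

(** * Constancy of the curvature on a fibre *)

Section FiberCurves.
Context {R : realType}.

Definition circle (t : R) : 'rV[R]_2 := \row_j (if j == i0 then cos t else sin t).

Lemma circleE t : circle t = cos t *: delta_mx 0 i0 + sin t *: delta_mx 0 i1.
Proof. by rewrite [LHS]row2_decomp !mxE. Qed.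

Lemma circle_neq0 t : circle t != 0.
Proof.
apply/eqP => /rowP e; have := cos2Dsin2 t; have := e i0; have := e i1.
by rewrite !mxE /= => -> ->; rewrite expr0n /= addr0 => /eqP; rewrite eq_sym oner_eq0.
Qed.

Lemma polar (y : 'rV[R]_2) : y != 0 -> exists r t, 0 < r /\ y = r *: circle t.
Proof.
move=> y0; pose n := y 0 i0 ^+ 2 + y 0 i1 ^+ 2.
have n0 : 0 < n.
  rewrite lt_def /n addr_ge0 ?sqr_ge0 // andbT paddr_eq0 ?sqr_ge0 // !sqrf_eq0.
  apply: contra y0 => /andP[/eqP e0 /eqP e1]; apply/eqP/rowP => j; rewrite mxE.
  by case: (I2P j) => ->.
pose r := Num.sqrt n; have r0 : 0 < r by rewrite sqrtr_gt0.
have rn : r ^+ 2 = n by rewrite sqr_sqrtr // ltW.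
have r1 : r != 0 by rewrite gt_eqF.
pose c := y 0 i0 / r; pose d := y 0 i1 / r.
have cd : c ^+ 2 + d ^+ 2 = 1.
  by rewrite /c /d !expr_div_n -mulrDl rn mulfV // gt_eqF.
have c1 : -1 <= c <= 1.
  rewrite -ler_norml -(@ler_sqr _ `|c|) ?nnegrE // expr1n real_normK ?num_real //.
  by rewrite -cd lerDl sqr_ge0.
have ca : cos (acos c) = c by apply: acosK; rewrite in_itv.
have sa : sin (acos c) = `|d|.
  by rewrite sin_acos // -sqrtr_sqr; congr (Num.sqrt _); rewrite -cd; ring.
have [d0|d0] := leP 0 d.
  exists r, (acos c); split=> //; apply/rowP => j; rewrite !mxE.
  case: (I2P j) => -> /=; first by rewrite ca /c mulrCA mulfV // mulr1.
  by rewrite sa ger0_norm // /d mulrCA mulfV // mulr1.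
exists r, (- acos c); split=> //; apply/rowP => j; rewrite !mxE.
case: (I2P j) => -> /=; first by rewrite cosN ca /c mulrCA mulfV // mulr1.
by rewrite sinN sa ltr0_norm // opprK /d mulrCA mulfV // mulr1.
Qed.

Lemma derive_combination (V : normedModType R) (a b c : V) (k l : R -> R) (t dk dl : R) :
  is_derive t 1 k dk -> is_derive t 1 l dl ->
  differentiable (fun s => a + k s *: b + l s *: c) t /\
  'D_1 (fun s => a + k s *: b + l s *: c) t = dk *: b + dl *: c.
Proof.
move=> [hk ek] [hl el].
have {}hk := (derivable1_diffP k t).1 hk.
have {}hl := (derivable1_diffP l t).1 hl.
have d0 : differentiable (cst a : R -> V) t by exact: differentiable_cst.
have d1 : differentiable (fun s : R => k s *: b) t by exact: differentiableZl.
have d2 : differentiable (fun s : R => l s *: c) t by exact: differentiableZl.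
have d01 := differentiableD d0 d1; have d := differentiableD d01 d2.
split; first exact: d.
have e := congr1 (fun p : R -> V => p 1) (diffD d01 d2).
have e' := congr1 (fun p : R -> V => p 1) (diffD d0 d1).
have e0 := congr1 (fun p : R -> V => p 1) (@diff_cst R R V a t).
have e1 := congr1 (fun p : R -> V => p 1) (diffZl b hk).
have e2 := congr1 (fun p : R -> V => p 1) (diffZl c hl).
suff E : 'd (cst a + (fun s : R => k s *: b) + (fun s : R => l s *: c)) t 1 = dk *: b + dl *: c.
  have d' : differentiable (fun s => a + k s *: b + l s *: c) t by exact: d.
  by rewrite (deriveE _ d'); exact: E.
rewrite e /= e' /= e0 e1 e2 /=.
by rewrite add0r -(deriveE _ hk) -(deriveE _ hl) ek el.
Qed.

Lemma derive_circle (f : TU R -> R) (x : 'rV[R]_2) t : differentiable f (x, circle t) ->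
  is_derive t 1 (fun s => f (x, circle s))
    (cos t * 'D_(ey i1) f (x, circle t) - sin t * 'D_(ey i0) f (x, circle t)).
Proof.
move=> df.
pose c (s : R) : TU R := (x, 0) + cos s *: ey i0 + sin s *: ey i1.
have cE s : (x, circle s) = c s.
  by rewrite /c /ey; apply: injective_projections => /=;
    rewrite ?scaler0 ?addr0 ?add0r // circleE.
have [dc Dc] := @derive_combination _ (x, 0) (ey i0) (ey i1) _ _ t _ _ (is_derive_cos t) (is_derive_sin t).
rewrite -/c in dc Dc.
rewrite cE in df *.
have -> : (fun s => f (x, circle s)) = f \o c by apply/funext => s; rewrite /= -cE.
apply: DeriveDef; first exact/derivable1_diffP/(differentiable_comp dc df).
rewrite (@derive_comp _ R _ _ c f t 1 dc df) Dc !(deriveE _ df) [LHS]linearD [in LHS]linearZZ [X in _ + X]linearZZ.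
by rewrite addrC scaleNr.
Qed.

End FiberCurves.

Section FiberConstancy.
Context {R : realType} (U : set 'rV[R]_2) (L : TU R -> R).
Hypothesis lf : local_finsler U L.
Let D := slit (lf_open lf).
Local Notation A := (sf_tring D).
Local Notation F := (loc_fdata lf).
Local Notation I := (mscal F : sf D).
Local Notation J := (vert F (mscal F) : sf D).

(** One tangent vector serves for all functions at once, so the level-curve lemma can use the same
    direction for [I] and for [V I]. *)
Lemma geodE_derive (f : sf D) z : dset D z ->
  exists2 sg : TU R, geod F f z = 'D_sg f z & forall g : sf D, geod F g z = 'D_sg g z.
Proof.
move=> Dz.
pose sg : TU R := (z.2, \row_j (if j == i0 then - (G1 F z + G1 F z) else - (G2 F z + G2 F z))).
suff h (g : sf D) : geod F g z = 'D_sg g z by exists sg.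
rewrite (derive_frame _ (sf_diff g Dz)) !mxE /=.
have -> : (geod F g : sf D) z = z.2 0 i0 * dv (ex i0) g z + z.2 0 i1 * dv (ex i1) g z
  - (G1 F z + G1 F z) * dv (ey i0) g z - (G2 F z + G2 F z) * dv (ey i1) g z.
  have -> : (geod F g : sf D) = sy i0 * dv (ex i0) g + sy i1 * dv (ex i1) g -
    (G1 F + G1 F) * dv (ey i0) g - (G2 F + G2 F) * dv (ey i1) g by [].
  by rewrite !(sfDE _ _ Dz, sfNE _ Dz, sfME _ _ Dz, syE _ Dz).
rewrite !(dvE _ _ Dz) -!addrA; congr (_ + (_ + _)).
by rewrite !mulNr.
Qed.

Lemma vertE_derive z : dset D z ->
  exists w : TU R, forall g : sf D, vert F g z = 'D_w g z.
Proof.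
move=> Dz.
pose w : TU R := (0, \row_j (if j == i0 then loc_si lf z * dv (ey i1) (loc_E lf) z
  else - (loc_si lf z * dv (ey i0) (loc_E lf) z))).
exists w => g; rewrite (derive_fiber _ (sf_diff g Dz)) !mxE /=.
have -> : (vert F g : sf D) = loc_si lf * (dv (ey i1) (loc_E lf) * dv (ey i0) g
   - dv (ey i0) (loc_E lf) * dv (ey i1) g) by [].
rewrite !(sfME _ _ Dz, sfDE _ _ Dz, sfNE _ Dz) !(dvE _ g Dz).
move: ('D_(ey i0) g z) ('D_(ey i1) g z) (loc_si lf z) => p q r.
move: (dv (ey i0) (loc_E lf) z) (dv (ey i1) (loc_E lf) z) => a b.
by ring.
Qed.

Lemma ray_cst (f : sf D) x y (a : R) : eul (f : A) = 0 -> dset D (x, y) -> 0 < a ->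
  f (x, a *: y) = f (x, y).
Proof.
move=> ef [/= Ux y0] a0.
have Dt (t : R) : 0 < t -> dset D (x, t *: y).
  by move=> t0; split=> //=; rewrite scaler_eq0 negb_or y0 gt_eqF.
have dt (t : R) : 0 < t -> is_derive t 1 (fun s : R => f (x, s *: y)) 0.
  move=> t0; have e s : (x, s *: y) = (x, 0) + s *: ((0, y) : TU R).
    by apply: injective_projections; rewrite /= ?scaler0 ?addr0 ?add0r.
  have -> : (fun s : R => f (x, s *: y)) = (fun s : R => f ((x, 0) + s *: ((0, y) : TU R))).
    by apply/funext => s; rewrite e.
  have Dtt := Dt _ t0; have df := sf_diff f Dtt.
  have z0 : 'D_(0, y) f (x, t *: y) = 0.
    rewrite (derive_fiber _ df); apply: (mulfI (lt0r_neq0 t0)).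
    have := congr1 (fun h : sf D => h (x, t *: y)) ef.
    have -> : (eul (f : A) : sf D) = sy i0 * dv (ey i0) f + sy i1 * dv (ey i1) f by [].
    rewrite (sfDE _ _ Dtt) !(sfME _ _ Dtt) !(syE _ Dtt) (sf0E Dtt) !(dvE _ f Dtt) !mxE.
    move: ('D_(ey i0) f (x, t *: y)) ('D_(ey i1) f (x, t *: y)) (y 0 i0) (y 0 i1) => p q v w h.
    by rewrite mulr0 -[RHS]h mulrDr !mulrA.
  by rewrite e in df z0; have := derive_line df; rewrite z0.
(* The interval of radius [a + 1] around [a + 1] consists of positive numbers and contains both [a]
   and 1. *)
have c0 (t : R) : `|t - (a + 1)| < a + 1 -> f (x, t *: y) = f (x, (a + 1) *: y).
  apply: (@locally_cst _ (fun s => f (x, s *: y))) => s.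
  by rewrite ltr_norml => /andP[h _]; apply: dt; lra.
rewrite -[in RHS](scale1r y) !c0 // ltr_norml; apply/andP; split; lra.
Qed.

(** On functions of degree zero the rotation field is a nowhere zero multiple of [V], so the
    coordinate circle can stand for the indicatrix. *)
Lemma derive_circle_vert (f : sf D) x (t : R) : U x -> eul (f : A) = 0 ->
  is_derive t 1 (fun s => f (x, circle s))
    (- (loc_s lf (x, circle t) / (loc_E lf (x, circle t) + loc_E lf (x, circle t))) *
      vert F f (x, circle t)).
Proof.
move=> Ux ef; have Dz : dset D (x, circle t) by split=> //; exact: circle_neq0.
have h := derive_circle (sf_diff f Dz).
suff e : cos t * 'D_(ey i1) f (x, circle t) - sin t * 'D_(ey i0) f (x, circle t) =
   - (loc_s lf (x, circle t) / (loc_E lf (x, circle t) + loc_E lf (x, circle t))) *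
      vert F f (x, circle t) by rewrite -e.
have ev (p q r d0 d1 : sf D) : (p + p) * (sy i0 * d1 - sy i1 * d0) =
    - ((sy i0 * sy i0 + sy i1 * sy i1) * (q * r)) ->
    (p (x, circle t) + p (x, circle t)) *
      (cos t * d1 (x, circle t) - sin t * d0 (x, circle t)) =
    - (q (x, circle t) * r (x, circle t)).
  move=> /(congr1 (fun h : sf D => h (x, circle t))).
  rewrite !(sfME _ _ Dz, sfDE _ _ Dz, sfNE _ Dz, syE _ Dz) !mxE /= -!expr2 cos2Dsin2 mul1r.
  by [].
have := ev _ _ _ _ _ (rotation_vert F ef).
rewrite -[Y1 (f : A)]/(dv (ey i0) f) -[Y2 (f : A)]/(dv (ey i1) f) !(dvE _ f Dz).
rewrite -[E F]/(loc_E lf) -[s F]/(loc_s lf).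
have E0 : loc_E lf (x, circle t) + loc_E lf (x, circle t) != 0.
  by rewrite gt_eqF // addr_gt0 // loc_E_gt0.
move=> e; apply: (mulfI E0); rewrite e.
move: (loc_E lf (x, circle t) + _) E0 => p p0.
by rewrite mulNr mulrN !mulrA; congr (- _); rewrite -!mulrA (mulrCA p) mulVKf.
Qed.

Definition loc_K : A := jac F * (Ei F * half lf).

Lemma loc_KE z : dset D z -> (loc_K : sf D) z = jac F z / (loc_E lf z + loc_E lf z).
Proof.
move=> Dz; have E0 := loc_E_gt0 Dz.
have E1 : loc_E lf z != 0 by rewrite gt_eqF.
have E2 : loc_E lf z + loc_E lf z != 0 by rewrite gt_eqF // addr_gt0.
rewrite (sfME (jac F) _ Dz) (sfME (loc_Ei lf) (half lf) Dz); congr (_ * _).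
have := congr1 (fun h : sf D => h z) (loc_EEi lf).
have := congr1 (fun h : sf D => h z) (half2 lf).
rewrite (sfDE (half lf) _ Dz) (sfME (loc_E lf) (loc_Ei lf) Dz) !(sf1E Dz) => h1 h2.
apply: (mulfI E2); rewrite mulfV //.
transitivity ((loc_E lf z * loc_Ei lf z) * ((half lf : sf D) z + (half lf : sf D) z)); first by ring.
by rewrite h1 h2 mulr1.
Qed.

Lemma eul_half : eul (half lf : A) = 0.
Proof.
have -> : eul (half lf : A) = sy i0 * dv (ey i0) (half lf) + sy i1 * dv (ey i1) (half lf) by [].
by rewrite !dv_half !mulr0 addr0.
Qed.

Lemma vert_half : vert F (half lf : A) = 0.
Proof.
have -> : vert F (half lf : A) = si F * (Y2 (E F) * dv (ey i0) (half lf) - Y1 (E F) * dv (ey i1) (half lf)) by [].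
by rewrite !dv_half !mulr0 subr0 mulr0.
Qed.

Lemma eul_K : eul loc_K = 0.
Proof.
have hE : eul (Ei F) = - (Ei F + Ei F).
  have := congr1 (@eul A) (EEi F); rewrite (derivM (eul_deriv A)) (deriv1 (eul_deriv A)) eulE => h.
  apply: (E_inj (F := F)).
  by apply: (lin_comb1 1 h); ring.
rewrite (derivM (eul_deriv A) (jac F)) (derivM (eul_deriv A) (Ei F)) hE eul_half.
by rewrite (eul_jac F); ring.
Qed.

Section Landsberg.
Hypothesis land : forall z u v w, dset D z -> landsberg L z u v w = 0.

Let B111 := berwald_rep land i0 i0 i0.
Let B112 := berwald_rep land i0 i0 i1.
Let B122 := berwald_rep land i0 i1 i1.
Let B222 := berwald_rep land i1 i1 i1.

Lemma loc_geod_mscal : geod F I = 0.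
Proof. exact: (@geod_mscal A F B111 B112 B122 B222). Qed.

(** [V] annihilates [E], so the equation for [jac] passes to its quotient by [2 E]. *)
Lemma loc_vert_K : vert F loc_K = - (I * loc_K).
Proof.
have hE : vert F (Ei F) = 0.
  have := congr1 (vert F) (EEi F); rewrite (derivM (vert_deriv F)) (deriv1 (vert_deriv F)) vertE => h.
  apply: (E_inj (F := F)).
  by apply: (lin_comb1 1 h); ring.
rewrite (derivM (vert_deriv F) (jac F)) (derivM (vert_deriv F) (Ei F)) hE vert_half.
by rewrite (@vert_jac A F B111 B112 B122 B222) /loc_K; ring.
Qed.

(* An isometry carries the fibre of [z] onto the fibre over [x0]; it may reverse
   the orientation, so it preserves [I] only up to sign. *)
Hypothesis hom : forall x0 z, U x0 -> dset D z -> exists y0, [/\ y0 != 0,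
  J (x0, y0) = J z & I (x0, y0) = I z \/ I (x0, y0) = - I z].

(** An isometry and a rescaling bring every such [z] to the circle over [x0], where [V I] being
    nonzero means that [I] has nonzero derivative. The levels [c] and [- c] account for the two
    possible signs. *)
Lemma countable_vert_mscal x0 c : U x0 ->
  countable [set j | exists z, [/\ dset D z, J z = j, j != 0 & I z = c]].
Proof.
move=> Ux0.
pose h (t : R) := I (x0, circle t); pose j (t : R) := J (x0, circle t).
pose S (c : R) := [set t | h t = c /\ exists2 l, l != 0 & is_derive t 1 h l].
have cS : countable (j @` (S c `|` S (- c))).
  apply: (@sub_countable _ _ _ (S c `|` S (- c))); first exact: card_image_le.
  have -> : S c `|` S (- c) = \bigcup_(n : bool) S (if n then c else - c).
    apply/seteqP; split=> t; first by case=> h0; [exists true|exists false].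
    by case=> -[] _ h0; [left|right].
  by apply: bigcup_countable => // n _; exact: countable_level.
apply: sub_countable cS; apply: subset_card_le => _ [z [Dz <- Jz Ic]].
have [y0 [y00 Jy Iy]] := hom Ux0 Dz.
have [r [t [r0 yE]]] := polar y00.
have Dc : dset D (x0, circle t) by split=> //; exact: circle_neq0.
have Jc : j t = J z by rewrite -Jy yE /j (ray_cst (eul_vert_mscal F) Dc r0).
have Ic' : h t = I (x0, y0) by rewrite yE /h (ray_cst (eul_mscal F) Dc r0).
have dl : exists2 l, l != 0 & is_derive t 1 h l.
  exists (- (loc_s lf (x0, circle t) / (loc_E lf (x0, circle t) + loc_E lf (x0, circle t))) * J (x0, circle t)).
    rewrite mulf_neq0 ?oppr_eq0 ?mulf_neq0 ?invr_eq0 //.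
    - by rewrite gt_eqF // loc_s_gt0.
    - by rewrite gt_eqF // addr_gt0 // loc_E_gt0.
    - by rewrite -[J _]/(j t) Jc.
  by apply: (derive_circle_vert _ Ux0); exact: eul_mscal.
exists t => //; rewrite -Ic; case: Iy => Iy; [left|right]; split=> //; by rewrite Ic' Iy.
Qed.

Lemma geod_vert_mscal z0 : dset D z0 -> J z0 != 0 -> geod F J z0 = 0.
Proof.
move=> Dz0 J0.
have [sg _ sgE] := geodE_derive I Dz0.
have [w wE] := vertE_derive Dz0.
(* On this open set all values of [V I] are nonzero, which is where the count of values applies. *)
pose W := [set z | dset D z /\ J z != 0].
have Wo : open W.
  rewrite openE => z [Dz Jz]; rewrite /interior.
  have c0 : \forall z \near z, dset D z by apply: open_nbhs_nbhs; split=> //; exact: dset_open.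
  have cJ : {for z, continuous J} by apply: differentiable_continuous; exact: sf_diff.
  have c1 : \forall z \near z, J z != 0 by exact: (cvgr_neq0 _ cJ).
  by apply: filterS2 c0 c1 => u h1 h2; exact: (conj h1 h2).
rewrite sgE.
apply: (@level_curve _ _ I J W z0 sg w [set j | exists z, [/\ dset D z, J z = j, j != 0 & I z = I z0]]).
- exact: Wo.
- by [].
- by apply: smooth_on_sub (sf_smooth I) => z [].
- by move=> z [Dz _]; exact: sf_diff.
- by rewrite -sgE loc_geod_mscal (sf0E Dz0).
- by apply: countable_vert_mscal; exact: (Dz0.1 : U z0.1).
- by move=> z [Dz Jz] Iz; exists z.
- by rewrite -wE.
Qed.

Lemma jac_vert_mscal z : dset D z -> J z != 0 -> jac F z = 0.
Proof.
move=> Dz Jz.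
have [sg _ sgE] := geodE_derive I Dz.
have e : (geod F (hor F I) : sf D) z = jac F z * J z.
  by rewrite (@geod_hor_mscal A F B111 B112 B122 B222) (sfME _ _ Dz).
apply/eqP; move/eqP: e; rewrite sgE.
suff -> : 'D_sg (hor F I : sf D) z = 0.
  by rewrite eq_sym mulf_eq0 (negbTE Jz) orbF.
(* [H I = - S (V I)] vanishes on a whole neighbourhood of [z], since [V I] is nonzero there; so its
   derivative along [S] vanishes too. *)
rewrite -[RHS](derive_cst (0 : R) z sg); apply: near_eq_derive.
have c0 : \forall z \near z, dset D z by apply: open_nbhs_nbhs; split=> //; exact: dset_open.
have cJ : {for z, continuous J} by apply: differentiable_continuous; exact: sf_diff.
have c1 : \forall z \near z, J z != 0 by exact: (cvgr_neq0 _ cJ).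
apply: filterS2 c0 c1 => u Du Ju.
by rewrite (@hor_mscal A F B111 B112 B122 B222) (sfNE _ Du) (geod_vert_mscal Du Ju) oppr0.
Qed.

Lemma K_fiber_cst x y y' : U x -> y != 0 -> y' != 0 -> (loc_K : sf D) (x, y) = (loc_K : sf D) (x, y').
Proof.
move=> Ux.
have Dc (t : R) : dset D (x, circle t) by split=> //; exact: circle_neq0.
have key (s t : R) : (loc_K : sf D) (x, circle s) = (loc_K : sf D) (x, circle t).
  pose m (t : R) := loc_s lf (x, circle t) / (loc_E lf (x, circle t) + loc_E lf (x, circle t)).
  have m0 (u : R) : m u != 0.
    rewrite mulf_neq0 ?invr_eq0 ?gt_eqF //; first exact: loc_s_gt0.
    by rewrite addr_gt0 // loc_E_gt0.
  apply: (@periodic_ode_cst _ (fun t => (loc_K : sf D) (x, circle t)) (fun t => I (x, circle t)) m (pi *+ 2)).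
  - by rewrite pmulrn_lgt0 // pi_gt0.
  - move=> u; have := derive_circle_vert u Ux eul_K.
    rewrite loc_vert_K (sfNE _ (Dc u)) (sfME _ _ (Dc u)) -/(m u).
    by rewrite mulrNN mulrA.
  - by move=> u; have [] := derive_circle_vert u Ux (eul_mscal F).
  - exact: m0.
  - move=> u k0; have := derive_circle_vert u Ux (eul_mscal F).
    have [J0|J0] := eqVneq (J (x, circle u)) 0; first by rewrite J0 mulr0.
    by move: k0; rewrite (loc_KE (Dc u)) (jac_vert_mscal (Dc u) J0) mul0r eqxx.
  - by move=> u; rewrite /circle (cosD2pi u) (sinD2pi u).
move=> /polar [r [t [r0 ->]]] /polar [r' [t' [r0' ->]]].
by rewrite (ray_cst eul_K (Dc t) r0) (ray_cst eul_K (Dc t') r0').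
Qed.

End Landsberg.
End FiberConstancy.

(** * Charts and isometries *)

Section Charts.
Context {R : realType} {n : nat} (M : manifold R n).
Implicit Types (p : M) (i j k : chart_index M) (phi : M -> M).

Definition local_map phi i j : 'rV[R]_n -> 'rV[R]_n :=
  chart_map (atlas j) \o phi \o chart_inv (atlas i).

Definition local_dom phi i j : set 'rV[R]_n :=
  [set x | chart_cod (atlas i) x /\ chart_dom (atlas j) (phi (chart_inv (atlas i) x))].

Lemma local_dom_open phi i j : continuous phi -> open (local_dom phi i j).
Proof.
move=> cphi; have Co : open (chart_cod (atlas i)) by exact: chart_cod_open.
have Do : open (chart_dom (atlas j)) by exact: chart_dom_open.
have ci : {in chart_cod (atlas i), continuous (chart_inv (atlas i))}.
  by rewrite -continuous_open_subspace //; exact: chart_inv_continuous.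
rewrite openE => x [Cx Dx]; rewrite /interior.
have cx : {for x, continuous (phi \o chart_inv (atlas i))}.
  by apply: continuous_comp; [apply: ci; rewrite inE|exact: cphi].
have h1 : \forall y \near x, chart_cod (atlas i) y by apply: open_nbhs_nbhs.
have h2 : \forall y \near x, chart_dom (atlas j) (phi (chart_inv (atlas i) y)).
  by apply: cx; apply: open_nbhs_nbhs.
by apply: filterS2 h1 h2 => y a b; exact: (conj a b).
Qed.

Lemma local_dom_image phi i j : local_dom phi i j =
  chart_map (atlas i) @` (chart_dom (atlas i) `&` phi @^-1` chart_dom (atlas j)).
Proof.
apply/seteqP; split=> [x [Cx Dx]|_ [p [Dp Dq] <-]].
  exists (chart_inv (atlas i) x); last exact: chart_invK.
  by split; [exact: chart_inv_dom|].
by split; [exact: chart_map_cod|rewrite chart_mapK].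
Qed.

Lemma local_map_smooth phi i j : smooth_map phi -> smooth_on (local_dom phi i j) (local_map phi i j).
Proof. by move=> [_ h]; rewrite local_dom_image; exact: h. Qed.

Lemma local_dom_map phi i j p : chart_dom (atlas i) p -> chart_dom (atlas j) (phi p) ->
  local_dom phi i j (chart_map (atlas i) p).
Proof. by move=> Dp Dq; split; [exact: chart_map_cod|rewrite chart_mapK]. Qed.

Lemma local_map_diff phi i j p : smooth_map phi ->
  chart_dom (atlas i) p -> chart_dom (atlas j) (phi p) ->
  differentiable (local_map phi i j) (chart_map (atlas i) p).
Proof.
move=> sphi Dp Dq; apply: (@smooth_on_diff _ _ _ (local_dom phi i j)).
  exact: local_map_smooth.
exact: local_dom_map.
Qed.

Lemma smooth_map_id : smooth_map (idfun : M -> M).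
Proof. by split=> [x|i j]; [exact: cvg_id|exact: atlas_smooth]. Qed.

(** Taking [idfun] for one or both maps covers changes of coordinates, so components of vectors and
    tangent maps obey a single chain rule. *)
Lemma local_map_comp phi psi i j k p y : smooth_map phi -> smooth_map psi ->
  chart_dom (atlas i) p -> chart_dom (atlas j) (phi p) -> chart_dom (atlas k) (psi (phi p)) ->
  'd (local_map (psi \o phi) i k) (chart_map (atlas i) p) y =
  'd (local_map psi j k) (chart_map (atlas j) (phi p))
     ('d (local_map phi i j) (chart_map (atlas i) p) y).
Proof.
move=> sphi spsi Di Dj Dk.
have d1 := local_map_diff sphi Di Dj; have d2 := local_map_diff spsi Dj Dk.
have e : local_map phi i j (chart_map (atlas i) p) = chart_map (atlas j) (phi p).
  by rewrite /local_map /= chart_mapK.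
rewrite -e in d2 *.
have dc := differentiable_comp d1 d2.
have near_e : \forall x \near chart_map (atlas i) p,
    (local_map psi j k \o local_map phi i j) x = local_map (psi \o phi) i k x.
  have : \forall x \near chart_map (atlas i) p, local_dom phi i j x.
    by apply: open_nbhs_nbhs; split; [exact: local_dom_open sphi.1|exact: local_dom_map].
  by apply: filterS => x [_ Dx]; rewrite /local_map /= chart_mapK.
have [_ de] := near_eq_is_diff near_e dc.
have de' := diff_comp d1 d2.
exact: etrans (congr1 (fun h : 'rV[R]_n -> 'rV[R]_n => h y) de)
  (congr1 (fun h : 'rV[R]_n -> 'rV[R]_n => h y) de').
Qed.

Lemma local_map_idE i p y : chart_dom (atlas i) p ->
  'd (local_map idfun i i) (chart_map (atlas i) p) y = y.
Proof.
move=> Di.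
have near_e : \forall x \near chart_map (atlas i) p, x = local_map idfun i i x.
  have : \forall x \near chart_map (atlas i) p, chart_cod (atlas i) x.
    by apply: open_nbhs_nbhs; split; [exact: chart_cod_open|exact: chart_map_cod].
  by apply: filterS => x Cx; rewrite /local_map /= chart_invK.
have [did vid] := is_diff_id (chart_map (atlas i) p).
have [_ de] := near_eq_is_diff (f := id) near_e did.
exact: etrans (congr1 (fun h : 'rV[R]_n -> 'rV[R]_n => h y) de)
  (congr1 (fun h : 'rV[R]_n -> 'rV[R]_n => h y) vid).
Qed.

Lemma vec_of_compE i p y j : chart_dom (atlas j) p ->
  vec_of_comp i p y j = 'd (local_map idfun i j) (chart_map (atlas i) p) y.
Proof. by move=> Dj; rewrite /vec_of_comp asboolT. Qed.

Lemma vec_of_comp_out i p y j : ~ chart_dom (atlas j) p -> vec_of_comp i p y j = 0.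
Proof. by move=> nDj; rewrite /vec_of_comp asboolF. Qed.

Lemma vec_of_comp_diag i p y : chart_dom (atlas i) p -> vec_of_comp i p y i = y.
Proof. by move=> Di; rewrite vec_of_compE // local_map_idE. Qed.

Lemma vec_of_comp_tangent i p y : chart_dom (atlas i) p -> tangent p (vec_of_comp i p y).
Proof.
move=> Di; split=> [j k Dj Dk|j]; last exact: vec_of_comp_out.
rewrite !vec_of_compE //.
exact: (@local_map_comp idfun idfun i j k p y smooth_map_id smooth_map_id Di Dj Dk).
Qed.

Lemma tangent_comp i p v : chart_dom (atlas i) p -> tangent p v -> v = vec_of_comp i p (v i).
Proof.
move=> Di [h1 h2]; apply/funext => j.
have [Dj|nDj] := pselect (chart_dom (atlas j) p); last by rewrite h2 // vec_of_comp_out.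
by rewrite vec_of_compE //; exact: h1.
Qed.

Lemma vec_of_compZ i p (a : R) y : vec_of_comp i p (a *: y) = a *: vec_of_comp i p y.
Proof.
apply/funext => j; have [Dj|nDj] := pselect (chart_dom (atlas j) p).
  by rewrite fctE !vec_of_compE // linearZZ.
by rewrite fctE !vec_of_comp_out // scaler0.
Qed.

Lemma vec_of_comp0 i p : vec_of_comp i p 0 = 0.
Proof. by rewrite -(scale0r 0) vec_of_compZ scale0r. Qed.

Lemma tangent_mapE phi p v k : chart_dom (atlas k) (phi p) ->
  tangent_map phi p v k = 'd (local_map phi (chart_around p) k)
    (chart_map (atlas (chart_around p)) p) (v (chart_around p)).
Proof. by move=> Dk; rewrite /tangent_map asboolT. Qed.

(** Frees [tangent_map] from its chosen chart: computed through that chart or through [j], the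
    [k]-component is the differential of [local_map phi i k]. *)
Lemma tangent_map_comp phi i j p y : smooth_map phi ->
  chart_dom (atlas i) p -> chart_dom (atlas j) (phi p) ->
  tangent_map phi p (vec_of_comp i p y) =
  vec_of_comp j (phi p) ('d (local_map phi i j) (chart_map (atlas i) p) y).
Proof.
move=> sphi Di Dj; apply/funext => k.
have [Dk|nDk] := pselect (chart_dom (atlas k) (phi p)); last first.
  by rewrite vec_of_comp_out // /tangent_map asboolF.
have Dc : chart_dom (atlas (chart_around p)) p by exact: (svalP (cid (atlas_cover p))).
transitivity ('d (local_map idfun j k) (chart_map (atlas j) (phi p))
    ('d (local_map phi i j) (chart_map (atlas i) p) y)); last first.
  by apply: esym; exact: vec_of_compE.
transitivity ('d (local_map phi (chart_around p) k) (chart_map (atlas (chart_around p)) p)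
    ('d (local_map idfun i (chart_around p)) (chart_map (atlas i) p) y)).
  have t1 := tangent_mapE (vec_of_comp i p y) Dk; have t2 := vec_of_compE i y Dc.
  by rewrite t1 t2.
transitivity ('d (local_map phi i k) (chart_map (atlas i) p) y).
  exact: esym (@local_map_comp idfun phi i (chart_around p) k p y smooth_map_id sphi Di Dc Dk).
exact: (@local_map_comp phi idfun i j k p y sphi smooth_map_id Di Dj Dk).
Qed.

End Charts.

Section Surface.
Context {R : realType} (M : manifold R 2) (F : finsler M).
Implicit Types (p q : M) (i j : chart_index M) (phi : M -> M).

Local Notation L := (local_expr F).
Local Notation cod i := (chart_cod (atlas i)).

Lemma local_expr_homog i x y (a : R) : cod i x -> 0 < a -> L i (x, a *: y) = a * L i (x, y).
Proof.
move=> Cx a0; rewrite /local_expr /= vec_of_compZ; apply: finsler_homog => //.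
exact/vec_of_comp_tangent/chart_inv_dom.
Qed.

Lemma chart_finsler i : local_finsler (cod i) (L i).
Proof.
split; [exact: chart_cod_open|exact: finsler_smooth|exact: local_expr_homog|exact: finsler_posdef].
Qed.

Lemma sub_finsler i (U : set 'rV[R]_2) : open U -> U `<=` cod i -> local_finsler U (L i).
Proof.
move=> Uo UC; split => //.
- by apply: smooth_on_sub (@finsler_smooth _ _ _ F i) => z [/UC].
- by move=> x y a /UC; exact: local_expr_homog.
- by move=> z u /UC; exact: finsler_posdef.
Qed.

(** A common form for isometries and for the identity, the latter giving the changes of chart. *)
Definition preserves phi := smooth_map phi /\
  forall p v, tangent p v -> F (phi p) (tangent_map phi p v) = F p v.

Lemma preserves_id : preserves idfun.
Proof.
split=> [|p v tv]; first exact: smooth_map_id.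
have Dc : chart_dom (atlas (chart_around p)) p by exact: (svalP (cid (atlas_cover p))).
rewrite {1}(tangent_comp Dc tv) (tangent_map_comp _ (smooth_map_id M) Dc Dc) local_map_idE //.
by rewrite -(tangent_comp Dc tv).
Qed.

Lemma local_expr_map phi i j x y : preserves phi -> local_dom phi i j x ->
  L j (local_map phi i j x, 'd (local_map phi i j) x y) = L i (x, y).
Proof.
move=> [sphi pres] [Cx Dj].
have Di := chart_inv_dom Cx.
have e : chart_inv (atlas j) (local_map phi i j x) = phi (chart_inv (atlas i) x).
  by rewrite /local_map /= chart_mapK.
rewrite /local_expr /= e -[X in 'd _ X](chart_invK Cx) -(tangent_map_comp _ sphi Di Dj).
by rewrite pres //; exact: vec_of_comp_tangent.
Qed.

Local Notation D i := (slit (lf_open (chart_finsler i))).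
Local Notation Fd i := (loc_fdata (chart_finsler i)).
Local Notation I i := (mscal (Fd i) : sf (D i)).
Local Notation J i := (vert (Fd i) (mscal (Fd i)) : sf (D i)).
Local Notation K i := (loc_K (chart_finsler i) : sf (D i)).

Lemma diff_id_row (x y : 'rV[R]_2) : 'd (id : 'rV[R]_2 -> 'rV[R]_2) x y = y.
Proof. by have [_ ->] := is_diff_id x. Qed.

Lemma sign_trans (a b c : R) : a = b \/ a = - b -> a = c \/ a = - c -> b = c \/ b = - c.
Proof.
case=> -> [] h; [left|right|right|left] => //; last exact: oppr_inj.
by rewrite -h opprK.
Qed.

(** The invariants attached to chart [i] live on its full image, but the map is defined only on
    [local_dom phi i j]. Both charts are compared with the metric restricted to that set: chart [i]
    through the inclusion, chart [j] through the map. *)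
Lemma chart_invariance phi i j x y : preserves phi -> local_dom phi i j x -> y != 0 ->
  let z' := (local_map phi i j x, 'd (local_map phi i j) x y) in
  [/\ z'.2 != 0, J i (x, y) = J j z', I i (x, y) = I j z' \/ I i (x, y) = - I j z' &
      K i (x, y) = K j z'].
Proof.
move=> pres Ux y0 z'.
pose U := local_dom phi i j.
have Uo : open U by apply: local_dom_open; exact: pres.1.1.
have UC : U `<=` cod i by move=> u [].
have lfU := sub_finsler Uo UC.
have Dz : dset (slit (lf_open lfU)) (x, y) by [].
have s1 : smooth_on U (local_map phi i j) by apply: local_map_smooth; exact: pres.1.
have m1 u : U u -> cod j (local_map phi i j u).
  by move=> [Cu Du]; exact: chart_map_cod.
have l1 u v : U u -> v != 0 -> L j (local_map phi i j u, 'd (local_map phi i j) u v) = L i (u, v).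
  by move=> Uu _; exact: local_expr_map.
have s2 : smooth_on U (id : 'rV[R]_2 -> 'rV[R]_2).
  apply/smooth_onP => m; case: m => [|m].
    by split=> // u _; case: (is_diff_id u).
  split=> [u _|v]; first by case: (is_diff_id u).
  have -> : 'D_v (id : 'rV[R]_2 -> 'rV[R]_2) = cst v by apply/funext => u; rewrite derive_id.
  exact: Ck_cst.
have l2 u v : U u -> v != 0 -> L i (id u, 'd (id : 'rV[R]_2 -> 'rV[R]_2) u v) = L i (u, v).
  by move=> _ _; rewrite diff_id_row.
have tid : tmap (id : 'rV[R]_2 -> 'rV[R]_2) (x, y) = (x, y) by rewrite /tmap diff_id_row.
have z'0 : z'.2 != 0 by by have [_] := tmapD (chart_finsler j) m1 l1 Dz.
have Di : dset (D i) (x, y) by split=> //; exact: UC.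
have Dj : dset (D j) z' by split=> //; exact: m1.
have ez : tmap (local_map phi i j) (x, y) = z' by [].
have i1 := mscal_tmap (chart_finsler j) s1 m1 l1 Dz.
have i2 := mscal_tmap (chart_finsler i) s2 UC l2 Dz.
have v1 := vert_mscal_tmap (chart_finsler j) s1 m1 l1 Dz.
have v2 := vert_mscal_tmap (chart_finsler i) s2 UC l2 Dz.
have f1 := flag_tmap (chart_finsler j) s1 m1 l1 Dz.
have f2 := flag_tmap (chart_finsler i) s2 UC l2 Dz.
rewrite tid in i2 v2 f2; rewrite ez in i1 v1 f1.
split=> //.
- exact: etrans (esym v2) v1.
- exact: sign_trans i2 i1.
- apply: etrans (loc_KE Di) _; apply: etrans (esym f2) _; apply: etrans f1 _.
  exact: esym (loc_KE Dj).
Qed.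

End Surface.

(** * Isotropy of the flag curvature *)

Section Isotropy.
Context {R : realType} (M : manifold R 2) (F : finsler M).
Hypotheses (hom : homogeneous F) (land : landsberg_metric F).
Implicit Types (p q : M) (i j : chart_index M).

Local Notation L := (local_expr F).
Local Notation cod i := (chart_cod (atlas i)).
Local Notation D i := (slit (lf_open (chart_finsler F i))).
Local Notation K i := (loc_K (chart_finsler F i) : sf (D i)).

Lemma chart_landsberg i z u v w : dset (D i) z -> landsberg (L i) z u v w = 0.
Proof.
case: z => x y [/= Cx y0].
have Di := chart_inv_dom Cx; set p := chart_inv (atlas i) x in Di.
have t a : tangent p (vec_of_comp i p a) by exact: vec_of_comp_tangent.
have ny : vec_of_comp i p y <> 0.
  move=> e; move/eqP: y0; apply; rewrite -(vec_of_comp_diag y Di).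
  exact: (congr1 (fun f => f i) e).
have h := land (t y) ny (t u) (t v) (t w) Di.
have ex : chart_map (atlas i) p = x by exact: chart_invK.
by rewrite ex !(vec_of_comp_diag _ Di) in h.
Qed.

Lemma isometry_preserves phi : isometry F phi -> preserves F phi.
Proof. by move=> [[psi [? _ _ _]] h]. Qed.

Lemma K_chart_cst i x y y' : cod i x -> y != 0 -> y' != 0 -> K i (x, y) = K i (x, y').
Proof.
apply: K_fiber_cst; first by move=> z u v w; exact: chart_landsberg.
move=> x0 [z1 z2] Cx0 [/= Cz z0].
(* The isometry joins two points of the same chart, so a single local expression is compared with
   itself. *)
have [phi iso e] := hom (chart_inv (atlas i) z1) (chart_inv (atlas i) x0).
have Uz : local_dom phi i i z1 by split=> //; rewrite e; exact: chart_inv_dom.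
have ex : local_map phi i i z1 = x0 by rewrite /local_map /= e chart_invK.
have [n0 hJ hI _] := chart_invariance (isometry_preserves iso) Uz z0.
exists ('d (local_map phi i i) z1 z2); rewrite -ex; split=> //.
  by case: hI => h; [left|right; rewrite h opprK].
Qed.

Lemma K_chart_change i j p y y' : chart_dom (atlas i) p -> chart_dom (atlas j) p ->
  y != 0 -> y' != 0 -> K i (chart_map (atlas i) p, y) = K j (chart_map (atlas j) p, y').
Proof.
move=> Di Dj y0 y'0.
have Ux := @local_dom_map _ _ M idfun i j p Di Dj.
have [n0 _ _ e] := chart_invariance (preserves_id F) Ux y0; apply: etrans e _.
have ex : local_map idfun i j (chart_map (atlas i) p) = chart_map (atlas j) p.
  by rewrite /local_map /= chart_mapK.
rewrite ex in n0 *; apply: K_chart_cst => //; exact: chart_map_cod.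
Qed.

Lemma flag_det_neq0 i p y u : chart_dom (atlas i) p -> tangent p y -> tangent p u ->
  y <> 0 -> lin_indep y u -> y i 0 i0 * u i 0 i1 - y i 0 i1 * u i 0 i0 != 0.
Proof.
move=> Di ty tu y0 li; apply/eqP => d0.
have rel a b : a *: y i + b *: u i = 0 -> a = 0 /\ b = 0.
  move=> e; apply: li; rewrite (tangent_comp Di ty) (tangent_comp Di tu).
  have -> : a = - (- a) by rewrite opprK.
  have e' : b *: u i = (- a) *: y i by apply/eqP; rewrite scaleNr -addr_eq0 addrC e.
  by rewrite -(vec_of_compZ i p b) e' vec_of_compZ -scalerDl addNr scale0r.
apply: y0; rewrite (tangent_comp Di ty).
suff -> : y i = 0 by exact: vec_of_comp0.
apply/rowP => k; rewrite mxE.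
(* When the determinant is zero, [- u_k y + y_k u] vanishes for each [k], so independence forces
   every [y_k] to be 0. *)
have [_ ->//] : - u i 0 k = 0 /\ y i 0 k = 0.
apply: rel; apply/rowP => l; rewrite !mxE.
move: d0; move: (y i) (u i) => a b d0.
case: (I2P k) => ->; case: (I2P l) => ->.
- ring.
- by rewrite -[RHS]d0; ring.
- by rewrite -[RHS]oppr0 -[in RHS]d0; ring.
- ring.
Qed.

End Isotropy.

Theorem theorem1p2 (R : realType) (M : manifold R 2) (F : finsler M)
  (hom : homogeneous F) (land : landsberg_metric F) :
  isotropic_flag_curvature F.
Proof.
pose e1 : 'rV[R]_2 := delta_mx 0 i0.
have e10 : e1 != 0.
  by apply/eqP => /rowP /(_ i0); rewrite !mxE /= => /eqP; rewrite oner_eq0.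
(* The chart and the flagpole [e1] are arbitrary choices; [K_chart_change] shows that the value does
   not depend on them. *)
exists (fun p => (loc_K (chart_finsler F (chart_around p)) : sf _)
  (chart_map (atlas (chart_around p)) p, e1)).
move=> p y ty y0 u tu li i Di.
have Dc : chart_dom (atlas (chart_around p)) p by exact: (svalP (cid (atlas_cover p))).
have yi : y i != 0.
  by apply/eqP => e; apply: y0; rewrite (tangent_comp Di ty) e vec_of_comp0.
have Dz : dset (slit (lf_open (chart_finsler F i))) (chart_map (atlas i) p, y i).
  by split=> //; exact: chart_map_cod.
apply: etrans (flag_curvE Dz (flag_det_neq0 Di ty tu y0 li)) _.
apply: etrans (esym (loc_KE Dz)) _.
exact: K_chart_change.
Qed.
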